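(* Let $b=\infty$ and let $q\in L^\infty((0,\infty))$ be real-valued, with $m$-function $m$ and $A$-amplitude $A$. Suppose $\kappa>0$ satisfies $\kappa^2>\|q\|_\infty$. Then $$m(-\kappa^2)=-\kappa-\int_0^\infty A(\alpha)e^{-2\alpha\kappa}\,d\alpha$$ (with a convergent integral and no error term).
   Context: For $z\in\mathbb C\setminus[-\|q\|_\infty,\infty)$, $m(z)=u'(0_+,z)/u(0_+,z)$, where $u(\cdot,z)$ is the (unique up to constants) nonzero solution of $-u''+qu=zu$ on $(0,\infty)$ that is square integrable near $\infty$. $A$-amplitude: the (unique) function $A$ on $[0,\infty)$ with $A\in L^1((0,a))$ for all $a<\infty$ such that for all $a>0$, $\varepsilon>0$, $m(-\kappa^2)=-\kappa-\int_0^aA(\alpha)e^{-2\alpha\kappa}d\alpha+\tilde O(e^{-2a\kappa})$ as $|\kappa|\to\infty$ with $-\frac\pi2+\varepsilon<\arg\kappa<-\varepsilon$, where $f=\tilde O(g)$ means $g\to0$ and $(f/g)|g|^\eta\to0$ for all $\eta>0$. Its existence is known. *)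

(* Defs.v *)
From HB Require Import structures.
From mathcomp Require Import all_boot all_order all_algebra.
From mathcomp Require Import all_classical all_reals all_analysis.
From mathcomp Require Import complex.
Set Implicit Arguments.
Unset Strict Implicit.
Unset Printing Implicit Defensive.
Import Order.TTheory GRing.Theory Num.Theory.
Import numFieldNormedType.Exports.
Import ComplexField.Normc.

Local Open Scope classical_set_scope.
Local Open Scope complex_scope.
Local Open Scope ring_scope.

(* 'Re and Re belong to the numClosedField structure and are R[i]-valued. *)
Local Notation re := complex.Re.
Local Notation im := complex.Im.

(* Complex-valued functions are differentiated and integrated componentwise.
   Limits in the complex plane are taken in R[i]^o, the complex field with the
   topology of its modulus; normc z : R is the modulus of z. *)
Section ComplexCalculus.
Variable R : realType.
Notation mu := (@lebesgue_measure R).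

Definition cexp (z : R[i]) : R[i] :=
  (expR (re z) * cos (im z)) +i* (expR (re z) * sin (im z)).

Definition cderivable (f : R -> R[i]) (x : R) : Prop :=
  derivable (fun t => re (f t)) x 1 /\ derivable (fun t => im (f t)) x 1.

Definition cderive (f : R -> R[i]) (x : R) : R[i] :=
  derive1 (fun t => re (f t)) x +i* derive1 (fun t => im (f t)) x.

Definition cintegrable (D : set R) (f : R -> R[i]) : Prop :=
  mu.-integrable D (fun x => (re (f x))%:E) /\
  mu.-integrable D (fun x => (im (f x))%:E).

Definition cintegral (D : set R) (f : R -> R[i]) : R[i] :=
  (\int[mu]_(x in D) re (f x)) +i* (\int[mu]_(x in D) im (f x)).

Definition absolutely_continuous (a b : R) (f : R -> R[i]) : Prop :=
  forall e : R, 0 < e -> exists2 d : R, 0 < d &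
    forall (n : nat) (s t : 'I_n -> R),
      (forall i, [/\ a <= s i, s i <= t i & t i <= b]) ->
      trivIset setT (fun i => `]s i, t i[%classic) ->
      \sum_(i < n) (t i - s i) < d ->
      \sum_(i < n) normc (f (t i) - f (s i)) < e.

Definition loc_absolutely_continuous (f : R -> R[i]) : Prop :=
  forall a b : R, 0 < a -> a < b -> absolutely_continuous a b f.

(* f = \tilde O(g) along the filter F *)
Definition tildeO (F : set_system R[i]) (f g : R[i] -> R[i]) : Prop :=
  (g k @[k --> F] --> (0 : R[i]^o)) /\
  forall eta : R, 0 < eta ->
    ((f k / g k) * (normc (g k) `^ eta)%:C) @[k --> F] --> (0 : R[i]^o).

(* - pi / 2 + eps < arg k < - eps *)
Definition sector (eps : R) : set R[i] :=
  [set k | exists r t : R, [/\ 0 < r, - (pi / 2) + eps < t, t < - eps &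
    k = (r * cos t) +i* (r * sin t)]].

(* |k| -> oo within the sector *)
Definition sector_infty (eps : R) : set_system R[i] :=
  filter_from setT (fun M : R => [set k | sector eps k /\ M < normc k]).

End ComplexCalculus.

Section HalfLine.
Variable R : realType.
Notation mu := (@lebesgue_measure R).
Notation half_line := (`]0, +oo[%classic : set R).

Definition ess_norm (q : R -> R) : \bar R :=
  'N[mu]_+oo [EFin \o (q \_ half_line)].

Definition Linfty (q : R -> R) : Prop :=
  measurable_fun half_line q /\ (ess_norm q < +oo)%E.

(* z lies off the ray [- ||q||_oo, +oo[ *)
Definition off_ray (q : R -> R) (z : R[i]) : Prop :=
  ~ (im z = 0 /\ (- ess_norm q <= (re z)%:E)%E).

(* As q is only essentially bounded, - u'' + q u = z u is understood in the
   Caratheodory sense: u and u' are locally absolutely continuous and the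
   equation holds almost everywhere. *)
Definition solution (q : R -> R) (z : R[i]) (u : R -> R[i]) : Prop :=
  [/\ forall x, 0 < x -> cderivable u x,
      loc_absolutely_continuous u,
      loc_absolutely_continuous (cderive u) &
      {ae mu, forall x, 0 < x -> cderivable (cderive u) x /\
         - cderive (cderive u) x + (q x)%:C * u x = z * u x}].

Definition L2_near_infty (u : R -> R[i]) : Prop :=
  exists2 c : R, 0 < c &
    mu.-integrable `]c, +oo[ (fun x => (normc (u x) ^+ 2)%:E).

Definition weyl_solution (q : R -> R) (z : R[i]) (u : R -> R[i]) : Prop :=
  [/\ solution q z u, exists2 x, 0 < x & u x != 0 & L2_near_infty u].

Definition at0 (f : R -> R[i]) : R[i] :=
  lim ((f x : R[i]^o) @[x --> (0 : R)^'+]).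

(* The Weyl solution is unique up to a constant factor, so that all of them
   yield the same quotient. *)
Definition m_function (q : R -> R) (m : R[i] -> R[i]) : Prop :=
  forall z, off_ray q z -> forall u, weyl_solution q z u ->
    m z = at0 (cderive u) / at0 u.

Definition A_amplitude (m : R[i] -> R[i]) (A : R -> R[i]) : Prop :=
  (forall a : R, 0 < a -> cintegrable `]0, a[ A) /\
  (forall a eps : R, 0 < a -> 0 < eps ->
    tildeO (sector_infty eps)
      (fun k => m (- k ^+ 2) -
         (- k - cintegral `]0, a[ (fun x => A x * cexp (- (2 * x)%:C * k))))
      (fun k => cexp (- (2 * a)%:C * k))).

End HalfLine.

(* Main.v *)
(* Write m(-k^2) = -k - F(0), where F(x) is the same quantity for the potential
   translated by x.  The Riccati equation for the m-function makes F solve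
     F(x) = \int_0^oo e^(-2ek) (q(x + e) - F(x + e)^2) de,
   and this is a Laplace transform of an equation in which F^2 becomes a
   convolution.  For c = ||q||_oo < kappa^2, Picard iteration of the latter in
   the weighted space L^1(e^(-2 kappa a) da) is dominated by the scalar
   iteration M -> (c + M^2) / (2 kappa), whose fixed point
   M = kappa - sqrt(kappa^2 - c) is less than kappa.  This gives a function A0
   with \int_0^oo |A0(a)| e^(-2 kappa a) da <= M such that
     m(-k^2) = -k - \int_0^oo A0(a) e^(-2ak) da   whenever Re k >= kappa;
   conversely, a solution F of the fixed point equation with |F| <= M < Re k
   yields the square integrable solution u = exp(\int (-k - F)).
   It remains to see that A = A0.  Both satisfy the defining asymptotics of the
   A-amplitude, so B = A - A0 on ]0, a[ satisfies
     \int B(x) e^(2 (a - x) t w) dx = O(e^(eta t))   for every eta > 0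
   along a ray t w inside the sector.  Integrating against the Gaussian
   e^(- (w t)^2) dt turns the complex exponentials into real ones,
     \int B(x) e^(L s(x)^2) dx = O(e^(eta L)) with s(x) = 2 (a - x),
   and Mikusinski's argument (expand 1 - exp(- e^(L (s^2 - y))) into a series
   and let L -> oo) shows that the integrals of B over all ]0, x[ vanish. *)
Require Import Defs.
From HB Require Import structures.
From mathcomp Require Import all_boot all_order all_algebra.
From mathcomp Require Import all_classical all_reals all_analysis.
From mathcomp Require Import measurable_realfun ess_sup_inf complex ring lra.
Set Implicit Arguments.
Unset Strict Implicit.
Unset Printing Implicit Defensive.
Import Order.TTheory GRing.Theory Num.Theory.
Import numFieldNormedType.Exports.
Import ComplexField.Normc.

Local Open Scope classical_set_scope.
Local Open Scope complex_scope.
Local Open Scope ring_scope.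

Local Notation re := complex.Re.
Local Notation im := complex.Im.

(** The defining asymptotics say nothing at [kappa] itself: they concern |k| -> oo in a sector that
    excludes the real axis, and they carry an error term. The exact formula therefore has to come
    from a construction valid for all Re k >= kappa, and the asymptotics serve only to identify its
    density with A. The space L^1 suits the iteration because the convolution that replaces F^2 is
    submultiplicative there, and because one density, built without reference to k, then serves
    every k at once. The obstacle in the identification is that Mikusinski's argument wants real
    exponentials while the transform is controlled on a non-real ray only. For Re (w^2) > 0 the
    integral of e^(x r w - (w r)^2) over r is e^(x^2 / 4) times a nonzero constant independent of x,
    so a Gaussian average removes w, at the price of replacing s(x) by its square; this loses
    nothing because s > 0 on ]0, a[. The condition on w leaves the directions -pi/4 < arg w < 0 of
    the sector. A convergence argument for integrals thus does the work for which one would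
    otherwise invoke growth theorems for entire functions. *)

(** * Translations of Lebesgue measure *)

Section Translation.
Variable R : realType.
Notation mu := (@lebesgue_measure R).

Lemma measurable_shift (a : R) :
  measurable_fun setT (fun x : measurableTypeR R => x + a : measurableTypeR R).
Proof.
apply: continuous_measurable_fun => x /=.
by apply: cvgD; [exact: cvg_id|exact: cvg_cst].
Qed.

(** Lebesgue measure is characterised by its values on half-open intervals, so only their preimages
    have to be measured. *)
Lemma lebesgue_measure_shift (a : R) (A : set (measurableTypeR R)) :
  measurable A -> pushforward mu (fun x : measurableTypeR R => x + a : measurableTypeR R) A = mu A.
Proof.
move=> mA.
pose f := (fun x : measurableTypeR R => x + a : measurableTypeR R).
have mf : measurable_fun setT f := measurable_shift a.
(* Bundling [f] equips its pushforward with the measure structure that the uniqueness theorem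
   takes. *)
pose f' := [the {mfun (measurableTypeR R) >-> (measurableTypeR R)} of
  HB.pack_for {mfun (measurableTypeR R) >-> (measurableTypeR R)} f (isMeasurableFun.Build _ _ _ _ _ mf)].
rewrite -[LHS]/(pushforward mu f' A).
apply/esym/lebesgue_measure_unique => // X [[u v]] /= _ <-.
rewrite /pushforward.
have -> : f @^-1` `]u, v] = `]u - a, v - a]%classic.
  by apply/seteqP; split => x /=; rewrite !in_itv/= /f ltrBlDr lerBrDr.
rewrite !lebesgue_measure_itv/= !lte_fin ltrD2r.
by case: ifP => // _; rewrite -!EFinB; congr EFin; ring.
Qed.

Local Open Scope ereal_scope.

Lemma ge0_integral_shift (a : R) (f : measurableTypeR R -> \bar R) :
  measurable_fun setT f -> (forall x, 0 <= f x) ->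
  \int[mu]_x f (x + a)%R = \int[mu]_x f x.
Proof.
move=> mf f0; have ms := measurable_shift a.
have -> : \int[mu]_x f x = \int[pushforward mu (fun x : measurableTypeR R => (x + a)%R : measurableTypeR R)]_x f x.
  by apply: eq_measure_integral => A mA _; exact/esym/lebesgue_measure_shift.
by rewrite ge0_integral_pushforward.
Qed.

Lemma integral_shift (a : R) (f : measurableTypeR R -> \bar R) : measurable_fun setT f ->
  \int[mu]_x f (x + a)%R = \int[mu]_x f x.
Proof.
move=> mf; rewrite integralE [RHS]integralE; congr (_ - _).
- have := ge0_integral_shift a (measurable_funepos mf) (funepos_ge0 f).
  by move=> <-; congr (integral _ _ _); exact: (funepos_comp f (fun x => x + a)%R).
- have := ge0_integral_shift a (measurable_funeneg mf) (funeneg_ge0 f).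
  by move=> <-; congr (integral _ _ _); exact: (funeneg_comp f (fun x => x + a)%R).
Qed.

Section Skew.
Context d (T : measurableType d) (m : {sigma_finite_measure set T -> \bar R}).
Variables (s : T -> R) (ms : measurable_fun setT s).

Let measurable_skew (W : measurableTypeR R * T -> \bar R) :
  measurable_fun setT W ->
  measurable_fun setT (fun z : measurableTypeR R * T => W ((z.1 - s z.2)%R, z.2)).
Proof.
move=> mW; apply: (measurableT_comp mW); apply/measurable_fun_pairP; split => /=.
  apply: measurable_funB; first exact: measurable_fst.
  by apply: measurableT_comp => //; exact: measurable_snd.
exact: measurable_snd.
Qed.

(** Tonelli lets a be integrated first, and for fixed p the skew map is a translation. This is the
    substitution that turns a convolution into a product of Laplace transforms. *)
Lemma ge0_integral_skew (W : measurableTypeR R * T -> \bar R) :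
  measurable_fun setT W -> (forall z, 0 <= W z) ->
  \int[mu]_a \int[m]_p W ((a - s p)%R, p) = \int[mu]_e \int[m]_p W (e, p).
Proof.
move=> mW W0.
rewrite (fubini_tonelli (m1 := mu) (m2 := m) _ (measurable_skew mW) (fun=> W0 _)).
rewrite (fubini_tonelli W mW W0); apply: eq_integral => p _.
by rewrite (ge0_integral_shift (- s p) (f := fun e : measurableTypeR R => W (e, p)))//; exact: measurableT_comp.
Qed.

End Skew.
End Translation.

(** * Dominated convergence for real integrals *)

Section RealDCT.
Context d (T : measurableType d) (R : realType) (mu : {measure set T -> \bar R}).

(** The dominating function is extended-real because the one used later, the sum of a series, may be
    infinite on a null set. *)
Lemma Rintegral_dominated (f_ : nat -> T -> R) (f : T -> R) (g : T -> \bar R) :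
  (forall n, measurable_fun setT (f_ n)) -> measurable_fun setT f ->
  {ae mu, forall x, f_ n x @[n --> \oo] --> f x} ->
  mu.-integrable setT g ->
  {ae mu, forall x, forall n, (`|f_ n x|%:E <= g x)%E} ->
  mu.-integrable setT (EFin \o f) /\
  \int[mu]_x f_ n x @[n --> \oo] --> \int[mu]_x f x.
Proof.
move=> mf_ mf ff ig fg.
have [|||||] := @dominated_convergence _ _ _ mu setT measurableT (fun n => EFin \o f_ n) (EFin \o f) g.
- by move=> n; exact/measurable_EFinP.
- exact/measurable_EFinP.
- by apply: filterS ff => x fx _; apply: cvg_EFin => //; exact: nearW.
- exact: ig.
- by apply: filterS fg => x fx n _; exact: fx.
move=> ifi _ h; split=> //.
apply: fine_cvg.
by rewrite fineK//; exact: integrable_fin_num.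
Qed.

End RealDCT.

(** * Complex-valued functions *)

Section ComplexBasics.
Variable R : realType.
Implicit Types (z w : R[i]) (x y : R).

Lemma normc_ge0 z : 0 <= normc z.
Proof. by case: z => a b; exact: sqrtr_ge0. Qed.

Lemma sqr_normc z : normc z ^+ 2 = re z ^+ 2 + im z ^+ 2.
Proof. by case: z => a b /=; rewrite sqr_sqrtr// addr_ge0// sqr_ge0. Qed.

Lemma normcD z w : normc (z + w) <= normc z + normc w.
Proof. by have := ler_normD z w; rewrite -lecR rmorphD. Qed.

Lemma normcN z : normc (- z) = normc z.
Proof. by case: z => a b /=; rewrite !sqrrN. Qed.

Lemma normcB z w : normc (z - w) <= normc z + normc w.
Proof. by rewrite (le_trans (normcD _ _))// normcN. Qed.

Lemma normcr x : normc (x%:C) = `|x|.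
Proof. by rewrite /= expr0n addr0 sqrtr_sqr. Qed.

Lemma normr_re z : `|re z| <= normc z.
Proof. by case: z => a b /=; rewrite -sqrtr_sqr ler_wsqrtr// lerDl sqr_ge0. Qed.

Lemma normr_im z : `|im z| <= normc z.
Proof. by case: z => a b /=; rewrite -sqrtr_sqr ler_wsqrtr// lerDr sqr_ge0. Qed.

Lemma normc_le_reim z : normc z <= `|re z| + `|im z|.
Proof.
case: z => a b /=; rewrite -[leRHS]ger0_norm ?addr_ge0// -[leRHS]sqrtr_sqr ler_wsqrtr//.
by rewrite sqrrD !real_normK ?num_real// addrAC lerDl mulrn_wge0// mulr_ge0.
Qed.

Lemma re_le_normc z : re z <= normc z.
Proof. exact: le_trans (ler_norm _) (normr_re z). Qed.

Lemma reM z w : re (z * w) = re z * re w - im z * im w.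
Proof. by case: z; case: w. Qed.

Lemma imM z w : im (z * w) = re z * im w + im z * re w.
Proof. by case: z; case: w. Qed.

Lemma reD z w : re (z + w) = re z + re w.
Proof. by case: z; case: w. Qed.

Lemma imD z w : im (z + w) = im z + im w.
Proof. by case: z; case: w. Qed.

Lemma reN z : re (- z) = - re z.
Proof. by case: z. Qed.

Lemma imN z : im (- z) = - im z.
Proof. by case: z. Qed.

(** Cauchy-Schwarz in the plane, from Re (z conj w) <= |z conj w|; it is the pointwise bound behind
    [normc_cint]. *)
Lemma normc_sum_le z w : re z * re w + im z * im w <= normc z * normc w.
Proof.
have := re_le_normc (z * (re w -i* im w)); rewrite normcM reM/= mulrN opprK.
by rewrite sqrrN; case: w.
Qed.

Lemma cexp0 : cexp 0 = 1 :> R[i].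
Proof. by rewrite /cexp/= expR0 cos0 sin0 mulr0 mulr1. Qed.

Lemma cexpD z w : cexp (z + w) = cexp z * cexp w.
Proof.
case: z => a b; case: w => c d; rewrite /cexp/= expRD cosD sinD.
by apply/eqP; rewrite eq_complex/=; apply/andP; split; apply/eqP; ring.
Qed.

Lemma normc_cexp z : normc (cexp z) = expR (re z).
Proof.
case: z => a b; rewrite /cexp/= !exprMn -mulrDr cos2Dsin2 mulr1 sqrtr_sqr.
by rewrite ger0_norm// expR_ge0.
Qed.

Lemma cexpr x : cexp x%:C = (expR x)%:C.
Proof. by rewrite /cexp/= cos0 sin0 mulr0 mulr1. Qed.

Lemma cexpN z : cexp z * cexp (- z) = 1.
Proof. by rewrite -cexpD subrr cexp0. Qed.

Lemma cexp_neq0 z : cexp z != 0.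
Proof.
by apply/eqP => h; have := cexpN z; rewrite h mul0r => /esym/eqP; rewrite oner_eq0.
Qed.

End ComplexBasics.

(** * Integrals of complex-valued functions *)

Section ComplexIntegral.
Context d (T : measurableType d) (R : realType) (mu : {measure set T -> \bar R}).
Implicit Types (f g : T -> R[i]) (c : R[i]).

Definition cmeas f := measurable_fun setT (fun x => re (f x)) /\ measurable_fun setT (fun x => im (f x)).

(** Integrals run over the whole space of an arbitrary measure, so that product measures are
    covered; subsets enter through indicator factors. *)
Definition cintble f :=
  mu.-integrable setT (fun x => (re (f x))%:E) /\ mu.-integrable setT (fun x => (im (f x))%:E).

Definition cint f : R[i] := (\int[mu]_x re (f x)) +i* (\int[mu]_x im (f x)).

Lemma cmeas_cst c : cmeas (cst c).
Proof. by split; exact: measurable_cst. Qed.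

Lemma cmeasr (h : T -> R) : measurable_fun setT h -> cmeas (fun x => (h x)%:C).
Proof. by move=> mh; split => //; exact: measurable_cst. Qed.

Lemma cmeasD f g : cmeas f -> cmeas g -> cmeas (fun x => f x + g x).
Proof.
move=> [f1 f2] [g1 g2]; split.
- by apply: (eq_measurable_fun (fun x => re (f x) + re (g x))) => [x _|]; [rewrite /= reD|exact: measurable_funD].
- by apply: (eq_measurable_fun (fun x => im (f x) + im (g x))) => [x _|]; [rewrite /= imD|exact: measurable_funD].
Qed.

Lemma cmeasM f g : cmeas f -> cmeas g -> cmeas (fun x => f x * g x).
Proof.
move=> [f1 f2] [g1 g2]; split.
- apply: (eq_measurable_fun (fun x => re (f x) * re (g x) - im (f x) * im (g x))) => [x _|]; first by rewrite /= reM.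
  by apply: measurable_funB; exact: measurable_funM.
- apply: (eq_measurable_fun (fun x => re (f x) * im (g x) + im (f x) * re (g x))) => [x _|]; first by rewrite /= imM.
  by apply: measurable_funD; exact: measurable_funM.
Qed.

Lemma cmeasN f : cmeas f -> cmeas (fun x => - f x).
Proof.
move=> mf; rewrite (_ : (fun x => _) = (fun x => (-1) * f x)); last by apply/funext => x; rewrite mulN1r.
by apply: cmeasM => //; exact: cmeas_cst.
Qed.

Lemma cmeasB f g : cmeas f -> cmeas g -> cmeas (fun x => f x - g x).
Proof. by move=> mf mg; apply: cmeasD => //; exact: cmeasN. Qed.

Lemma cmeas_cexp f : cmeas f -> cmeas (fun x => cexp (f x)).
Proof.
have mcos := continuous_measurable_fun (@continuous_cos R).
have msin := continuous_measurable_fun (@continuous_sin R).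
move=> [f1 f2]; split; apply: measurable_funM => /=.
- exact: measurableT_comp f1.
- exact: measurableT_comp mcos f2.
- exact: measurableT_comp f1.
- exact: measurableT_comp msin f2.
Qed.

Lemma measurable_normc f : cmeas f -> measurable_fun setT (fun x => normc (f x)).
Proof.
move=> [f1 f2].
apply: (eq_measurable_fun (fun x => Num.sqrt (re (f x) ^+ 2 + im (f x) ^+ 2))) => [x _|].
  by rewrite -sqr_normc sqrtr_sqr ger0_norm// normc_ge0.
apply: (measurableT_comp (continuous_measurable_fun (@sqrt_continuous R))).
by apply: measurable_funD; exact: measurable_funX.
Qed.

Lemma cintble_meas f : cintble f -> cmeas f.
Proof. by move=> [/measurable_int/measurable_EFinP f1 /measurable_int/measurable_EFinP f2]. Qed.

Lemma le_cintble f (g : T -> R) : cmeas f -> mu.-integrable setT (EFin \o g) ->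
  (forall x, normc (f x) <= g x) -> cintble f.
Proof.
move=> [f1 f2] ig fg; split; apply: le_integrable ig => //.
- exact/measurable_EFinP.
- by move=> x _; rewrite /= lee_fin (le_trans (normr_re _))// (le_trans (fg x))// ler_norm.
- exact/measurable_EFinP.
- by move=> x _; rewrite /= lee_fin (le_trans (normr_im _))// (le_trans (fg x))// ler_norm.
Qed.

Lemma integrable_normc f : cintble f -> mu.-integrable setT (fun x => (normc (f x))%:E).
Proof.
move=> cf; have mf := cintble_meas cf; case: cf => f1 f2.
apply: (@le_integrable _ _ _ _ _ _ _ (fun x => (`|re (f x)| + `|im (f x)|)%:E)) => //.
- by apply/measurable_EFinP; exact: measurable_normc.
- move=> x _; rewrite /= lee_fin ger0_norm ?normc_ge0// ger0_norm ?addr_ge0//.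
  exact: normc_le_reim.
- have := integrableD measurableT (integrable_norm f1) (integrable_norm f2).
  by apply: eq_integrable.
Qed.

Lemma eq_cint f g : f =1 g -> cint f = cint g.
Proof. by move=> fg; congr cint; apply/funext. Qed.

Lemma cintbleD f g : cintble f -> cintble g -> cintble (fun x => f x + g x).
Proof.
move=> [f1 f2] [g1 g2]; split.
- by have := integrableD measurableT f1 g1; apply: eq_integrable => // x _; rewrite /= reD.
- by have := integrableD measurableT f2 g2; apply: eq_integrable => // x _; rewrite /= imD.
Qed.

Lemma cintD f g : cintble f -> cintble g -> cint (fun x => f x + g x) = cint f + cint g.
Proof.
move=> [f1 f2] [g1 g2]; rewrite /cint; congr (_ +i* _).
- by rewrite -RintegralD//; apply: eq_Rintegral => x _; rewrite reD.
- by rewrite -RintegralD//; apply: eq_Rintegral => x _; rewrite imD.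
Qed.

Lemma cintbleZ c f : cintble f -> cintble (fun x => c * f x).
Proof.
move=> [f1 f2]; split.
- have := integrableB measurableT (integrableZl measurableT (re c) f1) (integrableZl measurableT (im c) f2).
  by apply: eq_integrable => // x _; rewrite /= reM.
- have := integrableD measurableT (integrableZl measurableT (re c) f2) (integrableZl measurableT (im c) f1).
  by apply: eq_integrable => // x _; rewrite /= imM.
Qed.

Lemma cintZ c f : cintble f -> cint (fun x => c * f x) = c * cint f.
Proof.
move=> [f1 f2]; apply/eqP; rewrite eq_complex reM imM /=; apply/andP; split; apply/eqP.
- rewrite -!RintegralZl// -RintegralB//; first by apply: eq_Rintegral => x _; rewrite reM.
  + exact: (integrableZl measurableT (re c) f1).
  + exact: (integrableZl measurableT (im c) f2).
- rewrite -!RintegralZl// -RintegralD//; first by apply: eq_Rintegral => x _; rewrite imM.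
  + exact: (integrableZl measurableT (re c) f2).
  + exact: (integrableZl measurableT (im c) f1).
Qed.

Lemma cintZr c f : cintble f -> cint (fun x => f x * c) = cint f * c.
Proof. by move=> cf; rewrite mulrC -cintZ//; apply: eq_cint => x; rewrite mulrC. Qed.

Lemma cintbleN f : cintble f -> cintble (fun x => - f x).
Proof.
move=> /(cintbleZ (-1)); rewrite (_ : (fun x => -1 * f x) = (fun x => - f x))//.
by apply/funext => x; rewrite mulN1r.
Qed.

Lemma cintN f : cintble f -> cint (fun x => - f x) = - cint f.
Proof. by move=> cf; rewrite -mulN1r -cintZ//; apply: eq_cint => x; rewrite mulN1r. Qed.

Lemma cintbleB f g : cintble f -> cintble g -> cintble (fun x => f x - g x).
Proof. by move=> cf /cintbleN; exact: cintbleD. Qed.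

Lemma cintB f g : cintble f -> cintble g -> cint (fun x => f x - g x) = cint f - cint g.
Proof. by move=> cf cg; rewrite cintD ?cintN//; exact: cintbleN. Qed.

(** Pairing the integral I with itself gives |I|^2 = int (re I re f + im I im f) <= |I| int |f|, and
    |I| cancels when it is positive. *)
Lemma normc_cint f : cintble f -> normc (cint f) <= \int[mu]_x normc (f x).
Proof.
move=> cf; case: (cf) => f1 f2; set I := cint f.
have I0 : 0 <= \int[mu]_x normc (f x) by apply: Rintegral_ge0 => x _; exact: normc_ge0.
have := normc_ge0 I; rewrite le_eqVlt => /predU1P[<-//|n0].
rewrite -(ler_pM2l n0) -expr2 sqr_normc !expr2 /=.
have i1 := integrableZl measurableT (re I) f1.
have i2 := integrableZl measurableT (im I) f2.
have i3 := integrable_normc cf.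
rewrite -!RintegralZl// -RintegralD//.
apply: le_Rintegral => //.
- exact: (integrableD measurableT i1 i2).
- exact: (integrableZl measurableT (normc I) i3).
- by move=> x _; exact: (normc_sum_le I (f x)).
Qed.

Lemma cintr (h : T -> R) : cint (fun x => (h x)%:C) = (\int[mu]_x h x)%:C.
Proof.
rewrite /cint/=; congr (_ +i* _).
by rewrite Rintegral_cst// mul0r.
Qed.

Lemma cint_dominated (f_ : nat -> T -> R[i]) f (g : T -> \bar R) :
  (forall n, cmeas (f_ n)) -> cmeas f ->
  {ae mu, forall x, re (f_ n x) @[n --> \oo] --> re (f x) /\ im (f_ n x) @[n --> \oo] --> im (f x)} ->
  mu.-integrable setT g ->
  {ae mu, forall x, forall n, ((normc (f_ n x))%:E <= g x)%E} ->
  [/\ cintble f, re (cint (f_ n)) @[n --> \oo] --> re (cint f) &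
      im (cint (f_ n)) @[n --> \oo] --> im (cint f)].
Proof.
move=> mf_ [mf1 mf2] ff ig fg.
have [|||i1 c1] := @Rintegral_dominated _ _ _ mu (fun n => fun x => re (f_ n x)) (fun x => re (f x)) g _ mf1 _ ig.
- by move=> n; case: (mf_ n).
- by apply: filterS ff => x [].
- apply: filterS fg => x fx n; apply: le_trans (fx n); rewrite lee_fin; exact: normr_re.
have [|||i2 c2] := @Rintegral_dominated _ _ _ mu (fun n => fun x => im (f_ n x)) (fun x => im (f x)) g _ mf2 _ ig.
- by move=> n; case: (mf_ n).
- by apply: filterS ff => x [].
- apply: filterS fg => x fx n; apply: le_trans (fx n); rewrite lee_fin; exact: normr_im.
by split.
Qed.

Lemma ae_eq_cint f g : cmeas f -> cmeas g -> {ae mu, forall x, f x = g x} -> cint f = cint g.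
Proof.
move=> [f1 f2] [g1 g2] fg; rewrite /cint /Rintegral; congr (fine _ +i* fine _);
  apply: ae_eq_integral => //; try exact/measurable_EFinP.
- by apply: filterS fg => x ->.
- by apply: filterS fg => x ->.
Qed.

End ComplexIntegral.

(** * Fubini for complex-valued functions *)

Section ComplexFubini.
Context d1 d2 (T1 : measurableType d1) (T2 : measurableType d2) (R : realType).
Variables (m1 : {sigma_finite_measure set T1 -> \bar R}) (m2 : {sigma_finite_measure set T2 -> \bar R}).

(** A real inner integral takes the default value 0 where the extended one is not finite; by
    integrability this happens on a null set only. *)
Lemma Rintegral_Fubini (f : T1 * T2 -> R) : (m1 \x m2)%E.-integrable setT (EFin \o f) ->
  \int[m1]_x \int[m2]_y f (x, y) = \int[m2]_y \int[m1]_x f (x, y).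
Proof.
move=> cf; rewrite /Rintegral; congr fine.
transitivity (\int[m1]_x \int[m2]_y (f (x, y))%:E)%E.
  apply: ae_eq_integral => //.
  - apply/measurable_EFinP; apply: measurableT_comp => //.
    exact: (measurable_fubini_F cf).
  - exact: (measurable_fubini_F cf).
  - apply: filterS (ae_integrable1 cf) => x ix _.
    by rewrite fineK//; exact: integrable_fin_num.
rewrite (Fubini cf).
apply: ae_eq_integral => //.
- exact: (measurable_fubini_G cf).
- apply/measurable_EFinP; apply: measurableT_comp => //.
  exact: (measurable_fubini_G cf).
- apply: filterS (ae_integrable2 cf) => x ix _.
  by rewrite fineK//; exact: integrable_fin_num.
Qed.

Lemma cint_Fubini (f : T1 * T2 -> R[i]) : cintble (m1 \x m2)%E f ->
  cint m1 (fun x => cint m2 (fun y => f (x, y))) = cint m2 (fun y => cint m1 (fun x => f (x, y))).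
Proof.
move=> [i1 i2]; rewrite /cint /=; congr (_ +i* _).
- exact: (Rintegral_Fubini i1).
- exact: (Rintegral_Fubini i2).
Qed.

End ComplexFubini.

Section ParamIntegral.
Context d1 d2 (T1 : measurableType d1) (T2 : measurableType d2) (R : realType).
Variable m2 : {sigma_finite_measure set T2 -> \bar R}.

(** No integrability in y is assumed, so the positive and negative parts are treated separately. *)
Lemma emeasurable_param (f : T1 * T2 -> \bar R) : measurable_fun setT f ->
  measurable_fun setT (fun x => \int[m2]_y f (x, y))%E.
Proof.
move=> mf.
rewrite (_ : (fun x => _) = (fun x => \int[m2]_y f^\+ (x, y)) \- (fun x => \int[m2]_y f^\- (x, y)))%E.
  apply: emeasurable_funB.
  - by apply: (measurable_fun_fubini_tonelli_F f^\+)%E => //; exact: measurable_funepos.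
  - by apply: (measurable_fun_fubini_tonelli_F f^\-)%E => //; exact: measurable_funeneg.
apply/funext => x /=; rewrite integralE; congr (_ - _)%E.
- by congr (integral _ _ _); exact: (funepos_comp f (fun y => (x, y))).
- by congr (integral _ _ _); exact: (funeneg_comp f (fun y => (x, y))).
Qed.

Lemma measurable_param (f : T1 * T2 -> R) : measurable_fun setT f ->
  measurable_fun setT (fun x => \int[m2]_y f (x, y)).
Proof.
move=> mf; apply: measurableT_comp => //.
by apply: (emeasurable_param (f := EFin \o f)); exact/measurable_EFinP.
Qed.

Lemma cmeas_param (f : T1 * T2 -> R[i]) : cmeas f ->
  cmeas (fun x => cint m2 (fun y => f (x, y))).
Proof.
by move=> [f1 f2]; split; [exact: (measurable_param (f := fun z => re (f z)) f1)|
  exact: (measurable_param (f := fun z => im (f z)) f2)].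
Qed.

Variable m1 : {sigma_finite_measure set T1 -> \bar R}.

Lemma cintble_prod (f : T1 -> R[i]) (g : T2 -> R[i]) : cintble m1 f -> cintble m2 g ->
  cintble (m1 \x m2)%E (fun z => f z.1 * g z.2).
Proof.
move=> cf cg; have mf := cintble_meas cf; have mg := cintble_meas cg.
have mfst : cmeas (fun z : T1 * T2 => f z.1).
  by case: mf => f1 f2; split; [apply: (measurableT_comp f1)|apply: (measurableT_comp f2)].
have msnd : cmeas (fun z : T1 * T2 => g z.2).
  by case: mg => f1 f2; split; [apply: (measurableT_comp f1)|apply: (measurableT_comp f2)].
have mm := cmeasM mfst msnd.
apply: (@le_cintble _ _ _ _ _ (fun z => normc (f z.1) * normc (g z.2))) => //; last first.
  by move=> z; rewrite normcM.
have mN : measurable_fun setT (fun z : T1 * T2 => normc (f z.1) * normc (g z.2)).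
  by apply: measurable_funM; exact: measurable_normc.
apply/integrable12ltyP; first exact/measurable_EFinP.
have /integrableP[_ iG] := integrable_normc cg.
have /integrableP[_ iF] := integrable_normc cf.
set G := (\int[m2]_y `|(normc (g y))%:E|)%E in iG.
rewrite (_ : (\int[m1]_x _)%E = (\int[m1]_x (`|(normc (f x))%:E| * G))%E); last first.
  apply: eq_integral => x _; rewrite -ge0_integralZl//=.
  - by apply: eq_integral => y _; rewrite /= normrM EFinM.
  - apply/measurable_EFinP; apply: measurableT_comp => //; exact: measurable_normc.
have G0 : (0 <= G)%E by apply: integral_ge0.
rewrite ge0_integralZr//=.
  rewrite lte_mul_pinfty//.
    exact: integral_ge0.
  by rewrite ge0_fin_numE// integral_ge0.
by apply/measurable_EFinP; apply: measurableT_comp => //; exact: measurable_normc.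
Qed.

Lemma Rintegral_prod (f : T1 * T2 -> R) : (m1 \x m2)%E.-integrable setT (EFin \o f) ->
  \int[(m1 \x m2)%E]_z f z = \int[m1]_x \int[m2]_y f (x, y).
Proof.
move=> cf; rewrite /Rintegral; congr fine.
rewrite -(integral12_prod_meas1 cf).
apply: ae_eq_integral => //.
- exact: (measurable_fubini_F cf).
- apply/measurable_EFinP; apply: measurableT_comp => //.
  exact: (measurable_fubini_F cf).
- apply: filterS (ae_integrable1 cf) => x ix _.
  by rewrite fineK//; exact: integrable_fin_num.
Qed.

Lemma cint_prod (f : T1 -> R[i]) (g : T2 -> R[i]) : cintble m1 f -> cintble m2 g ->
  cint (m1 \x m2)%E (fun z => f z.1 * g z.2) = cint m1 f * cint m2 g.
Proof.
move=> cf cg; have [i1 i2] := cintble_prod cf cg.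
rewrite -cintZr//.
transitivity (cint m1 (fun x => cint m2 (fun y => f x * g y))).
  by rewrite {1 2}/cint (Rintegral_prod i1) (Rintegral_prod i2).
by apply: eq_cint => x; rewrite cintZ.
Qed.

End ParamIntegral.

(** * Translations and skew maps under real and complex integrals *)

Section ShiftC.
Context (R : realType).
Notation mu := (@lebesgue_measure R).

Lemma Rintegral_shift (a : R) (f : R -> R) : measurable_fun setT f ->
  \int[mu]_x f (x + a) = \int[mu]_x f x.
Proof.
by move=> mf; congr fine; apply: (integral_shift a (f := fun x => (f x)%:E)); exact/measurable_EFinP.
Qed.

Lemma integrable_shift (a : R) (f : R -> R) : mu.-integrable setT (EFin \o f) ->
  mu.-integrable setT (fun x => (f (x + a))%:E).
Proof.
move=> /integrableP[/measurable_EFinP mf lf].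
have ms := measurable_shift a.
apply/integrableP; split.
  by apply/measurable_EFinP; exact: (measurableT_comp mf ms).
rewrite (ge0_integral_shift a (f := fun x => `|(f x)%:E|%E))//.
by apply/measurable_EFinP; exact: measurableT_comp.
Qed.

Lemma cint_shift (a : R) (f : R -> R[i]) : cmeas f ->
  cint mu (fun x => f (x + a)) = cint mu f.
Proof. by move=> [f1 f2]; rewrite /cint (Rintegral_shift a f1) (Rintegral_shift a f2). Qed.

Section Skew.
Context d (T : measurableType d) (m : {sigma_finite_measure set T -> \bar R}).
Variables (s : T -> R) (ms : measurable_fun setT s).

Lemma measurable_skew (W : measurableTypeR R * T -> R) :
  measurable_fun setT W ->
  measurable_fun setT (fun z : measurableTypeR R * T => W (z.1 - s z.2, z.2)).
Proof.
move=> mW; apply: (measurableT_comp mW); apply/measurable_fun_pairP; split => /=.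
  apply: measurable_funB; first exact: measurable_fst.
  by apply: measurableT_comp => //; exact: measurable_snd.
exact: measurable_snd.
Qed.

Lemma cmeas_skew (W : measurableTypeR R * T -> R[i]) :
  cmeas W -> cmeas (fun z : measurableTypeR R * T => W (z.1 - s z.2, z.2)).
Proof.
by move=> [W1 W2]; split; [exact: (measurable_skew (W := fun z => re (W z)) W1)|
  exact: (measurable_skew (W := fun z => im (W z)) W2)].
Qed.

Lemma integrable_skew (W : measurableTypeR R * T -> R) : (mu \x m)%E.-integrable setT (EFin \o W) ->
  (mu \x m)%E.-integrable setT (fun z : measurableTypeR R * T => (W (z.1 - s z.2, z.2))%:E).
Proof.
move=> iW; have /measurable_EFinP mW := measurable_int _ iW.
apply/integrable12ltyP; first by apply/measurable_EFinP; exact: measurable_skew.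
have := ge0_integral_skew m ms (W := abse \o EFin \o W).
move=> /= ->//; first by apply: (integrable12ltyP mu m (iffRL (measurable_EFinP _ _) mW)).1.
by apply/measurable_EFinP; exact: measurableT_comp.
Qed.

Lemma cintble_skew (W : measurableTypeR R * T -> R[i]) : cintble (mu \x m)%E W ->
  cintble (mu \x m)%E (fun z : measurableTypeR R * T => W (z.1 - s z.2, z.2)).
Proof.
by move=> [i1 i2]; split;
  [exact: (integrable_skew (W := fun z => re (W z)) i1)|exact: (integrable_skew (W := fun z => im (W z)) i2)].
Qed.

Lemma cint_skew (W : measurableTypeR R * T -> R[i]) : cintble (mu \x m)%E W ->
  cint mu (fun a => cint m (fun p => W (a - s p, p))) = cint mu (fun e => cint m (fun p => W (e, p))).
Proof.
move=> iW; have mW := cintble_meas iW.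
have := cint_Fubini (cintble_skew iW) => /= ->.
rewrite (cint_Fubini iW); apply: eq_cint => p.
apply: (cint_shift (- s p) (f := fun e => W (e, p))).
by case: mW => W1 W2; split; [apply: (measurableT_comp W1)|apply: (measurableT_comp W2)].
Qed.

End Skew.
End ShiftC.

Section ProductSigmaFinite.
Context d1 d2 (T1 : measurableType d1) (T2 : measurableType d2) (R : realType).
Variable m1 : {sigma_finite_measure set T1 -> \bar R}.
Variable m2 : {sigma_finite_measure set T2 -> \bar R}.

(** Products of the members of two increasing exhausting sequences exhaust the product. This allows
    the product of two measures to be a factor of a further product, as in the triple integrals over
    (e, (a1, a2)) below. *)
Lemma product_sigma_finite : sigma_finite setT (m1 \x m2)%E.
Proof.
have /sigma_finiteP[F [TF ndF Foo]] := sigma_finiteT m1.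
have /sigma_finiteP[G [TG ndG Goo]] := sigma_finiteT m2.
exists (fun n => F n `*` G n).
  rewrite -setXTT TF TG predeqE => -[x y]; split; last by move=> [n _ []/= ? ?]; split; exists n.
  move=> [/= [n _ Fnx] [k _ Gky]]; exists (maxn n k) => //; split.
  - by move: x Fnx; exact/subsetPset/ndF/leq_maxl.
  - by move: y Gky; exact/subsetPset/ndG/leq_maxr.
move=> k; have [? ?] := Foo k; have [? ?] := Goo k.
split; first exact: measurableX.
by rewrite product_measure1E// lte_mul_pinfty// ge0_fin_numE.
Qed.
Definition prodm : {sigma_finite_measure set (T1 * T2)%type -> \bar R} :=
  HB.pack_for {sigma_finite_measure set (T1 * T2)%type -> \bar R} (m1 \x m2)%E
    (Measure_isSigmaFinite.Build _ _ _ (m1 \x m2)%E product_sigma_finite).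
End ProductSigmaFinite.

(** * The equation for the A-amplitude *)

Section Iteration.
Variables (R : realType) (kappa c M : R) (q0 : measurableTypeR R -> R).
Notation mu := (@lebesgue_measure R).
Notation mR := (measurableTypeR R).
Let mu2 := prodm mu mu.
Hypothesis kappa0 : 0 < kappa.
Hypothesis c0 : 0 <= c.
Hypothesis mq : measurable_fun setT q0.
Hypothesis qc : forall x, `|q0 x| <= c.

Definition pexp (t : mR) : R := if 0 <= t then expR (- (2 * kappa * t)) else 0.

(** Comparison with the exponential density of rate 2 kappa yields measurability and the integral 1
    / (2 kappa). *)
Lemma pexpE t : pexp t = (2 * kappa)^-1 * exponential_pdf (2 * kappa) t.
Proof.
rewrite /pexp; case: ifP => [t0|/negbT]; last first.
  by rewrite -ltNge => t0; rewrite lt0_exponential_pdf// mulr0.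
rewrite exponential_pdfE// mulNr mulrA mulVf ?mul1r//.
by rewrite gt_eqF// mulr_gt0.
Qed.

Lemma pexp_ge0 t : 0 <= pexp t.
Proof. by rewrite /pexp; case: ifP => // _; exact: expR_ge0. Qed.

Lemma pexp_lt0 t : t < 0 -> pexp t = 0.
Proof. by rewrite /pexp leNgt => ->. Qed.

Let k2 : 0 < 2 * kappa. Proof. by rewrite mulr_gt0. Qed.

Lemma measurable_pexp : measurable_fun setT pexp.
Proof.
rewrite (_ : pexp = fun t : mR => (2 * kappa)^-1 * exponential_pdf (2 * kappa) t); last first.
  by apply/funext => t; rewrite pexpE.
by apply: measurable_funM => //; apply: measurable_exponential_pdf; exact: ltW.
Qed.

Lemma integral_pexp : (\int[mu]_t (pexp t)%:E = ((2 * kappa)^-1)%:E)%E.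
Proof.
under eq_integral do rewrite pexpE EFinM.
rewrite ge0_integralZl_EFin//.
- by rewrite integral_exponential_pdf// mule1.
- by move=> t _; rewrite lee_fin exponential_pdf_ge0// ltW.
- by apply/measurable_EFinP; apply: measurable_exponential_pdf; exact: ltW.
- by rewrite invr_ge0 ltW.
Qed.

Lemma integrable_pexp : mu.-integrable setT (EFin \o pexp).
Proof.
apply/integrableP; split; first by apply/measurable_EFinP; exact: measurable_pexp.
under eq_integral do rewrite /= ger0_norm ?pexp_ge0//.
by rewrite integral_pexp ltry.
Qed.

Lemma cmeas_pexp : cmeas (fun t => (pexp t)%:C).
Proof. by apply: cmeasr; exact: measurable_pexp. Qed.

Definition mfun2 (f : mR -> mR -> R) := measurable_fun setT (fun z : mR * mR => f z.1 z.2).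
(** The bound is uniform in x because the equation at x involves the translates x + e. The weight
    being part of f, this is the weighted norm. *)
Definition l1bound (f : mR -> mR -> R) (N : R) :=
  forall x, (\int[mu]_a (`|f a x|)%:E <= N%:E)%E.
(** Support in a >= 0 lets Laplace integrals run over the whole line, on which translations act. *)
Definition causal (f : mR -> mR -> R) := forall a x, a < 0 -> f a x = 0.

Lemma mfun2_1 f x : mfun2 f -> measurable_fun setT (fun a => f a x).
Proof.
move=> mf; apply: (measurableT_comp mf (g := fun a : mR => (a, x))).
exact: pair2_measurable.
Qed.

Lemma mfun2_comp d (T : measurableType d) f (u v : T -> mR) : mfun2 f ->
  measurable_fun setT u -> measurable_fun setT v -> measurable_fun setT (fun t => f (u t) (v t)).
Proof.
move=> mf mu_ mv; apply: (measurableT_comp mf (g := fun t => (u t, v t))).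
exact/measurable_fun_pairP.
Qed.

Lemma l1bound_ge0 f N : l1bound f N -> 0 <= N.
Proof.
by move=> /(_ 0) h; rewrite -lee_fin; apply: le_trans h; apply: integral_ge0 => a _; rewrite lee_fin.
Qed.

Lemma l1bound_integrable f N x : mfun2 f -> l1bound f N ->
  mu.-integrable setT (EFin \o f ^~ x).
Proof.
move=> mf bf; apply/integrableP; split; first by apply/measurable_EFinP; exact: mfun2_1.
by rewrite (le_lt_trans (bf x))// ltry.
Qed.

Definition sum2 (z : mR * mR) : R := z.1 + z.2.

(** The point w is (e, (a1, a2)): a shift e of the potential and the arguments of two amplitudes.
    With e = a - a1 - a2 the three weights multiply to e^(-2 kappa a). *)
Definition kernel (f g : mR -> mR -> R) (x : mR) (w : mR * (mR * mR)) : R :=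
  pexp w.1 * (f w.2.1 (x + w.1) * g w.2.2 (x + w.1)).

(* The weight e^(-2 kappa a) is kept inside the functions of a.  Taking Laplace
   transforms F, G in a turns [ricconv f g] into the function
   x |-> \int_0^oo e^(-2 kappa e) chi(e) F(x + e) G(x + e) de. *)
Definition ricconv (f g : mR -> mR -> R) (a x : mR) : R :=
  \int[mu2]_z kernel f g x (a - sum2 z, z).

Lemma measurable_sum2 : measurable_fun setT sum2.
Proof. by apply: measurable_funD; [exact: measurable_fst|exact: measurable_snd]. Qed.

Lemma measurable_kernel f g x : mfun2 f -> mfun2 g -> measurable_fun setT (kernel f g x).
Proof.
move=> mf mg; have m1 : measurable_fun setT (fun w : mR * (mR * mR) => x + w.1).
  by apply: measurable_funD => //; exact: measurable_fst.
apply: measurable_funM.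
  by apply: (measurableT_comp measurable_pexp); exact: measurable_fst.
apply: measurable_funM; apply: mfun2_comp => //.
- by apply: (measurableT_comp measurable_fst); exact: measurable_snd.
- by apply: (measurableT_comp measurable_snd); exact: measurable_snd.
Qed.

Lemma mfun2_conv f g : mfun2 f -> mfun2 g -> mfun2 (ricconv f g).
Proof.
move=> mf mg; rewrite /mfun2 /ricconv.
apply: (measurable_param mu2 (f := fun w : (mR * mR) * (mR * mR) => kernel f g w.1.2 (w.1.1 - sum2 w.2, w.2))).
have m11 : measurable_fun setT (fun w : (mR * mR) * (mR * mR) => w.1.1).
  by apply: (measurableT_comp measurable_fst); exact: measurable_fst.
have m12 : measurable_fun setT (fun w : (mR * mR) * (mR * mR) => w.1.2).
  by apply: (measurableT_comp measurable_snd); exact: measurable_fst.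
have m21 : measurable_fun setT (fun w : (mR * mR) * (mR * mR) => w.2.1).
  by apply: (measurableT_comp measurable_fst); exact: measurable_snd.
have m22 : measurable_fun setT (fun w : (mR * mR) * (mR * mR) => w.2.2).
  by apply: (measurableT_comp measurable_snd); exact: measurable_snd.
have m3 : measurable_fun setT (fun w : (mR * mR) * (mR * mR) => w.1.1 - sum2 w.2).
  by apply: measurable_funB => //; exact: measurable_funD.
have m4 : measurable_fun setT (fun w : (mR * mR) * (mR * mR) => w.1.2 + (w.1.1 - sum2 w.2)).
  exact: measurable_funD.
apply: measurable_funM; first exact: (measurableT_comp measurable_pexp).
by apply: measurable_funM; apply: mfun2_comp.
Qed.

(** The three arguments a - z1 - z2, z1 and z2 add up to a < 0, so one of them is negative and its
    factor vanishes. *)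
Lemma causal_conv f g : causal f -> causal g -> causal (ricconv f g).
Proof.
move=> kf kg a x a0; rewrite /ricconv -[RHS](mulr0 (fine (mu2 setT))).
rewrite (_ : (fun z => _) = cst 0); first by rewrite Rintegral_cst// mul0r mulr0.
apply/funext => z; rewrite /kernel /=.
have [z1|z1] := ltP z.1 0; first by rewrite kf// mul0r mulr0.
have [z2|z2] := ltP z.2 0; first by rewrite kg// !mulr0.
by rewrite pexp_lt0 ?mul0r// /sum2; lra.
Qed.

(** For fixed e the integral over (a1, a2) is a product of two L^1 norms at x + e, and [pexp]
    integrates to 1 / (2 kappa). This is the origin of the factor in the scalar iteration. *)
Lemma integral_kernel_bound f g Nf Ng x : mfun2 f -> mfun2 g -> l1bound f Nf -> l1bound g Ng ->
  (\int[mu]_e \int[mu2]_z `|(kernel f g x (e, z))%:E| <= ((2 * kappa)^-1 * (Nf * Ng))%:E)%E.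
Proof.
move=> mf mg bf bg.
have Nf0 := l1bound_ge0 bf; have Ng0 := l1bound_ge0 bg.
have mfx (y : mR) : measurable_fun setT (fun a => `|f a y|).
  by apply: measurableT_comp => //; exact: mfun2_1.
have mgx (y : mR) : measurable_fun setT (fun a => `|g a y|).
  by apply: measurableT_comp => //; exact: mfun2_1.
apply: (@le_trans _ _ (\int[mu]_e ((pexp e)%:E * (Nf * Ng)%:E))%E); last first.
  rewrite ge0_integralZr//.
  - by rewrite integral_pexp.
  - by apply/measurable_EFinP; exact: measurable_pexp.
  - by move=> e _; rewrite lee_fin pexp_ge0.
  - by rewrite lee_fin mulr_ge0.
have mk : measurable_fun setT (fun w : mR * (mR * mR) => `|(kernel f g x w)%:E|%E).
  by apply: measurableT_comp => //; apply/measurable_EFinP; exact: measurable_kernel.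
apply: ge0_le_integral => //.
- by move=> e _; exact: integral_ge0.
- exact: (emeasurable_param mu2 mk).
- by apply/measurable_EFinP; apply: measurable_funM => //; exact: measurable_pexp.
move=> e _.
have -> : (\int[mu2]_z `|(kernel f g x (e, z))%:E| =
    \int[mu2]_z ((pexp e)%:E * (`|f z.1 (x + e)| * `|g z.2 (x + e)|)%:E))%E.
  by apply: eq_integral => z _; rewrite /kernel /= !normrM ger0_norm ?pexp_ge0.
have mm : measurable_fun setT (fun z : mR * mR => `|f z.1 (x + e)| * `|g z.2 (x + e)|).
  by apply: measurable_funM; [apply: (measurableT_comp (mfx _))|apply: (measurableT_comp (mgx _))].
have mmE : measurable_fun setT (fun z : mR * mR => (`|f z.1 (x + e)| * `|g z.2 (x + e)|)%:E).
  exact/measurable_EFinP.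
have mm0 (z : mR * mR) : (0 <= (`|f z.1 (x + e)| * `|g z.2 (x + e)|)%:E)%E.
  by rewrite lee_fin mulr_ge0.
rewrite (ge0_integralZl_EFin mu2 measurableT (fun z _ => mm0 z) mmE (pexp_ge0 e)).
apply: lee_wpmul2l; first by rewrite lee_fin pexp_ge0.
rewrite /mu2 (fubini_tonelli1 (m1 := mu) (m2 := mu) _ mmE mm0).
rewrite /fubini_F /=.
apply: (@le_trans _ _ (\int[mu]_a ((`|f a (x + e)|)%:E * Ng%:E))%E).
  apply: ge0_le_integral => //.
  - by move=> a _; apply: integral_ge0 => b _; rewrite lee_fin mulr_ge0.
  - exact: (emeasurable_param mu mmE).
  - by apply/measurable_EFinP; exact: measurable_funM.
  move=> a _; under eq_integral do rewrite EFinM.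
  rewrite ge0_integralZl_EFin//.
  - by rewrite lee_wpmul2l// lee_fin.
  - exact/measurable_EFinP.
rewrite ge0_integralZr//.
- by rewrite EFinM lee_wpmul2r// lee_fin.
- exact/measurable_EFinP.
Qed.

Lemma l1bound_conv f g Nf Ng : mfun2 f -> mfun2 g -> l1bound f Nf -> l1bound g Ng ->
  l1bound (ricconv f g) ((2 * kappa)^-1 * (Nf * Ng)).
Proof.
move=> mf mg bf bg x; apply: le_trans (integral_kernel_bound x mf mg bf bg).
have mk : measurable_fun setT (fun w : mR * (mR * mR) => `|(kernel f g x w)%:E|%E).
  by apply: measurableT_comp => //; apply/measurable_EFinP; exact: measurable_kernel.
rewrite -(ge0_integral_skew mu2 measurable_sum2 mk)//.
apply: ge0_le_integral => //.
- by apply/measurable_EFinP; apply: measurableT_comp => //; apply: mfun2_1; exact: mfun2_conv.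
- apply: (emeasurable_param mu2 (f := fun w : mR * (mR * mR) => `|(kernel f g x (w.1 - sum2 w.2, w.2))%:E|%E)).
  apply: measurableT_comp => //; apply/measurable_EFinP.
  by apply: (measurable_skew measurable_sum2); exact: measurable_kernel.
move=> a _; rewrite /ricconv /Rintegral.
apply: (@le_trans _ _ `|\int[mu2]_z (kernel f g x (a - sum2 z, z))%:E|%E).
  (* If the extended integral is infinite, its real value is the default 0 and the inequality
     persists. *)
  by case: (\int[mu2]_z _)%E => //= [|]; rewrite ?normr0 ?leey.
apply: le_abse_integral => //; apply/measurable_EFinP.
have := measurable_skew measurable_sum2 (measurable_kernel x mf mg).
by move=> h; apply: (measurableT_comp h (g := fun z => (a, z))); exact: pair1_measurable.
Qed.

Section Char.
(** In the application chi a = e^(-2 a (k - kappa)): the weight sits inside the functions, so only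
    the excess of k over kappa remains, and it has modulus at most 1 for a >= 0. *)
Variable chi : mR -> R[i].
Hypothesis mchi : cmeas chi.
Hypothesis chiD : forall a b, chi (a + b) = chi a * chi b.
Hypothesis chi_le1 : forall a, 0 <= a -> normc (chi a) <= 1.

Lemma normc_chi f a x : causal f -> normc (chi a * (f a x)%:C) <= `|f a x|.
Proof.
move=> kf; rewrite normcM normcr.
have [a0|a0] := ltP a 0; first by rewrite kf// normr0 mulr0.
by rewrite ler_piMl// chi_le1.
Qed.

Lemma normc_pchi e : normc ((pexp e)%:C * chi e) <= pexp e.
Proof.
rewrite normcM normcr ger0_norm ?pexp_ge0//.
have [e0|e0] := ltP e 0; first by rewrite pexp_lt0// mul0r.
by rewrite ler_piMr ?pexp_ge0// chi_le1.
Qed.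

Definition laplace (f : mR -> mR -> R) (x : mR) : R[i] := cint mu (fun a => chi a * (f a x)%:C).

Lemma cmeas_chi f x : mfun2 f -> cmeas (fun a => chi a * (f a x)%:C).
Proof. by move=> mf; apply: cmeasM => //; apply: cmeasr; exact: mfun2_1. Qed.

Lemma cintble_chi f N x : mfun2 f -> causal f -> l1bound f N ->
  cintble mu (fun a => chi a * (f a x)%:C).
Proof.
move=> mf kf bf; apply: (@le_cintble _ _ _ _ _ (fun a : mR => `|f a x|)).
- exact: cmeas_chi.
- exact: (integrable_norm (l1bound_integrable x mf bf)).
- by move=> a; exact: normc_chi.
Qed.

Lemma normc_laplace f N x : mfun2 f -> causal f -> l1bound f N -> normc (laplace f x) <= N.
Proof.
move=> mf kf bf; have cf := cintble_chi x mf kf bf.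
apply: le_trans (normc_cint cf) _.
have i2 : mu.-integrable setT (EFin \o (fun a : mR => `|f a x|)).
  exact: (integrable_norm (l1bound_integrable x mf bf)).
apply: (@le_trans _ _ (\int[mu]_a `|f a x|)).
  apply: le_Rintegral => //; first exact: integrable_normc.
  by move=> a _; exact: normc_chi.
by rewrite -lee_fin /Rintegral fineK//; exact: integrable_fin_num.
Qed.

Lemma cmeas_laplace f : mfun2 f -> cmeas (laplace f).
Proof.
move=> mf; apply: (cmeas_param _ (f := fun w : mR * mR => chi w.2 * (f w.2 w.1)%:C)).
apply: cmeasM.
  by case: mchi => h1 h2; split; [apply: (measurableT_comp h1)|apply: (measurableT_comp h2)].
by apply: cmeasr; apply: mfun2_comp.
Qed.

(** Multiplicativity splits chi (e + a1 + a2) into three factors; after the skew substitution the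
    integral over (a1, a2) factors for each e. *)
Lemma laplace_conv f g Nf Ng x : mfun2 f -> mfun2 g -> causal f -> causal g ->
  l1bound f Nf -> l1bound g Ng ->
  laplace (ricconv f g) x =
  cint mu (fun e => (pexp e)%:C * chi e * (laplace f (x + e) * laplace g (x + e))).
Proof.
move=> mf mg kf kg bf bg.
pose W (w : mR * (mR * mR)) : R[i] := (pexp w.1)%:C * chi w.1 *
  ((chi w.2.1 * (f w.2.1 (x + w.1))%:C) * (chi w.2.2 * (g w.2.2 (x + w.1))%:C)).
have mchi' (u : mR * (mR * mR) -> mR) : measurable_fun setT u -> cmeas (fun w => chi (u w)).
  by move=> mu_; case: mchi => h1 h2; split; [apply: (measurableT_comp h1)|apply: (measurableT_comp h2)].
have m1 : measurable_fun setT (fun w : mR * (mR * mR) => w.1) by exact: measurable_fst.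
have m21 : measurable_fun setT (fun w : mR * (mR * mR) => w.2.1).
  by apply: (measurableT_comp measurable_fst); exact: measurable_snd.
have m22 : measurable_fun setT (fun w : mR * (mR * mR) => w.2.2).
  by apply: (measurableT_comp measurable_snd); exact: measurable_snd.
have mx : measurable_fun setT (fun w : mR * (mR * mR) => x + w.1) by exact: measurable_funD.
have mW : cmeas W.
  apply: cmeasM; first apply: cmeasM; try exact: mchi'.
    by apply: cmeasr; exact: (measurableT_comp measurable_pexp).
  by apply: cmeasM; apply: cmeasM; try exact: mchi'; apply: cmeasr; exact: mfun2_comp.
have WK w : normc (W w) <= `|kernel f g x w|.
  rewrite /W /kernel normcM normrM (ger0_norm (pexp_ge0 _)).
  apply: ler_pM; rewrite ?normc_ge0 ?normc_pchi// normcM normrM.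
  by apply: ler_pM; rewrite ?normc_ge0// normc_chi.
have mk := measurable_kernel x mf mg.
have iK : (mu \x mu2)%E.-integrable setT (EFin \o kernel f g x).
  apply/integrable12ltyP; first exact/measurable_EFinP.
  by rewrite (le_lt_trans (integral_kernel_bound x mf mg bf bg))// ltry.
have iW : cintble (mu \x mu2)%E W.
  by apply: (@le_cintble _ _ _ _ _ (fun w => `|kernel f g x w|)) => //; exact: (integrable_norm iK).
have iK' := integrable_skew measurable_sum2 iK.
transitivity (cint mu (fun a => cint mu2 (fun z => W (a - sum2 z, z)))).
  apply: ae_eq_cint.
  - by apply: cmeas_chi; exact: mfun2_conv.
  - by apply: (cmeas_param _ (f := fun w : mR * (mR * mR) => W (w.1 - sum2 w.2, w.2))); exact: (cmeas_skew measurable_sum2).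
  (* The integral defining [ricconv] is known to converge for almost every a only; there chi a may
     be moved inside. *)
  apply: filterS (ae_integrable1 iK') => a /= ia.
  rewrite /ricconv -cintr -cintZ; last first.
    split => //=.
    by apply: (eq_integrable _ (cst 0)%E) => //; exact: integrable0.
  apply: eq_cint => z; rewrite /W /kernel /=.
  rewrite (_ : chi a = chi (a - sum2 z) * (chi z.1 * chi z.2)); last first.
    by rewrite -!chiD /sum2 subrK.
  rewrite !rmorphM /=; ring.
rewrite (cint_skew measurable_sum2 iW).
apply: eq_cint => e; rewrite /W /=.
have c1 := cintble_chi (x + e) mf kf bf; have c2 := cintble_chi (x + e) mg kg bg.
rewrite cintZ; last exact: cintble_prod c1 c2.
by rewrite (cint_prod c1 c2).
Qed.

End Char.

End Iteration.

(** * Picard iteration and its limit *)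

Section Amplitude.
Variables (R : realType) (kappa c M : R) (q0 : measurableTypeR R -> R).
Notation mu := (@lebesgue_measure R).
Notation mR := (measurableTypeR R).
Hypothesis kappa0 : 0 < kappa.
Hypothesis c0 : 0 <= c.
Hypothesis mq : measurable_fun setT q0.
Hypothesis qc : forall x, `|q0 x| <= c.
Hypothesis M0 : 0 <= M.
Hypothesis cM : c + M ^+ 2 <= 2 * kappa * M.

Let k2 : 0 < 2 * kappa. Proof. by rewrite mulr_gt0. Qed.
Let k2V : 0 <= (2 * kappa)^-1. Proof. by rewrite invr_ge0 ltW. Qed.

(* The pair (E_j, D_j) of an iterate and its increment; the recursion for D_j is
   (E + D)^2 - E^2 = D (2 E + D). *)
Fixpoint iterates (j : nat) : (mR -> mR -> R) * (mR -> mR -> R) :=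
  if j is j'.+1 then
    let ED := iterates j' in
    (fun a x => ED.1 a x + ED.2 a x,
     fun a x => - ricconv kappa ED.2 (fun a x => 2 * ED.1 a x + ED.2 a x) a x)
  else (fun _ _ => 0, fun a x => pexp kappa a * q0 (x + a)).

Definition picard j := (iterates j).1.
Definition increment j := (iterates j).2.

(* The same recursion for the norms, i.e. for M |-> (c + M^2) / (2 kappa). *)
Fixpoint bounds (j : nat) : R * R :=
  if j is j'.+1 then
    let ed := bounds j' in
    (ed.1 + ed.2, (2 * kappa)^-1 * (ed.2 * (2 * ed.1 + ed.2)))
  else (0, (2 * kappa)^-1 * c).

Lemma bounds_ge0 j : 0 <= (bounds j).1 /\ 0 <= (bounds j).2.
Proof.
elim: j => [|j [h1 h2]] /=; first by rewrite mulr_ge0.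
by rewrite addr_ge0// !mulr_ge0// addr_ge0// mulr_ge0.
Qed.

(** Since d (2 e + d) = (e + d)^2 - e^2, adding the increments telescopes into the iteration of M ->
    (c + M^2) / (2 kappa). *)
Lemma bounds_fix j : (bounds j).1 + (bounds j).2 = (2 * kappa)^-1 * (c + (bounds j).1 ^+ 2).
Proof.
elim: j => [|j IH] /=; first by rewrite expr0n/= addr0 add0r.
rewrite [X in X + _]IH -mulrDr; congr (_ * _); ring.
Qed.

(** By [cM] the scalar map sends M below itself, and it is increasing on nonnegative numbers, so the
    iteration started at 0 stays below M. *)
Lemma bounds_le j : (bounds j).1 <= M.
Proof.
elim: j => [|j IH]; first by [].
have [h _] := bounds_ge0 j.
rewrite /= bounds_fix mulrC ler_pdivrMr// (le_trans _ (le_trans cM _))//.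
  by rewrite lerD2l ler_sqr.
by rewrite mulrC.
Qed.

Lemma bounds_sum j : (bounds j).1 = \sum_(0 <= i < j) (bounds i).2.
Proof. by elim: j => [|j IH]; [rewrite big_geq|rewrite big_nat_recr//= -IH]. Qed.

Lemma mfun2D (f g : mR -> mR -> R) : mfun2 f -> mfun2 g -> mfun2 (fun a x => f a x + g a x).
Proof. by move=> mf mg; exact: measurable_funD. Qed.

Lemma mfun2Z r (f : mR -> mR -> R) : mfun2 f -> mfun2 (fun a x => r * f a x).
Proof. by move=> mf; apply: measurable_funM. Qed.

Lemma mfun2N (f : mR -> mR -> R) : mfun2 f -> mfun2 (fun a x => - f a x).
Proof. by move=> mf; exact: measurable_funN. Qed.

Lemma l1boundD (f g : mR -> mR -> R) Nf Ng : mfun2 f -> mfun2 g -> l1bound f Nf -> l1bound g Ng ->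
  l1bound (fun a x => f a x + g a x) (Nf + Ng).
Proof.
move=> mf mg bf bg x; rewrite EFinD; apply: le_trans (leeD (bf x) (bg x)).
have mfx : measurable_fun setT (fun a => (`|f a x|)%:E).
  by apply/measurable_EFinP; apply: measurableT_comp => //; exact: mfun2_1.
have mgx : measurable_fun setT (fun a => (`|g a x|)%:E).
  by apply/measurable_EFinP; apply: measurableT_comp => //; exact: mfun2_1.
rewrite -ge0_integralD//; apply: ge0_le_integral => //.
- apply/measurable_EFinP; apply: measurableT_comp => //.
  by apply: (mfun2_1 (f := fun a x => f a x + g a x)); exact: mfun2D.
- exact: emeasurable_funD.
- by move=> a _; rewrite lee_fin ler_normD.
Qed.

Lemma l1boundZ r (f : mR -> mR -> R) Nf : mfun2 f -> l1bound f Nf ->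
  l1bound (fun a x => r * f a x) (`|r| * Nf).
Proof.
move=> mf bf x; under eq_integral do rewrite normrM EFinM.
rewrite ge0_integralZl_EFin//; first by rewrite EFinM lee_wpmul2l ?lee_fin.
by apply/measurable_EFinP; apply: measurableT_comp => //; exact: mfun2_1.
Qed.

Lemma l1boundN (f : mR -> mR -> R) Nf : l1bound f Nf -> l1bound (fun a x => - f a x) Nf.
Proof. by move=> bf x; under eq_integral do rewrite normrN. Qed.

Lemma iterates_props j : [/\ mfun2 (picard j), mfun2 (increment j),
  causal (picard j) & causal (increment j)] /\
  l1bound (picard j) (bounds j).1 /\ l1bound (increment j) (bounds j).2.
Proof.
elim: j => [|j [[mE mD kE kD] [bE bD]]].
  have mp := measurable_pexp kappa0.
  split; [split|split] => //.
  - exact: measurable_cst.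
  - apply: measurable_funM; first by apply: (measurableT_comp mp); exact: measurable_fst.
    apply: (measurableT_comp mq).
    by apply: measurable_funD; [exact: measurable_snd|exact: measurable_fst].
  - by move=> a x a0; rewrite /increment /= pexp_lt0// mul0r.
  - by move=> x; rewrite /picard /= normr0 integral0.
  - move=> x; apply: (@le_trans _ _ (\int[mu]_a ((pexp kappa a)%:E * c%:E))%E).
      apply: ge0_le_integral => //.
      + apply/measurable_EFinP; apply: measurableT_comp => //; apply: measurable_funM => //.
        by apply: (measurableT_comp mq); exact: measurable_funD.
      + by apply/measurable_EFinP; apply: measurable_funM.
      + move=> a _; rewrite /increment /= lee_fin normrM ger0_norm ?pexp_ge0//.
        by rewrite ler_wpM2l ?pexp_ge0.
    rewrite ge0_integralZr//.
    + by rewrite integral_pexp.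
    + exact/measurable_EFinP.
    + by move=> a _; rewrite lee_fin pexp_ge0.
have mS : mfun2 (fun a x => 2 * picard j a x + increment j a x).
  by apply: mfun2D => //; exact: mfun2Z.
have kS : causal (fun a x => 2 * picard j a x + increment j a x).
  by move=> a x a0; rewrite kE// kD// mulr0 addr0.
have bS : l1bound (fun a x => 2 * picard j a x + increment j a x) (2 * (bounds j).1 + (bounds j).2).
  have := l1boundD (mfun2Z 2 mE) mD (l1boundZ 2 mE bE) bD.
  by rewrite ger0_norm.
split; [split|split].
- exact: mfun2D.
- by apply: mfun2N; exact: mfun2_conv.
- by move=> a x a0; rewrite /picard /= -/(picard j) -/(increment j) kE// kD// addr0.
- move=> a x a0; rewrite /increment /= -/(picard j) -/(increment j).
  by rewrite (causal_conv kappa kD kS)// oppr0.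
- exact: l1boundD.
- apply: l1boundN; exact: l1bound_conv.
Qed.

Lemma picard_sum j a x : picard j a x = \sum_(0 <= i < j) increment i a x.
Proof. by elim: j => [|j IH]; [rewrite big_geq|rewrite big_nat_recr//= -IH]. Qed.

(** This series majorises every iterate. Its integral is at most M by [bounds_sum], so it is finite
    almost everywhere: it yields both the convergence and the dominating function. *)
Definition dominant (a x : mR) : \bar R := (\sum_(0 <= j <oo) (`|increment j a x|)%:E)%E.

Lemma dominant_ge0 a x : (0 <= dominant a x)%E.
Proof. by apply: nneseries_ge0 => n _ _; rewrite lee_fin. Qed.

Lemma measurable_increment j x : measurable_fun setT (fun a => (`|increment j a x|)%:E).
Proof.
apply/measurable_EFinP; apply: measurableT_comp => //; apply: mfun2_1.
by have [[]] := iterates_props j.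
Qed.

Lemma measurable_dominant x : measurable_fun setT (dominant^~ x).
Proof.
apply: ge0_emeasurable_sum => // k _; exact: measurable_increment.
Qed.

Lemma integral_dominant x : (\int[mu]_a dominant a x <= M%:E)%E.
Proof.
rewrite integral_nneseries//; last by move=> n; exact: measurable_increment.
apply: lime_le; first by apply: is_cvg_nneseries => n _ _; exact: integral_ge0.
apply: nearW => n; apply: (@le_trans _ _ (\sum_(0 <= i < n) ((bounds i).2)%:E)%E).
  by apply: lee_sum => i _; have [_ [_]] := iterates_props i; apply.
by rewrite sumEFin lee_fin -bounds_sum bounds_le.
Qed.

Lemma integrable_dominant x : mu.-integrable setT (dominant^~ x).
Proof.
apply/integrableP; split; first exact: measurable_dominant.
under eq_integral do rewrite gee0_abs ?dominant_ge0//.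
by rewrite (le_lt_trans (integral_dominant x))// ltry.
Qed.

Lemma picard_le j a x : ((`|picard j a x|)%:E <= dominant a x)%E.
Proof.
apply: (@le_trans _ _ (\sum_(0 <= i < j) (`|increment i a x|)%:E)%E).
  by rewrite sumEFin lee_fin picard_sum ler_norm_sum.
by apply: nneseries_lim_ge => n _ _; rewrite lee_fin.
Qed.

(* The iterates converge for almost all a only; the upper limit is a total
   function that is measurable in (a, x). *)
Definition amplitude (a x : mR) : R := fine (limn_esup (fun j => (picard j a x)%:E)).

Lemma cvg_picard a x : dominant a x \is a fin_num -> picard j a x @[j --> \oo] --> amplitude a x.
Proof.
move=> fd.
have cs : cvgn (series (fun i => increment i a x)).
  apply: normed_cvg; apply: nondecreasing_is_cvgn.
    by apply/nondecreasing_seqP => n; rewrite /series /= [leRHS]big_nat_recr//= lerDl.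
  exists (fine (dominant a x)) => _ [n _ <-].
  rewrite -lee_fin fineK// /series /= -sumEFin.
  by apply: nneseries_lim_ge => i _ _; rewrite lee_fin.
have cp : picard j a x @[j --> \oo] --> limn (series (fun i => increment i a x)).
  rewrite (_ : (fun j => picard j a x) = series (fun i => increment i a x)); first exact: cs.
  by apply/funext => j; rewrite picard_sum.
have cpE : (picard j a x)%:E @[j --> \oo] --> (limn (series (fun i => increment i a x)))%:E.
  by apply: cvg_EFin => //; exact: nearW.
by rewrite /amplitude (cvg_limn_einf_sup cpE).2.
Qed.

Lemma ae_cvg_picard x : {ae mu, forall a, picard j a x @[j --> \oo] --> amplitude a x}.
Proof.
have := integrable_ae measurableT (integrable_dominant x).
by apply: filterS => a /(_ I); exact: cvg_picard.
Qed.

Lemma mfun2_amplitude : mfun2 amplitude.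
Proof.
apply: measurableT_comp => //.
apply: (measurable_fun_limn_esup (f := fun j (z : mR * mR) => (picard j z.1 z.2)%:E)) => n.
by apply/measurable_EFinP; have [[]] := iterates_props n.
Qed.

Lemma causal_amplitude : causal amplitude.
Proof.
move=> a x a0; rewrite /amplitude.
rewrite (_ : (fun j => _) = cst 0%E); last first.
  by apply/funext => j; have [[_ _ ->//]] := iterates_props j.
by rewrite (cvg_limn_einf_sup (cvg_cst _)).2.
Qed.

Lemma l1bound_amplitude : l1bound amplitude M.
Proof.
move=> x; apply: le_trans (integral_dominant x).
apply: ae_ge0_le_integral => //.
- apply/measurable_EFinP; apply: measurableT_comp => //; apply: mfun2_1; exact: mfun2_amplitude.
- by move=> a _; exact: dominant_ge0.
- exact: measurable_dominant.
have := integrable_ae measurableT (integrable_dominant x).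
apply: filterS => a /(_ I) fd _; rewrite -(fineK fd) lee_fin.
have h : `|picard j a x| @[j --> \oo] --> `|amplitude a x|.
  by apply: cvg_norm; exact: cvg_picard.
rewrite -(cvg_lim (@Rhausdorff R) h); apply: limr_le; first exact: cvgP h.
by apply: nearW => j; rewrite -lee_fin fineK// picard_le.
Qed.

Section Char.
Variable chi : mR -> R[i].
Hypothesis mchi : cmeas chi.
Hypothesis chiD : forall a b, chi (a + b) = chi a * chi b.
Hypothesis chi_le1 : forall a, 0 <= a -> normc (chi a) <= 1.
Notation lap := (laplace chi).

Lemma cintble_pchi (f : mR -> R[i]) N : cmeas f -> (forall e, normc (f e) <= N) ->
  cintble mu (fun e => (pexp kappa e)%:C * chi e * f e).
Proof.
move=> mf fN; apply: (@le_cintble _ _ _ _ _ (fun e : mR => pexp kappa e * N)).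
- apply: cmeasM => //; apply: cmeasM => //; exact: cmeas_pexp.
- apply: (@eq_integrable _ _ _ _ setT measurableT (fun e => ((pexp kappa e)%:E * N%:E)%E)) => //.
  by apply: integrableZr => //; exact: integrable_pexp.
- by move=> e; rewrite normcM ler_pM ?normc_ge0// normc_pchi.
Qed.

Lemma laplace_picardS j x : lap (picard j.+1) x = lap (picard j) x + lap (increment j) x.
Proof.
have [[mE mD kE kD] [bE bD]] := iterates_props j.
rewrite /laplace -cintD; last 2 first.
- exact: (cintble_chi _ _ _ mE kE bE).
- exact: (cintble_chi _ _ _ mD kD bD).
by apply: eq_cint => a; rewrite /picard /= rmorphD mulrDr.
Qed.

(** On transforms D (2 E + D) is the difference of the squares of consecutive iterates, ready to be
    telescoped. *)
Lemma laplace_incrementS j x : lap (increment j.+1) x =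
  - cint mu (fun e => (pexp kappa e)%:C * chi e * 
     (lap (picard j.+1) (x + e) ^+ 2 - lap (picard j) (x + e) ^+ 2)).
Proof.
have [[mE mD kE kD] [bE bD]] := iterates_props j.
have mS : mfun2 (fun a x => 2 * picard j a x + increment j a x).
  by apply: mfun2D => //; exact: mfun2Z.
have kS : causal (fun a x => 2 * picard j a x + increment j a x).
  by move=> a y a0; rewrite kE// kD// mulr0 addr0.
have bS : l1bound (fun a x => 2 * picard j a x + increment j a x) (2 * (bounds j).1 + (bounds j).2).
  have := l1boundD (mfun2Z 2 mE) mD (l1boundZ 2 mE bE) bD.
  by rewrite ger0_norm.
transitivity (- lap (ricconv kappa (increment j) (fun a x => 2 * picard j a x + increment j a x)) x).
  rewrite /laplace -cintN; last first.
    exact: (cintble_chi mchi chi_le1 x (mfun2_conv kappa0 mD mS) (causal_conv kappa kD kS)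
      (l1bound_conv kappa0 mD mS bD bS)).
  by apply: eq_cint => a; rewrite /increment /= rmorphN mulrN.
rewrite (laplace_conv kappa0 mchi chiD chi_le1 x mD mS kD kS bD bS); congr (- _).
apply: eq_cint => e; congr (_ * _).
rewrite laplace_picardS.
have -> : lap (fun a x => 2 * picard j a x + increment j a x) (x + e) =
  2 * lap (picard j) (x + e) + lap (increment j) (x + e).
  have i1 := cintble_chi mchi chi_le1 (x + e) mE kE bE.
  have i2 := cintble_chi mchi chi_le1 (x + e) mD kD bD.
  rewrite /laplace -cintZ// -cintD//; last exact: cintbleZ.
  by apply: eq_cint => a; rewrite rmorphD rmorphM /=; ring.
ring.
Qed.

Lemma cmeas_lap_shift j x : cmeas (fun e : mR => lap (picard j) (x + e)).
Proof.
have [[mE _ _ _] _] := iterates_props j.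
have [h1 h2] := cmeas_laplace mchi mE.
by split; [apply: (measurableT_comp h1)|apply: (measurableT_comp h2)]; exact: measurable_funD.
Qed.

Lemma normc_lap_picard j x : normc (lap (picard j) x) <= M.
Proof.
have [[mE _ kE _] [bE _]] := iterates_props j.
exact: le_trans (normc_laplace mchi chi_le1 x mE kE bE) (bounds_le j).
Qed.

Lemma laplace_picard0 x : lap (picard 0) x = 0.
Proof.
transitivity (cint mu (fun _ : mR => (0 : R)%:C)); first by apply: eq_cint => a; rewrite mulr0.
by rewrite cintr Rintegral_cst// mul0r.
Qed.

(** The first increment contributes the term in [q0]; each later one replaces the square of an
    iterate by that of the next. *)
Lemma laplace_picard_fix j x : lap (picard j.+1) x =
  cint mu (fun e => (pexp kappa e)%:C * chi e * ((q0 (x + e))%:C - lap (picard j) (x + e) ^+ 2)).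
Proof.
have i2 j' : cintble mu (fun e => (pexp kappa e)%:C * chi e * lap (picard j') (x + e) ^+ 2).
  apply: (cintble_pchi (N := M ^+ 2)).
    by under [fun e => _]eq_fun do rewrite expr2; apply: cmeasM; exact: cmeas_lap_shift.
  by move=> e; rewrite !expr2 normcM ler_pM ?normc_ge0 ?normc_lap_picard.
have iq : cintble mu (fun e => (pexp kappa e)%:C * chi e * (q0 (x + e))%:C).
  apply: (cintble_pchi (N := c)); last by move=> e; rewrite normcr.
  by apply: cmeasr; apply: (measurableT_comp mq); exact: measurable_funD.
elim: j => [|j IH].
  rewrite laplace_picardS laplace_picard0 add0r; apply: eq_cint => e; rewrite laplace_picard0.
  by rewrite expr0n/= subr0 /increment/= rmorphM/=; ring.
pose f e := (pexp kappa e)%:C * chi e * ((q0 (x + e))%:C - lap (picard j) (x + e) ^+ 2).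
pose g e := (pexp kappa e)%:C * chi e * (lap (picard j.+1) (x + e) ^+ 2 - lap (picard j) (x + e) ^+ 2).
have cf : cintble mu f.
  rewrite (_ : f = (fun e => (pexp kappa e)%:C * chi e * (q0 (x + e))%:C - (pexp kappa e)%:C * chi e * lap (picard j) (x + e) ^+ 2)).
    exact: (cintbleB iq (i2 j)).
  by apply/funext => e; rewrite /f mulrBr.
have cg : cintble mu g.
  rewrite (_ : g = (fun e => (pexp kappa e)%:C * chi e * lap (picard j.+1) (x + e) ^+ 2 - (pexp kappa e)%:C * chi e * lap (picard j) (x + e) ^+ 2)).
    exact: (cintbleB (i2 j.+1) (i2 j)).
  by apply/funext => e; rewrite /g mulrBr.
rewrite laplace_picardS laplace_incrementS IH -[LHS](cintB cf cg).
by apply: eq_cint => e; rewrite /f /g -mulrBr; congr (_ * _); rewrite opprB addrA subrK.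
Qed.

Lemma cvg_laplace_picard x :
  re (lap (picard j) x) @[j --> \oo] --> re (lap amplitude x) /\
  im (lap (picard j) x) @[j --> \oo] --> im (lap amplitude x).
Proof.
have [] // := @cint_dominated _ _ _ mu (fun j a => chi a * (picard j a x)%:C)
  (fun a => chi a * (amplitude a x)%:C) (dominant^~ x).
- by move=> j; apply: cmeas_chi => //; have [[]] := iterates_props j.
- by apply: cmeas_chi => //; exact: mfun2_amplitude.
- have := ae_cvg_picard x; apply: filterS => a ca.
  split; under eq_fun do rewrite ?reM ?imM /= mulr0 ?subr0 ?addr0 ?add0r;
    rewrite ?reM ?imM /= mulr0 ?subr0 ?addr0 ?add0r; apply: cvgM => //; exact: cvg_cst.
- exact: integrable_dominant.
- apply: aeW => a j; apply: le_trans (picard_le j a x); rewrite lee_fin.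
  have [[mE _ kE _] [bE _]] := iterates_props j.
  exact: normc_chi.
Qed.

Lemma normc_laplace_amplitude x : normc (lap amplitude x) <= M.
Proof.
exact: (normc_laplace mchi chi_le1 x mfun2_amplitude causal_amplitude l1bound_amplitude).
Qed.

Lemma cmeas_laplace_amplitude : cmeas (lap amplitude).
Proof. exact: (cmeas_laplace mchi mfun2_amplitude). Qed.

(** The limit is taken in the equation for the transforms, where the integrand is dominated by (c +
    M^2) [pexp], rather than in the convolution equation. *)
Lemma laplace_amplitude_fix x : lap amplitude x =
  cint mu (fun e => (pexp kappa e)%:C * chi e * ((q0 (x + e))%:C - lap amplitude (x + e) ^+ 2)).
Proof.
have [c1 c2] := cvg_laplace_picard x.
have mla : cmeas (fun e : mR => lap amplitude (x + e)).
  have [h1 h2] := cmeas_laplace_amplitude.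
  by split; [apply: (measurableT_comp h1)|apply: (measurableT_comp h2)]; exact: measurable_funD.
have mqx : cmeas (fun e : mR => (q0 (x + e))%:C).
  by apply: cmeasr; apply: (measurableT_comp mq); exact: measurable_funD.
have mpc : cmeas (fun e => (pexp kappa e)%:C * chi e).
  by apply: cmeasM => //; exact: cmeas_pexp.
have [] // := @cint_dominated _ _ _ mu
  (fun j e => (pexp kappa e)%:C * chi e * ((q0 (x + e))%:C - lap (picard j) (x + e) ^+ 2))
  (fun e => (pexp kappa e)%:C * chi e * ((q0 (x + e))%:C - lap amplitude (x + e) ^+ 2))
  (fun e => ((pexp kappa e)%:E * (c + M ^+ 2)%:E)%E).
- move=> j; apply: cmeasM => //; apply: cmeasB => //.
  by under [fun e => _]eq_fun do rewrite expr2; apply: cmeasM; exact: cmeas_lap_shift.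
- apply: cmeasM => //; apply: cmeasB => //.
  by under [fun e => _]eq_fun do rewrite expr2; apply: cmeasM.
- apply: aeW => e; have [d1 d2] := cvg_laplace_picard (x + e).
  set L := lap amplitude (x + e) in d1 d2 *.
  set P := (pexp kappa e)%:C * chi e.
  split; rewrite expr2 !(reM, imM, reD, imD, reN, imN);
    under eq_fun do rewrite expr2 !(reM, imM, reD, imD, reN, imN).
  + apply: cvgB; apply: cvgM; try exact: cvg_cst.
    * apply: cvgB; first exact: cvg_cst.
      by apply: cvgB; apply: cvgM.
    * apply: cvgB; first exact: cvg_cst.
      by apply: cvgD; apply: cvgM.
  + apply: cvgD; apply: cvgM; try exact: cvg_cst.
    * apply: cvgB; first exact: cvg_cst.
      by apply: cvgD; apply: cvgM.
    * apply: cvgB; first exact: cvg_cst.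
      by apply: cvgB; apply: cvgM.
- by apply: integrableZr => //; exact: integrable_pexp.
- apply: aeW => e j; rewrite -EFinM lee_fin normcM ler_pM ?normc_ge0 ?normc_pchi//.
  apply: le_trans (normcB _ _) _; rewrite normcr lerD//.
  by rewrite !expr2 normcM ler_pM ?normc_ge0 ?normc_lap_picard.
move=> _ e1 e2.
apply/eqP; rewrite eq_complex; apply/andP; split; apply/eqP.
- have c1' : re (lap (picard j.+1) x) @[j --> \oo] --> re (lap amplitude x).
    by rewrite (cvg_shiftS (fun j => re (lap (picard j) x))).
  apply: (cvg_unique (@Rhausdorff R) _ e1).
  by move: c1'; under eq_fun do rewrite laplace_picard_fix.
- have c2' : im (lap (picard j.+1) x) @[j --> \oo] --> im (lap amplitude x).
    by rewrite (cvg_shiftS (fun j => im (lap (picard j) x))).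
  apply: (cvg_unique (@Rhausdorff R) _ e2).
  by move: c2'; under eq_fun do rewrite laplace_picard_fix.
Qed.

End Char.
End Amplitude.

(** * From the Riccati equation to the Weyl solution *)

Section ComplexDerivative.
Variable R : realType.
Implicit Types (f g : R -> R[i]) (x a b : R) (l : R[i]).

Lemma is_deriveM_fun (f g : R -> R) x (df dg : R) : is_derive x 1 f df -> is_derive x 1 g dg ->
  is_derive x 1 (fun t => f t * g t) (df * g x + f x * dg).
Proof.
move=> hf hg; have D := is_deriveM hf hg.
have -> : df * g x + f x * dg = f x *: dg + g x *: df by rewrite /GRing.scale /=; ring.
exact: D.
Qed.

Lemma is_deriveB_fun (f g : R -> R) x (df dg : R) : is_derive x 1 f df -> is_derive x 1 g dg ->
  is_derive x 1 (fun t => f t - g t) (df - dg).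
Proof. by move=> hf hg; exact: is_deriveB. Qed.

Lemma is_deriveD_fun (f g : R -> R) x (df dg : R) : is_derive x 1 f df -> is_derive x 1 g dg ->
  is_derive x 1 (fun t => f t + g t) (df + dg).
Proof. by move=> hf hg; exact: is_deriveD. Qed.

Definition is_cderive f x l :=
  is_derive x 1 (fun t => re (f t)) (re l) /\ is_derive x 1 (fun t => im (f t)) (im l).

Lemma is_cderive_cderivable f x l : is_cderive f x l -> cderivable f x.
Proof. by move=> [[h1 _] [h2 _]]. Qed.

Lemma is_cderive_val f x l : is_cderive f x l -> cderive f x = l.
Proof.
move=> [[_ h1] [_ h2]]; rewrite /cderive !derive1E h1 h2.
by case: l {h1 h2}.
Qed.

Lemma is_cderive_eq f x l l' : is_cderive f x l -> l = l' -> is_cderive f x l'.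
Proof. by move=> h <-. Qed.

Lemma is_cderive_near f g x l : (\forall y \near x, f y = g y) -> is_cderive f x l -> is_cderive g x l.
Proof.
move=> fg [h1 h2]; split.
- by apply: near_eq_is_derive h1; apply: filterS fg => y ->.
- by apply: near_eq_is_derive h2; apply: filterS fg => y ->.
Qed.

Lemma is_cderive_cst c x : is_cderive (fun=> c) x 0.
Proof. by split; exact: is_derive_cst. Qed.

Lemma is_cderiveD f g x l l' : is_cderive f x l -> is_cderive g x l' ->
  is_cderive (fun t => f t + g t) x (l + l').
Proof.
move=> [f1 f2] [g1 g2]; split; rewrite ?reD ?imD.
- by under eq_fun do rewrite reD; exact: is_deriveD.
- by under eq_fun do rewrite imD; exact: is_deriveD.
Qed.

Lemma is_cderiveM f g x l l' : is_cderive f x l -> is_cderive g x l' ->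
  is_cderive (fun t => f t * g t) x (l * g x + f x * l').
Proof.
move=> [f1 f2] [g1 g2]; split.
- under eq_fun do rewrite reM.
  apply: (is_derive_eq (is_deriveB_fun (is_deriveM_fun f1 g1) (is_deriveM_fun f2 g2))).
  by rewrite reD !reM /=; ring.
- under eq_fun do rewrite imM.
  apply: (is_derive_eq (is_deriveD_fun (is_deriveM_fun f1 g2) (is_deriveM_fun f2 g1))).
  by rewrite imD !imM /=; ring.
Qed.

Lemma is_cderiveN f x l : is_cderive f x l -> is_cderive (fun t => - f t) x (- l).
Proof.
move=> [f1 f2]; split; rewrite ?reN ?imN.
- by under eq_fun do rewrite reN; exact: is_deriveN.
- by under eq_fun do rewrite imN; exact: is_deriveN.
Qed.

Lemma is_cderiveB f g x l l' : is_cderive f x l -> is_cderive g x l' ->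
  is_cderive (fun t => f t - g t) x (l - l').
Proof. by move=> hf hg; apply: is_cderiveD => //; exact: is_cderiveN. Qed.

Lemma is_cderiver (h : R -> R) x d : is_derive x 1 h d -> is_cderive (fun t => (h t)%:C) x d%:C.
Proof. by move=> hh; split => //=; exact: is_derive_cst. Qed.

Lemma is_cderive_cexp f x l : is_cderive f x l -> is_cderive (fun t => cexp (f t)) x (l * cexp (f x)).
Proof.
move=> [f1 f2].
have e1 : is_derive x 1 (fun t => expR (re (f t))) (expR (re (f x)) * re l).
  exact: (@is_derive1_comp _ expR (fun t => re (f t))).
have e2 : is_derive x 1 (fun t => cos (im (f t))) (- sin (im (f x)) * im l).
  exact: (@is_derive1_comp _ cos (fun t => im (f t))).
have e3 : is_derive x 1 (fun t => sin (im (f t))) (cos (im (f x)) * im l).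
  exact: (@is_derive1_comp _ sin (fun t => im (f t))).
split; rewrite /cexp /=.
- apply: (is_derive_eq (is_deriveM_fun e1 e2)).
  by rewrite reM /=; ring.
- apply: (is_derive_eq (is_deriveM_fun e1 e3)).
  by rewrite imM /=; ring.
Qed.

Lemma is_cderive_linear (c : R[i]) x : is_cderive (fun t => t%:C * c) x c.
Proof.
apply: is_cderive_eq.
  apply: is_cderiveM; last exact: is_cderive_cst.
  by apply: is_cderiver; exact: is_derive_id.
by rewrite mulr0 addr0 mul1r.
Qed.

(** As the right-hand side of the Riccati equation is bounded, all functions involved are Lipschitz
    on compact intervals. This property passes to products and gives both the absolute continuity
    required of a solution and the value of [at0]. *)
Definition clipschitz a b f := exists2 L, 0 <= L &
  forall x y, a <= x <= b -> a <= y <= b -> normc (f x - f y) <= L * `|x - y|.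

Lemma clipschitz_bounded a b f : a <= b -> clipschitz a b f ->
  exists2 B, 0 <= B & forall x, a <= x <= b -> normc (f x) <= B.
Proof.
move=> ab [L L0 h]; exists (normc (f a) + L * (b - a)).
  by rewrite addr_ge0 ?normc_ge0// mulr_ge0// subr_ge0.
move=> x /andP[ax xb]; rewrite -[f x](subrK (f a)) addrC.
apply: le_trans (normcD _ _) _; rewrite lerD2l.
apply: le_trans (h x a _ _) _; rewrite ?ax ?xb ?lexx ?ab//.
by rewrite ler_wpM2l// ger0_norm ?subr_ge0// lerB.
Qed.

Lemma clipschitzM a b f g : a <= b -> clipschitz a b f -> clipschitz a b g -> clipschitz a b (fun x => f x * g x).
Proof.
move=> ab cf cg; have [Bf Bf0 hBf] := clipschitz_bounded ab cf; have [Bg Bg0 hBg] := clipschitz_bounded ab cg.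
case: cf => Lf Lf0 hf; case: cg => Lg Lg0 hg.
exists (Lf * Bg + Bf * Lg); first by rewrite addr_ge0// mulr_ge0.
move=> x y xab yab.
rewrite (_ : _ - _ = (f x - f y) * g x + f y * (g x - g y)); last by ring.
apply: le_trans (normcD _ _) _; rewrite !normcM mulrDl lerD//.
- by rewrite mulrAC ler_pM ?normc_ge0 ?hf ?hBg.
- by rewrite -mulrA ler_pM ?normc_ge0 ?hg ?hBf.
Qed.

Lemma clipschitz_cst a b c : clipschitz a b (fun=> c).
Proof. by exists 0 => // x y _ _; rewrite subrr mul0r normc0. Qed.

Lemma clipschitzD a b f g : clipschitz a b f -> clipschitz a b g -> clipschitz a b (fun x => f x + g x).
Proof.
move=> [Lf Lf0 hf] [Lg Lg0 hg]; exists (Lf + Lg); first exact: addr_ge0.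
move=> x y xab yab; rewrite (_ : _ - _ = (f x - f y) + (g x - g y)); last by ring.
by apply: le_trans (normcD _ _) _; rewrite mulrDl lerD ?hf ?hg.
Qed.

Lemma clipschitzN a b f : clipschitz a b f -> clipschitz a b (fun x => - f x).
Proof.
move=> [L L0 h]; exists L => // x y xab yab.
by rewrite -opprD normcN h.
Qed.

Lemma clipschitzB a b f g : clipschitz a b f -> clipschitz a b g -> clipschitz a b (fun x => f x - g x).
Proof. by move=> cf cg; apply: clipschitzD => //; exact: clipschitzN. Qed.

Lemma eq_clip a b f g : (forall x, a <= x <= b -> f x = g x) -> clipschitz a b f -> clipschitz a b g.
Proof. by move=> fg [L L0 h]; exists L => // x y xab yab; rewrite -!fg// h. Qed.

Let lip_derive (h dh : R -> R) a b (N : R) :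
  (forall x, a <= x <= b -> is_derive x 1 h (dh x)) -> (forall x, a <= x <= b -> `|dh x| <= N) ->
  forall x y, a <= x <= b -> a <= y <= b -> `|h x - h y| <= N * `|x - y|.
Proof.
move=> hd hN x y.
wlog yx : x y / y <= x.
  move=> H xab yab; have [yx|/ltW xy] := leP y x; first exact: H.
  by rewrite distrC (distrC x); apply: H.
move=> /andP[ax xb] /andP[ay yb].
have sub z : z \in `[y, x] -> a <= z <= b.
  by rewrite in_itv /= => /andP[yz zx]; rewrite (le_trans ay yz) (le_trans zx xb).
have [z zyx ->] : exists2 z, z \in `[y, x] & h x - h y = dh z * (x - y).
  apply: MVT_segment => //.
  - by move=> z zyx; apply: hd; apply: sub; exact: subset_itv_oo_cc.
  - apply: derivable_within_continuous => z zyx.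
    by have [] := hd z (sub _ zyx).
by rewrite normrM ler_wpM2r// hN// sub.
Qed.

(** The mean value theorem applies to each component separately, hence the constant N + N. *)
Lemma clipschitz_derive f (l : R -> R[i]) a b (N : R) : 0 <= N ->
  (forall x, a <= x <= b -> is_cderive f x (l x)) -> (forall x, a <= x <= b -> normc (l x) <= N) ->
  clipschitz a b f.
Proof.
move=> N0 fl lN; exists (N + N); first exact: addr_ge0.
move=> x y xab yab; apply: le_trans (normc_le_reim _) _; rewrite mulrDl !(reD, imD, reN, imN) lerD//.
- apply: (lip_derive (h := fun x => re (f x)) (dh := fun x => re (l x)) (a := a) (b := b)) => // z zab.
  + by case: (fl z zab).
  + exact: le_trans (normr_re _) (lN z zab).
- apply: (lip_derive (h := fun x => im (f x)) (dh := fun x => im (l x)) (a := a) (b := b)) => // z zab.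
  + by case: (fl z zab).
  + exact: le_trans (normr_im _) (lN z zab).
Qed.

Lemma clipschitz_absolutely_continuous a b f : clipschitz a b f -> absolutely_continuous a b f.
Proof.
(* L + 1 in place of L keeps the divisor positive. *)
move=> [L L0 h] e e0; exists (e / (L + 1)); first by rewrite divr_gt0// ltr_wpDl.
move=> n s t st _ sd.
have L1 : 0 < L + 1 by rewrite ltr_wpDl.
apply: le_lt_trans (_ : (L + 1) * \sum_(i < n) (t i - s i) < e).
  rewrite mulr_sumr; apply: ler_sum => i _; have [as_ sti tb] := st i.
  apply: le_trans (h _ _ _ _) _.
  - by rewrite (le_trans as_ sti).
  - by rewrite as_ (le_trans sti tb).
  - by rewrite ger0_norm ?subr_ge0// ler_wpM2r ?subr_ge0// lerDl.
by rewrite mulrC -ltr_pdivlMr.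
Qed.

Lemma at0_clipschitz f : clipschitz 0 1 f -> at0 f = f 0.
Proof.
move=> [L L0 h]; rewrite /at0; apply: (@cvg_lim R[i]^o); first exact: norm_hausdorff.
apply/cvgrPdist_le => eps eps0.
(* Radii in [R[i]^o] are complex numbers; being positive forces the imaginary part to vanish. *)
have epsE : eps = (re eps)%:C by move: eps0; case: (eps) => u v; rewrite ltcE /= => /andP[/eqP -> _].
have re0 : 0 < re eps by move: eps0; rewrite ltcE => /andP[].
near=> x.
rewrite epsE -[X in X <= _]/((normc (f 0 - f x))%:C) lecR.
have x0 : 0 < x by near: x; exact: nbhs_right_gt.
have x1 : x <= 1 by near: x; exact: nbhs_right_le.
apply: le_trans (h _ _ _ _) _; rewrite ?lexx ?ler01 ?(ltW x0) ?x1//.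
rewrite sub0r normrN gtr0_norm//.
apply: le_trans (_ : (L + 1) * x <= _); first by rewrite ler_wpM2r ?(ltW x0)// lerDl.
rewrite mulrC -ler_pdivlMr ?ltr_wpDl//; near: x; apply: nbhs_right_le.
by rewrite divr_gt0// ltr_wpDl.
Unshelve. all: by end_near. Qed.

End ComplexDerivative.

(** * Primitives of integrable functions *)

Section Primitive.
Variable R : realType.
Notation mu := (@lebesgue_measure R).

Lemma is_derive1 (f : R -> R) (x l : R) : derivable f x 1 -> derive1 f x = l -> is_derive x 1 f l.
Proof. by move=> df <-; rewrite derive1E; exact: derivableP. Qed.

Lemma integrable_cst (A : set (measurableTypeR R)) (r : R) : measurable A -> (mu A < +oo)%E ->
  mu.-integrable A (EFin \o (fun=> r)).
Proof.
move=> mA fA; apply: measurable_bounded_integrable => //.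
exists `|r|; split; first exact: num_real.
by move=> s rs x _; rewrite /= ltW.
Qed.

Lemma Rintegral_cst_itv (a b r : R) (b1 b2 : bool) : a <= b ->
  \int[mu]_(_ in [set` Interval (BSide b1 a) (BSide b2 b)]) r = r * (b - a).
Proof.
move=> ab; rewrite Rintegral_cst//; congr (_ * _).
transitivity (fine (lebesgue_measure [set` Interval (BSide b1 a) (BSide b2 b)])) => //.
rewrite lebesgue_measure_itv/= lte_fin.
case: ltP => //= ba.
by rewrite (le_anti (introT andP (conj ba ab))) subrr.
Qed.

Lemma cintegral_indic (A : set R) (H : measurableTypeR R -> R[i]) :
  cintegral A H = cint mu (fun y => (\1_A y)%:C * H y).
Proof.
rewrite /cintegral /cint; congr (_ +i* _); rewrite Rintegral_mkcond; apply: eq_Rintegral => y _;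
  by rewrite patchE ?reM ?imM /= mul0r ?subr0 ?addr0 indicE; case: ifP => _; rewrite ?mul1r ?mul0r.
Qed.

Lemma ae_derive_primitive (h : R -> R) : mu.-integrable setT (EFin \o h) ->
  {ae mu, forall x : R, is_derive x 1 (fun x : R => \int[mu]_(t in `]-oo, x]) h t) (h x)}.
Proof.
move=> ih.
have ihy y : mu.-integrable `]-oo, y] (EFin \o h) by apply: integrableS ih.
have := FTC1Ny ihy (open_integrable_locally openT ih).
apply: filterS; first exact: (ae_filter_ringOfSetsType mu).
by move=> x [d1 d2]; exact: is_derive1.
Qed.

Lemma lip_primitive (h : R -> R) (N : R) : mu.-integrable setT (EFin \o h) -> (forall x, `|h x| <= N) ->
  forall x y, `|\int[mu]_(t in `]-oo, x]) h t - \int[mu]_(t in `]-oo, y]) h t| <= N * `|x - y|.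
Proof.
move=> ih hN x y.
wlog yx : x y / y <= x.
  move=> H; have [yx|/ltW xy] := leP y x; first exact: H.
  by rewrite distrC (distrC x); apply: H.
have ihx (i : interval R) : mu.-integrable [set` i] (EFin \o h).
  exact: integrableS ih.
rewrite Rintegral_itvB//.
apply: le_trans (le_normr_Rintegral _ _) _ => //.
have fmu : (mu `]y, x] < +oo)%E by rewrite lebesgue_measure_itv/=; case: ifP => // _; rewrite -EFinB ltry.
apply: le_trans (_ : \int[mu]_(t in `]y, x]) N <= _).
  apply: le_Rintegral => //.
  - exact: integrable_norm.
  - exact: integrable_cst.
by rewrite Rintegral_cst_itv// ger0_norm// subr_ge0.
Qed.

Lemma clipschitz_continuous (a b x : R) (f : R -> R[i]) : clipschitz a b f -> a < x < b ->
  {for x, continuous (fun t => re (f t))} /\ {for x, continuous (fun t => im (f t))}.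
Proof.
move=> [L L0 h] /andP[ax xb].
suff H (g : R -> R) : (forall y, a <= y <= b -> `|g x - g y| <= L * `|x - y|) -> {for x, continuous g}.
  split; apply: H => y yab; (apply: le_trans (h x y _ _); last by []);
    rewrite ?(ltW ax) ?(ltW xb)//.
  - by rewrite -reN -reD; exact: normr_re.
  - by rewrite -imN -imD; exact: normr_im.
move=> hg; apply/cvgrPdist_le => e e0; near=> y.
have ay : a < y by near: y; exact: lt_nbhsr.
have yb : y < b by near: y; exact: lt_nbhsl.
apply: le_trans (hg y _) _; first by rewrite !ltW.
apply: le_trans (_ : (L + 1) * `|x - y| <= _); first by rewrite ler_wpM2r// lerDl.
rewrite mulrC -ler_pdivlMr ?ltr_wpDl//; near: y.
by apply: cvgr_dist_le; [exact: cvg_id|rewrite divr_gt0// ltr_wpDl].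
Unshelve. all: by end_near. Qed.

End Primitive.

(** * The Weyl solution obtained from a solution of the fixed point equation *)

Section Weyl.
Variables (R : realType) (k : R[i]) (c M : R) (q0 : measurableTypeR R -> R).
Variable F : measurableTypeR R -> R[i].
Notation mu := (@lebesgue_measure R).
Notation mR := (measurableTypeR R).
Hypothesis c0 : 0 <= c.
Hypothesis mq : measurable_fun setT q0.
Hypothesis qc : forall x, `|q0 x| <= c.
Hypothesis k0 : 0 < re k.
Hypothesis Mk : M < re k.
Hypothesis mF : cmeas F.
Hypothesis FM : forall x, normc (F x) <= M.
Hypothesis Ffix : forall x, F x = cint mu (fun e : mR =>
  (\1_(`[0, +oo[%classic : set R) e)%:C * cexp (- (2 * e)%:C * k) * ((q0 (x + e))%:C - F (x + e) ^+ 2)).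

(** The inhomogeneous term of the Riccati equation F' = 2 k F - g. *)
Let g y := (q0 y)%:C - F y ^+ 2.
Let B := c + M ^+ 2.
Let M0 : 0 <= M. Proof. exact: le_trans (normc_ge0 _) (FM 0). Qed.
Let B0 : 0 <= B. Proof. by rewrite addr_ge0// sqr_ge0. Qed.

Let mg : cmeas g.
Proof.
apply: cmeasB; first exact: cmeasr.
by under [fun e => _]eq_fun do rewrite expr2; apply: cmeasM.
Qed.

Let gB y : normc (g y) <= B.
Proof.
apply: le_trans (normcB _ _) _; rewrite normcr lerD//.
by rewrite !expr2 normcM ler_pM ?normc_ge0.
Qed.

(* [q0] lives on the whole line, so the solution is constructed on a
   neighbourhood of 0 and [at0] is just its value there. *)
Let half := (`]-2, +oo[%classic : set R).
Let H (y : mR) : R[i] := (\1_half y)%:C * (cexp (- (2 * y)%:C * k) * g y).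

Let mE : cmeas (fun y : mR => cexp (- (2 * y)%:C * k)).
Proof.
apply: cmeas_cexp; apply: cmeasM; last exact: cmeas_cst.
by apply: cmeasN; apply: cmeasr; exact: measurable_funM.
Qed.

Let mH : cmeas H.
Proof.
apply: cmeasM; last exact: cmeasM.
by apply: cmeasr; apply: measurable_indic; exact: measurable_itv.
Qed.

Let reE y : re (- (2 * y)%:C * k) = - (2 * re k * y).
Proof. by rewrite reM reN imN /= oppr0 mul0r subr0 mulNr mulrAC. Qed.

(** On y > -2 one has e^(-2 y re k) = e^(4 re k) e^(-2 (y + 2) re k), which makes the majorant a
    translate of [pexp]. *)
Let HB y : normc (H y) <= B * expR (4 * re k) * pexp (re k) (y + 2).
Proof.
rewrite /H normcM normcr indicE /pexp.
have [y2|y2] := boolP (y \in half); last first.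
  rewrite normr0 mul0r !mulr_ge0 ?expR_ge0//; case: ifP => // _; exact: expR_ge0.
move: y2; rewrite inE /half /= in_itv/= andbT => y2.
rewrite normr1 mul1r normcM normc_cexp reE ifT; last by rewrite -lerBlDr sub0r ltW.
rewrite -[leRHS]mulrA -expRD mulrC ler_pM ?normc_ge0 ?expR_ge0 ?gB//.
by rewrite ler_expR; lra.
Qed.

Let pexp_le1 y : pexp (re k) y <= 1.
Proof.
rewrite /pexp; case: ifP => // y0; rewrite -expR0 ler_expR oppr_le0.
by rewrite !mulr_ge0// ltW.
Qed.

Let cH : cintble mu H.
Proof.
apply: (le_cintble (g := fun y : mR => B * expR (4 * re k) * pexp (re k) (y + 2))) => //.
have := integrable_shift 2 (integrable_pexp k0).
move=> /(integrableZl measurableT (B * expR (4 * re k))).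
by apply: eq_integrable.
Qed.

Let HB1 y : normc (H y) <= B * expR (4 * re k).
Proof.
apply: le_trans (HB y) _; rewrite ler_piMr// mulr_ge0 ?expR_ge0//.
Qed.

Let I x : R[i] := (\int[mu]_(t in `]-oo, x]) re (H t)) +i* (\int[mu]_(t in `]-oo, x]) im (H t)).

Let cutH x : cintble mu (fun y : mR => (\1_(`]-oo, x]%classic : set R) y)%:C * H y).
Proof.
apply: (le_cintble (g := fun y : mR => normc (H y))).
- apply: cmeasM => //; apply: cmeasr; apply: measurable_indic; exact: measurable_itv.
- exact: (integrable_normc cH).
- move=> y; rewrite normcM normcr indicE; case: (_ \in _); rewrite ?normr1 ?mul1r//.
  by rewrite normr0 mul0r normc_ge0.
Qed.

Let IE x : I x = cint mu (fun y : mR => (\1_(`]-oo, x]%classic : set R) y)%:C * H y).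
Proof.
exact: cintegral_indic.
Qed.

(** With y = x + e the fixed point equation becomes F x = e^(2 k x) int_(y > x) e^(-2 k y) g y dy.
    Now x enters only through a smooth factor and a limit of integration, so F is Lipschitz on
    compact intervals and differentiable almost everywhere. *)
Lemma riccati_repr x : -2 < x -> F x = cexp ((2 * x)%:C * k) * (cint mu H - I x).
Proof.
move=> x2; rewrite Ffix.
pose W (y : mR) : R[i] := (\1_(`[0, +oo[%classic : set R) (y - x))%:C * cexp (- (2 * (y - x))%:C * k) * g y.
have ms : measurable_fun setT (fun y : mR => y - x : mR) by exact: measurable_shift.
have mW : cmeas W.
  apply: cmeasM => //; apply: cmeasM.
    apply: cmeasr; apply: (measurableT_comp _ ms).
    by apply: measurable_indic; exact: measurable_itv.
  by case: mE => h1 h2; split; [apply: (measurableT_comp h1)|apply: (measurableT_comp h2)].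
transitivity (cint mu W).
  rewrite -(cint_shift x mW); apply: eq_cint => e.
  by rewrite /W addrK (addrC e x).
rewrite IE -(cintB cH (cutH x)) -cintZ; last exact: cintbleB.
apply: ae_eq_cint; first exact: mW.
  apply: cmeasM; first exact: cmeas_cst.
  exact: (cmeasB mH (cintble_meas (cutH x))).
(* The ray y >= x and the complement of ]-oo, x] differ at the single point y = x. *)
exists [set x]; split => //; first exact: lebesgue_measure_set1.
move=> y /= h; apply: contrapT => /eqP yx; apply: h.
rewrite /W /H !indicE.
have [xy|xy] := ltP x y.
- have -> : y - x \in (`[0, +oo[%classic : set R) by rewrite inE/= in_itv/= andbT subr_ge0 ltW.
  have -> : y \in half by rewrite inE /half /= in_itv/= andbT (lt_trans x2).
  have -> : (y \in (`]-oo, x]%classic : set R)) = false.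
    by apply/negP; rewrite inE/= in_itv/= leNgt xy.
  rewrite mul0r subr0 !mul1r mulrA -cexpD; congr (cexp _ * _).
  by rewrite mulrBr rmorphB /= ; ring.
- have yx' : y < x by rewrite lt_neqAle yx.
  have -> : (y - x \in (`[0, +oo[%classic : set R)) = false.
    by apply/negP; rewrite inE/= in_itv/= andbT subr_ge0 leNgt yx'.
  have -> : (y \in (`]-oo, x]%classic : set R)) by rewrite inE/= in_itv/=.
  by rewrite !mul0r mul1r subrr mulr0.
Qed.

Lemma clipschitz_riccati a b : -2 < a -> a <= b -> clipschitz a b F.
Proof.
move=> a2 ab; apply: (eq_clip (f := fun x => cexp ((2 * x)%:C * k) * (cint mu H - I x))).
  by move=> x /andP[ax _]; rewrite -riccati_repr// (lt_le_trans a2).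
apply: clipschitzM => //.
  pose N := normc (2%:C * k) * expR (2 * b * re k).
  apply: (clipschitz_derive (l := fun x => 2%:C * k * cexp ((2 * x)%:C * k)) (N := N)).
  - by rewrite mulr_ge0 ?normc_ge0 ?expR_ge0.
  - move=> x _; apply: is_cderive_cexp.
    rewrite (_ : (fun t => _) = (fun t : R => t%:C * (2%:C * k))); first exact: is_cderive_linear.
    by apply/funext => t; rewrite rmorphM /= mulrA (mulrC t%:C).
  - move=> x /andP[_ xb]; rewrite normcM ler_wpM2l ?normc_ge0// normc_cexp ler_expR.
    rewrite reM /= mul0r subr0 ler_wpM2r ?(ltW k0)// ler_wpM2l//.
apply: clipschitzB; first exact: clipschitz_cst.
pose N := B * expR (4 * re k).
have N0 : 0 <= N by rewrite mulr_ge0 ?expR_ge0.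
exists (N + N); first by rewrite addr_ge0.
move=> x y _ _; apply: le_trans (normc_le_reim _) _; rewrite mulrDl !(reD, imD, reN, imN).
case: cH => h1 h2; rewrite lerD//; apply: lip_primitive => // t.
- exact: le_trans (normr_re _) (HB1 t).
- exact: le_trans (normr_im _) (HB1 t).
Qed.

(** Product rule on [riccati_repr]: differentiating the integral contributes - e^(2 k x) H x = - g
    x. *)
Lemma ae_derive_riccati : {ae mu, forall x : R, -2 < x -> is_cderive F x (2%:C * k * F x - g x)}.
Proof.
case: cH => h1 h2.
have := ae_derive_primitive h1; have := ae_derive_primitive h2.
apply: (@filterS2 _ _ (ae_filter_ringOfSetsType mu)) => x d2 d1 x2.
apply: (is_cderive_near (f := fun x => cexp ((2 * x)%:C * k) * (cint mu H - I x))).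
  by near=> y; rewrite -riccati_repr//; near: y; exact: lt_nbhsr.
have dI : is_cderive I x (H x) by split.
apply: is_cderive_eq.
  apply: is_cderiveM; last by apply: is_cderiveB; [exact: is_cderive_cst|exact: dI].
  apply: is_cderive_cexp.
  rewrite (_ : (fun t => _) = (fun t : R => t%:C * (2%:C * k))); first exact: is_cderive_linear.
  by apply/funext => t; rewrite rmorphM /= mulrA (mulrC t%:C).
rewrite sub0r -mulrA -riccati_repr// mulrN; congr (_ - _).
rewrite /H indicE (_ : x \in half) ?mul1r; last by rewrite inE /half /= in_itv/= andbT.
rewrite mulrA -cexpD (_ : _ + _ = 0); first by rewrite cexp0 mul1r.
by rewrite mulNr subrr.
Unshelve. all: by end_near. Qed.

(** Almost everywhere m' = q0 + k^2 - m^2, so that u' = m u entails u'' = (m' + m^2) u = (q0 + k^2)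
    u. *)
Definition riccati x := - k - F x.
Notation m := riccati.

Lemma clipschitz_m a b : -2 < a -> a <= b -> clipschitz a b m.
Proof. by move=> a2 ab; apply: clipschitzB; [exact: clipschitz_cst|exact: clipschitz_riccati]. Qed.

Let N := normc k + M.
Let mN x : normc (m x) <= N.
Proof. by apply: le_trans (normcB _ _) _; rewrite normcN lerD. Qed.

Let cm : cmeas (m : mR -> _).
Proof. by apply: cmeasB => //; exact: cmeas_cst. Qed.

Let im_ (u : R) : mu.-integrable `[-1, u] (fun x => (re (m x))%:E) /\
  mu.-integrable `[-1, u] (fun x => (im (m x))%:E).
Proof.
have fmu : (mu `[(-1)%R, u] < +oo)%E.
  by rewrite lebesgue_measure_itv/=; case: ifP => // _; rewrite -EFinB ltry.
case: cm => h1 h2; split; apply: measurable_bounded_integrable => //.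
- exact: measurable_funTS.
- exists N; split; first exact: num_real.
  by move=> r Nr x _; rewrite /= (le_trans (le_trans (normr_re _) (mN x)))// ltW.
- exact: measurable_funTS.
- exists N; split; first exact: num_real.
  by move=> r Nr x _; rewrite /= (le_trans (le_trans (normr_im _) (mN x)))// ltW.
Qed.

(** The base point -1 keeps 0 inside the interval on which P is differentiable. *)
Let P x : R[i] := (\int[mu]_(t in `[-1, x]) re (m t)) +i* (\int[mu]_(t in `[-1, x]) im (m t)).

Let derP x : -1 < x -> is_cderive P x (m x).
Proof.
move=> x1; have [i1 i2] := im_ (x + 1).
have a2 : -2 < (x - 1) / 2 by lra.
have ax : (x - 1) / 2 <= x + 1 by lra.
have xx : (x - 1) / 2 < x < x + 1 by apply/andP; split; lra.
have [c1 c2] := clipschitz_continuous (clipschitz_m a2 ax) xx.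
have x1' : x < x + 1 by rewrite ltrDl.
have [d1 e1] := continuous_FTC1_closed x1' i1 x1 c1.
have [d2 e2] := continuous_FTC1_closed x1' i2 x1 c2.
exact: (conj (is_derive1 d1 e1) (is_derive1 d2 e2)).
Qed.

Definition weyl x := cexp (P x).
Notation u := weyl.

Lemma derive_weyl x : -1 < x -> is_cderive u x (m x * u x).
Proof. by move=> x1; apply: is_cderive_cexp; exact: derP. Qed.

Let d := re k - M.
Let d0 : 0 < d. Proof. by rewrite subr_gt0. Qed.

(** From |F| <= M < re k follows re m <= - d with d > 0; the resulting exponential decay of u makes
    it square integrable. *)
Let reP x : -1 <= x -> re (P x) <= - (d * (x + 1)).
Proof.
move=> x1; rewrite /P /=.
have fmu : (mu `[(-1)%R, x] < +oo)%E.
  by rewrite lebesgue_measure_itv/=; case: ifP => // _; rewrite -EFinB ltry.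
apply: le_trans (_ : \int[mu]_(t in `[-1, x]) (- d) <= _).
  apply: le_Rintegral => //.
  - by case: (im_ x).
  - exact: integrable_cst.
  - move=> t _; rewrite /riccati reD !reN /d.
    have := le_trans (normr_re (F t)) (FM t); rewrite ler_norml => /andP[]; lra.
by rewrite Rintegral_cst_itv// opprK mulNr.
Qed.

Let uN x : -1 <= x -> normc (u x) <= expR (- (d * (x + 1))).
Proof. by move=> x1; rewrite normc_cexp ler_expR reP. Qed.

Lemma clipschitz_weyl a b : -1 < a -> a <= b -> clipschitz a b u.
Proof.
move=> a1 ab; apply: (clipschitz_derive (l := fun x => m x * u x) (N := N * 1)).
- by rewrite mulr1 (le_trans (normc_ge0 _) (mN 0)).
- by move=> x /andP[ax _]; apply: derive_weyl; exact: lt_le_trans ax.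
- move=> x /andP[ax _]; rewrite normcM ler_pM ?normc_ge0//.
  have x1 : -1 <= x by rewrite (le_trans (ltW a1)).
  apply: le_trans (uN x1) _; rewrite -[leRHS]expR0 ler_expR oppr_le0 mulr_ge0 ?(ltW d0)//.
  by rewrite -lerBlDr sub0r.
Qed.

Let du x : -1 < x -> cderive u x = m x * u x.
Proof. by move=> x1; apply: is_cderive_val; exact: derive_weyl. Qed.

Lemma clipschitz_dweyl a b : -1 < a -> a <= b -> clipschitz a b (cderive u).
Proof.
move=> a1 ab; apply: (eq_clip (f := fun x => m x * u x)).
  by move=> x /andP[ax _]; rewrite du// (lt_le_trans a1).
by apply: clipschitzM => //; [apply: clipschitz_m => //; lra|exact: clipschitz_weyl].
Qed.

Variable q : R -> R.
Hypothesis qq0 : {ae mu, forall x, 0 < x -> q x = q0 x}.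

(** The equation is required almost everywhere only, so the bounded representative [q0] may stand
    for [q]. *)
Lemma weyl_solutionP : weyl_solution q (- k ^+ 2) u.
Proof.
split.
- split.
  + move=> x x0; apply: is_cderive_cderivable; apply: derive_weyl; lra.
  + move=> a b a0 ab; apply: clipschitz_absolutely_continuous; apply: clipschitz_weyl; lra.
  + move=> a b a0 ab; apply: clipschitz_absolutely_continuous; apply: clipschitz_dweyl; lra.
  + have := ae_derive_riccati; move: qq0; apply: (@filterS2 _ _ (ae_filter_ringOfSetsType mu)) => x qx dF x0.
    have x1 : -1 < x by lra.
    have x2 : -2 < x by lra.
    have D : is_cderive (cderive u) x ((g x - 2%:C * k * F x) * u x + m x * (m x * u x)).
      apply: (is_cderive_near (f := fun x => m x * u x)).
        by near=> y; rewrite du//; near: y; exact: lt_nbhsr.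
      apply: is_cderive_eq.
        apply: is_cderiveM; last exact: derive_weyl.
        by apply: is_cderiveB; [exact: is_cderive_cst|exact: dF].
      by rewrite sub0r opprB.
    split; first exact: (is_cderive_cderivable D).
    rewrite (is_cderive_val D) (qx x0) /g /riccati (_ : 2%:C = 2 :> R[i]); last by rewrite rmorph_nat.
    ring.
- by exists 1 => //; exact: cexp_neq0.
- exists 1 => //.
  have ip := integrable_pexp d0.
  apply: (@le_integrable _ _ _ _ _ _ _ (EFin \o pexp d)) => //.
  + apply/measurable_EFinP.
    rewrite (_ : (fun x => _) = (fun x => expR (re (P x)) ^+ 2)); last first.
      by apply/funext => x; rewrite /weyl normc_cexp.
    apply: open_continuous_measurable_fun; first exact: rray_open.
    move=> x; rewrite inE/= in_itv/= andbT => x1.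
    have x1' : -1 < x by lra.
    have [[dd _] _] := derP x1'.
    have cP : {for x, continuous (fun t => re (P t))}.
      by apply: differentiable_continuous; exact/derivable1_diffP.
    have cE : {for x, continuous (fun t => expR (re (P t)))}.
      by apply: (continuous_comp cP); exact: continuous_expR.
    under eq_fun do rewrite expr2.
    exact: (continuousM cE cE).
  + move=> x; rewrite /= in_itv/= andbT => x1; rewrite lee_fin ger0_norm ?sqr_ge0//.
    rewrite ger0_norm ?pexp_ge0// /pexp ifT; last by lra.
    have x1' : -1 <= x by lra.
    apply: le_trans (_ : expR (- (d * (x + 1))) ^+ 2 <= _).
      by rewrite ler_sqr ?nnegrE ?normc_ge0 ?expR_ge0 ?uN.
    rewrite expr2 -expRD ler_expR.
    have := mulr_ge0 (ltW d0) (_ : 0 <= x + 1); rewrite -/d; nra.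
  + exact: integrableS ip.
Unshelve. all: by end_near. Qed.

Lemma weyl_quotient : at0 (cderive u) / at0 u = - k - F 0.
Proof.
rewrite !at0_clipschitz; [|apply: clipschitz_weyl; lra|apply: clipschitz_dweyl; lra].
rewrite du; last by lra.
by rewrite mulfK// cexp_neq0.
Qed.

End Weyl.

(** * A complex Gaussian integral *)

Section DiffUnder.
Context d (T : measurableType d) (R : realType) (mu : {measure set T -> \bar R}).

Lemma is_cderive_cint (f df : R -> T -> R[i]) (a u v : R) (G : T -> R) : u < a < v ->
  (forall x, u < x < v -> cintble mu (f x)) ->
  (forall x y, u < x < v -> is_cderive (f ^~ y) x (df x y)) ->
  mu.-integrable setT (EFin \o G) ->
  (forall x y, u < x < v -> normc (df x y) <= G y) ->
  is_cderive (fun x => cint mu (f x)) a (cint mu (df a)).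
Proof.
move=> uav cf fdf iG GB.
have Ia : `]u, v[%classic a by rewrite /= in_itv.
have G0 y : 0 <= G y by apply: le_trans (normc_ge0 _) (GB a y uav).
have I2 x : `]u, v[%classic x -> u < x < v by rewrite /= in_itv.
have p1 x y : u < x < v -> partial1of2 (fun x y => re (f x y)) x y = re (df x y).
  by move=> ux; rewrite /partial1of2 derive1E; have [[_ ->] _] := fdf x y ux.
have p2 x y : u < x < v -> partial1of2 (fun x y => im (f x y)) x y = im (df x y).
  by move=> ux; rewrite /partial1of2 derive1E; have [_ [_ ->]] := fdf x y ux.
split.
- have h1 x : `]u, v[%classic x -> mu.-integrable setT (EFin \o (fun y => re (f x y))).
    by move=> /I2 ux; have [] := cf x ux.
  have h2 x y : `]u, v[%classic x -> setT y -> derivable (fun x => re (f x y)) x 1.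
    by move=> /I2 ux _; have [[]] := fdf x y ux.
  have h3 x y : `]u, v[%classic x -> setT y -> `|partial1of2 (fun x y => re (f x y)) x y| <= G y.
    by move=> /I2 ux _; rewrite p1// (le_trans (normr_re _))// GB.
  apply: is_derive1; first exact: (derivable_under_integral measurableT Ia h1 h2 G0 iG h3).
  rewrite (differentiation_under_integral measurableT Ia h1 h2 G0 iG h3).
  by apply: eq_Rintegral => y _; exact: p1.
- have h1 x : `]u, v[%classic x -> mu.-integrable setT (EFin \o (fun y => im (f x y))).
    by move=> /I2 ux; have [] := cf x ux.
  have h2 x y : `]u, v[%classic x -> setT y -> derivable (fun x => im (f x y)) x 1.
    by move=> /I2 ux _; have [_ []] := fdf x y ux.
  have h3 x y : `]u, v[%classic x -> setT y -> `|partial1of2 (fun x y => im (f x y)) x y| <= G y.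
    by move=> /I2 ux _; rewrite p2// (le_trans (normr_im _))// GB.
  apply: is_derive1; first exact: (derivable_under_integral measurableT Ia h1 h2 G0 iG h3).
  rewrite (differentiation_under_integral measurableT Ia h1 h2 G0 iG h3).
  by apply: eq_Rintegral => y _; exact: p2.
Qed.

End DiffUnder.

Section Gaussian.
Variable R : realType.
Notation mu := (@lebesgue_measure R).
Notation mR := (measurableTypeR R).

Lemma normal_fun_scale (s r : R) : normal_fun 0 s r = expR (- (r ^+ 2 / (s ^+ 2 *+ 2))).
Proof. by rewrite /normal_fun subr0 mulNr. Qed.

Lemma integrable_gauss (s : R) : s != 0 ->
  mu.-integrable setT (EFin \o (fun r : mR => expR (- (r ^+ 2 / (s ^+ 2 *+ 2))))).
Proof.
move=> s0; have := integrable_normal_pdf 0 s.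
move=> /(integrableZl measurableT (normal_peak s)^-1); apply: eq_integrable => // r _ /=.
rewrite -EFinM normal_pdfE// normal_fun_scale mulrA mulVf ?mul1r//.
by rewrite gt_eqF// normal_peak_gt0.
Qed.

Lemma Rintegral_gauss (s : R) : s != 0 ->
  \int[mu]_r expR (- (r ^+ 2 / (s ^+ 2 *+ 2))) = Num.sqrt (s ^+ 2 * pi *+ 2).
Proof.
move=> s0; have p0 := normal_peak_gt0 s0.
apply: (mulfI (lt0r_neq0 p0)); rewrite -RintegralZl//; last exact: integrable_gauss.
have := integral_normal_pdf 0 s; rewrite normal_pdfE//.
under eq_integral do rewrite normal_fun_scale.
rewrite /Rintegral => ->; rewrite /= /normal_peak mulVf//.
by rewrite -invr_eq0 lt0r_neq0.
Qed.

Lemma integrable_gauss2 : mu.-integrable setT (EFin \o (fun r : mR => expR (- (r ^+ 2 / 2)))).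
Proof.
have := integrable_gauss (oner_neq0 R); apply: eq_integrable => // r _ /=.
by rewrite expr1n.
Qed.

Lemma integrable_gauss4 : mu.-integrable setT (EFin \o (fun r : mR => expR (- (r ^+ 2 / 4)))).
Proof.
have s0 : (Num.sqrt 2 : R) != 0 by rewrite sqrtr_eq0 -ltNge.
have := integrable_gauss s0; apply: eq_integrable => // r _ /=.
by rewrite sqr_sqrtr//; do 4 f_equal; lra.
Qed.

(* A direction inside the sector with Re (omega^2) = 1, so that
   e^(- (omega r)^2) has modulus e^(-r^2). *)
Definition omega : R[i] := (41 / 40) +i* (- (9 / 40)).

(** Coordinates are rational thanks to 41^2 - 9^2 = 40^2. The imaginary part is nonzero, which keeps
    the ray off the real axis after squaring, and small, which is used in [gaussI0_neq0]. *)
Lemma omega2 : omega ^+ 2 = 1 +i* (- (369 / 800)).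
Proof. by apply/eqP; rewrite expr2 eq_complex /=; apply/andP; split; apply/eqP; lra. Qed.

Lemma omega_neq0 : omega != 0.
Proof. by rewrite eq_complex /= negb_and; apply/orP; left; apply/eqP; lra. Qed.

Definition gaussc (z : R[i]) (r : mR) : R[i] := cexp (- (omega * r%:C + z) ^+ 2).

Lemma re_gaussc z r : re (- (omega * r%:C + z) ^+ 2) =
  - (r ^+ 2 + 2 * (41 / 40 * re z + 9 / 40 * im z) * r + re z ^+ 2 - im z ^+ 2).
Proof. by rewrite reN expr2 !(reM, reD, imD, imM) /=; field. Qed.

Lemma normc_gaussc z r K : normc z <= K ->
  normc (gaussc z r) <= expR (5 * K ^+ 2) * expR (- (r ^+ 2 / 2)).
Proof.
move=> zK; rewrite normc_cexp re_gaussc -expRD ler_expR.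
have := le_trans (normr_re z) zK; have := le_trans (normr_im z) zK.
rewrite !ler_norml => /andP[b1 b2] /andP[a1 a2].
set a := re z in a1 a2 *; set b := im z in b1 b2 *.
set t := 41 / 40 * a + 9 / 40 * b.
have K0 : 0 <= K by lra.
have b2K : b ^+ 2 <= K ^+ 2 by rewrite -ler_sqrt ?sqr_ge0// !sqrtr_sqr (ger0_norm K0) ler_norml b1 b2.
have t2K : t ^+ 2 <= (5 / 4 * K) ^+ 2.
  rewrite -ler_sqrt ?sqr_ge0// !sqrtr_sqr (ger0_norm (_ : 0 <= 5 / 4 * K)); last by lra.
  by rewrite ler_norml /t; apply/andP; split; lra.
(* Completing the square, r^2 / 2 + 2 t r + 2 t^2 >= 0; the rest is 2 t^2 + b^2 <= (25 / 8 + 1) K^2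
   <= 5 K^2. *)
have := sqr_ge0 (r + 2 * t); have := sqr_ge0 a; have := sqr_ge0 K.
move: b2K t2K; rewrite !expr2; nra.
Qed.

Lemma cmeas_gaussc z : cmeas (gaussc z).
Proof.
have m1 : cmeas (fun r : mR => omega * r%:C + z).
  apply: cmeasD; last exact: cmeas_cst.
  by apply: cmeasM; [exact: cmeas_cst|apply: cmeasr; exact: measurable_id].
by apply: cmeas_cexp; apply: cmeasN; under [fun e => _]eq_fun do rewrite expr2; apply: cmeasM.
Qed.

Lemma cintble_gaussc z : cintble mu (gaussc z).
Proof.
apply: (le_cintble (g := fun r : mR => expR (5 * normc z ^+ 2) * expR (- (r ^+ 2 / 2)))).
- exact: cmeas_gaussc.
- by have := integrableZl measurableT (expR (5 * normc z ^+ 2)) integrable_gauss2; apply: eq_integrable.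
- by move=> r; exact: normc_gaussc.
Qed.

(** Absorbs a linear factor into the Gaussian at the price of half its exponent. *)
Lemma le_normr_expR (r : R) : `|r| <= expR (r ^+ 2 / 4).
Proof.
apply: le_trans (expR_ge1Dx _).
by rewrite -(real_normK (num_real r)); have := sqr_ge0 (`|r| / 2 - 1); rewrite !expr2; lra.
Qed.

Definition gaussI (z : R[i]) : R[i] := cint mu (gaussc z).
(** The complex derivative of [gaussI], taken under the integral sign. *)
Definition gaussI' (z : R[i]) : R[i] := cint mu (fun r => - 2%:C * (omega * r%:C + z) * gaussc z r).

Lemma normc_dgaussc z r K : normc z <= K ->
  normc (- 2%:C * (omega * r%:C + z) * gaussc z r) <=
  2 * (2 + K) * expR (5 * K ^+ 2) * expR (- (r ^+ 2 / 4)).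
Proof.
move=> zK; have K0 : 0 <= K := le_trans (normc_ge0 _) zK.
rewrite !normcM normcN normcr ger0_norm// -!mulrA ler_wpM2l//.
have h1 : normc (omega * r%:C + z) <= (2 + K) * expR (r ^+ 2 / 4).
  apply: le_trans (normcD _ _) _; rewrite normcM normcr mulrDl lerD//.
    apply: ler_pM => //; rewrite ?normc_ge0 ?le_normr_expR//.
    apply: le_trans (normc_le_reim _) _; rewrite /= normrN !ger0_norm; lra.
  apply: le_trans zK _; rewrite ler_peMr// -[leLHS]expR0 ler_expR.
  by rewrite divr_ge0// sqr_ge0.
apply: le_trans (ler_pM (normc_ge0 _) (normc_ge0 _) h1 (normc_gaussc r zK)) _.
rewrite -mulrA ler_wpM2l ?addr_ge0// mulrCA ler_wpM2l ?expR_ge0// -expRD ler_expR; lra.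
Qed.

(** Holomorphy expressed through real directional derivatives: all directions zeta share the factor
    [gaussI'] z. *)
Lemma is_cderive_gaussI z zeta : is_cderive (fun h : R => gaussI (z + h%:C * zeta)) 0 (zeta * gaussI' z).
Proof.
pose K := normc z + normc zeta.
have zK (x : R) : -1 < x < 1 -> normc (z + x%:C * zeta) <= K.
  move=> /andP[x1 x2]; apply: le_trans (normcD _ _) _; rewrite lerD// normcM normcr.
  by rewrite ler_piMl ?normc_ge0// ler_norml !ltW.
pose df (x : R) (r : mR) : R[i] := zeta * (- 2%:C * (omega * r%:C + (z + x%:C * zeta)) * gaussc (z + x%:C * zeta) r).
have -> : zeta * gaussI' z = cint mu (df 0).
  rewrite /df /gaussI' -cintZ.
    by apply: eq_cint => r; rewrite mul0r addr0.
  apply: (le_cintble (g := fun r : mR => 2 * (2 + normc z) * expR (5 * normc z ^+ 2) * expR (- (r ^+ 2 / 4)))).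
  - apply: cmeasM; last exact: cmeas_gaussc.
    apply: cmeasM; first exact: cmeas_cst.
    apply: cmeasD; last exact: cmeas_cst.
    by apply: cmeasM; [exact: cmeas_cst|apply: cmeasr; exact: measurable_id].
  - by have := integrableZl measurableT (2 * (2 + normc z) * expR (5 * normc z ^+ 2)) integrable_gauss4; apply: eq_integrable.
  - by move=> r; exact: normc_dgaussc.
apply: (is_cderive_cint (df := df) (u := -1) (v := 1)
  (G := fun r : mR => normc zeta * (2 * (2 + K) * expR (5 * K ^+ 2) * expR (- (r ^+ 2 / 4))))).
- by rewrite ltrN10 ltr01.
- by move=> x _; exact: cintble_gaussc.
- move=> x r _; rewrite /gaussc.
  have D0 : is_cderive (fun h : R => omega * r%:C + (z + h%:C * zeta)) x zeta.
    apply: is_cderive_eq.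
      apply: is_cderiveD; first exact: is_cderive_cst.
      apply: is_cderiveD; first exact: is_cderive_cst.
      exact: is_cderive_linear.
    by rewrite !add0r.
  apply: is_cderive_eq.
    apply: is_cderive_cexp; apply: is_cderiveN.
    under eq_fun do rewrite expr2.
    exact: (is_cderiveM D0 D0).
  rewrite /df /gaussc (_ : 2%:C = 2 :> R[i]); last by rewrite rmorph_nat.
  by ring.
- have := integrableZl measurableT (normc zeta * (2 * (2 + K) * expR (5 * K ^+ 2))) integrable_gauss4.
  by apply: eq_integrable => // r _ /=; rewrite -EFinM !mulrA.
- by move=> x r x1; rewrite /df normcM ler_wpM2l ?normc_ge0// normc_dgaussc// zK.
Qed.

(* Translating the variable of integration moves z along omega, so that the
   holomorphic function gaussI has derivative 0. *)
Lemma gaussI'0 z : gaussI' z = 0.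
Proof.
have sh (h : R) : gaussI (z + h%:C * omega) = gaussI z.
  rewrite /gaussI -[RHS](cint_shift h (cmeas_gaussc z)); apply: eq_cint => r.
  by rewrite /gaussc rmorphD /=; congr (cexp (- _ ^+ 2)); ring.
have D := is_cderive_gaussI z omega.
have D0 : is_cderive (fun h : R => gaussI (z + h%:C * omega)) 0 0.
  by under eq_fun do rewrite sh; exact: is_cderive_cst.
have := is_cderive_val D; rewrite (is_cderive_val D0) => /esym/eqP.
by rewrite mulf_eq0 (negbTE omega_neq0) => /eqP.
Qed.

(** By holomorphy the derivative that vanishes along omega vanishes along the real axis as well. *)
Lemma gaussI_const (x : R) : gaussI x%:C = gaussI 0.
Proof.
have D (y : R) : is_cderive (fun h : R => gaussI h%:C) y 0.
  have := is_cderive_gaussI y%:C 1; rewrite mul1r gaussI'0 => -[d1 d2].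
  have E (f : R[i] -> R) : is_derive (0 : R) 1 (fun h : R => f (gaussI (y%:C + h%:C * 1))) 0 ->
      is_derive y 1 (fun h : R => f (gaussI h%:C)) 0.
    move=> h.
    have s1 : is_derive y 1 (fun t : R => t - y) 1.
      exact: (is_derive_shift y 1 (- y)).
    have h' : is_derive (y - y) 1 (fun h : R => f (gaussI (y%:C + h%:C * 1))) 0 by rewrite subrr.
    have := @is_derive1_comp _ (fun h : R => f (gaussI (y%:C + h%:C * 1))) (fun t : R => t - y) y 0 1 h' s1.
    rewrite mul0r (_ : _ \o _ = (fun h : R => f (gaussI h%:C)))//.
    by apply/funext => t /=; rewrite mulr1 -rmorphD /= addrC subrK.
  by split; [exact: (E (@complex.Re R))|exact: (E (@complex.Im R))].
apply/eqP; rewrite eq_complex; apply/andP; split; apply/eqP.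
- by apply: (@is_derive_0_is_cst _ (fun h : R => re (gaussI h%:C))) => y; case: (D y).
- by apply: (@is_derive_0_is_cst _ (fun h : R => im (gaussI h%:C))) => y; case: (D y).
Qed.

Lemma cos_ge (y : R) : 0 <= y -> 1 - y <= cos y.
Proof.
move=> y0.
have [z _ h] : exists2 z, z \in `[0, y] & cos y - cos 0 = - sin z * (y - 0).
  apply: (MVT_segment (f := cos) (df := fun z => - sin z)) => //.
  by apply: continuous_subspaceT; exact: continuous_cos.
have : `|sin z| <= 1 by exact: sin_max.
rewrite ler_norml => /andP[s1 s2].
move: h; rewrite cos0 subr0 => h; have : sin z * y <= 1 * y by rewrite ler_wpM2r.
lra.
Qed.

(** The real part is positive: cos y >= 1 - y at y = 369/800 r^2 and r^2 e^(-r^2) <= e^(-r^2 / 2)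
    bound it below by sqrt pi (1 - 369/800 sqrt 2), and sqrt 2 < 3/2. *)
Lemma gaussI0_neq0 : gaussI 0 != 0.
Proof.
suff : 0 < re (gaussI 0) by apply: contraTneq => ->; rewrite ltxx.
have i1 : mu.-integrable setT (EFin \o (fun r : mR => expR (- r ^+ 2))).
  exact: integrableT_gauss.
have i2 := integrable_gauss2.
have i3 := integrableZl measurableT (369 / 800) i2.
have i4 := integrableB measurableT i1 i3.
apply: lt_le_trans (_ : \int[mu]_r (expR (- r ^+ 2) - 369 / 800 * expR (- (r ^+ 2 / 2))) <= _).
  have g1 : \int[mu]_r expR (- r ^+ 2) = Num.sqrt pi by rewrite /Rintegral integralT_gauss.
  rewrite RintegralB; [|exact: measurableT|exact: i1|exact: i3].
  rewrite RintegralZl; [|exact: measurableT|exact: i2].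
  rewrite g1.
  have -> : \int[mu]_r expR (- (r ^+ 2 / 2)) = Num.sqrt (pi *+ 2).
    have := Rintegral_gauss (oner_neq0 R); by rewrite expr1n mul1r => <-; apply: eq_Rintegral.
  have p0 : 0 < Num.sqrt (pi : R) by rewrite sqrtr_gt0 pi_gt0.
  rewrite -(mulr_natl pi 2) (@sqrtrM R 2 pi (ler0n _ _)).
  have s2 : Num.sqrt 2 < 3 / 2 :> R.
    rewrite -[ltRHS]ger0_norm; last by lra.
    by rewrite -sqrtr_sqr ltr_sqrt; lra.
  have : 0 < Num.sqrt (pi : R) * (3 / 2 - Num.sqrt 2) by rewrite mulr_gt0 ?subr_gt0.
  by move: p0; set p := Num.sqrt _; set t := Num.sqrt _; nra.
rewrite -[leRHS]/(\int[mu]_r re (gaussc 0 r)).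
apply: le_Rintegral; [exact: measurableT|exact: i4|by case: (cintble_gaussc 0)|].
move=> r _; rewrite /gaussc addr0.
have e1 : re (- (omega * r%:C) ^+ 2) = - r ^+ 2.
  by have := re_gaussc 0 r; rewrite addr0 => ->; rewrite /=; ring.
have e2 : im (- (omega * r%:C) ^+ 2) = 369 / 800 * r ^+ 2.
  by rewrite imN expr2 !(reM, imM) /=; lra.
rewrite -[re (cexp _)]/(expR (re (- (omega * r%:C) ^+ 2)) * cos (im (- (omega * r%:C) ^+ 2))) e1 e2.
have r2 := sqr_ge0 r.
have c := cos_ge (_ : 0 <= 369 / 800 * r ^+ 2).
have b : r ^+ 2 * expR (- r ^+ 2) <= expR (- (r ^+ 2 / 2)).
  have -> : - (r ^+ 2 / 2) = r ^+ 2 / 2 + (- r ^+ 2) by lra.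
  rewrite expRD ler_wpM2r ?expR_ge0//.
  have h := le_normr_expR r; rewrite -(real_normK (num_real r)) expr2.
  apply: le_trans (ler_pM _ _ h h) _ => //; rewrite -expRD ler_expR -(real_normK (num_real r)); lra.
have e0 := expR_ge0 (- r ^+ 2).
have k0 : 0 <= 369 / 800 * r ^+ 2 by lra.
apply: le_trans (ler_wpM2l e0 (c k0)); move: b.
by set E := expR (- r ^+ 2); set E' := expR _; set r' := r ^+ 2; lra.
Qed.

End Gaussian.

(** * Uniqueness of Laplace representations along a ray *)

Section Transfer.
Variable R : realType.
Notation mu := (@lebesgue_measure R).
Notation mR := (measurableTypeR R).
Variables (B : mR -> R[i]) (s : mR -> R) (S0 : R).
Hypothesis cB : cintble mu B.
Hypothesis ms : measurable_fun setT s.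
Hypothesis S00 : 0 <= S0.
Hypothesis sB : forall x, B x != 0 -> 0 <= s x <= S0.
Hypothesis hB : forall eta : R, 0 < eta -> exists C, forall t : R,
  normc (cint mu (fun x => B x * cexp ((s x * t)%:C * omega R))) <= C * expR (eta * `|t|).
Notation w := (omega R).

(** Since x r w - (w r)^2 = x^2 / 4 - (w r - x / 2)^2, the integral is e^(x^2 / 4) [gaussI] (- x /
    2), and [gaussI_const] removes the shift. *)
Lemma cint_gauss (x : R) :
  cint mu (fun r : mR => cexp ((x * r)%:C * w - (w * r%:C) ^+ 2)) = (expR (x ^+ 2 / 4))%:C * gaussI (0 : R[i]).
Proof.
rewrite -(gaussI_const (- x / 2)) /gaussI -cintZ; last exact: cintble_gaussc.
apply: eq_cint => r; rewrite /gaussc -cexpr -cexpD; congr (cexp _).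
have -> : ((- x / 2)%:C : R[i]) = - (x%:C / 2).
  by rewrite rmorphM rmorphN fmorphV rmorph_nat mulNr.
have -> : ((x ^+ 2 / 4)%:C : R[i]) = x%:C ^+ 2 / 4.
  by rewrite rmorphM rmorphXn fmorphV rmorph_nat.
by rewrite rmorphM /=; field.
Qed.

Let Phi (l : R) (z : mR * mR) := B z.1 * cexp ((s z.1 * l * z.2)%:C * w - (w * z.2%:C) ^+ 2).

Let PhiB l z : 0 <= l -> normc (Phi l z) <= normc (B z.1) * (expR ((l * S0) ^+ 2) * expR (- (z.2 ^+ 2 / 2))).
Proof.
move=> l0; rewrite /Phi normcM.
have [->|B0] := eqVneq (B z.1) 0; first by rewrite normc0 !mul0r.
rewrite ler_wpM2l ?normc_ge0// normc_cexp -expRD ler_expR.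
have /andP[s0 sS] := sB B0.
have -> : re ((s z.1 * l * z.2)%:C * w - (w * z.2%:C) ^+ 2) = 41 / 40 * (s z.1 * l) * z.2 - z.2 ^+ 2.
  by rewrite reD reN expr2 !(reM, imM) /=; field.
have u0 : 0 <= s z.1 * l by rewrite mulr_ge0.
have uS : s z.1 * l <= l * S0 by rewrite mulrC ler_wpM2l.
have h : (s z.1 * l) ^+ 2 <= (l * S0) ^+ 2 by rewrite ler_sqr// nnegrE// (le_trans u0).
move: h; set u := s z.1 * l; set v := (l * S0) ^+ 2; set r := z.2 => h.
have := sqr_ge0 (r - 41 / 40 * u); have := sqr_ge0 u; move: h; rewrite !expr2; nra.
Qed.

Let mPhi l : cmeas (Phi l).
Proof.
have [h1 h2] := cintble_meas cB.
apply: cmeasM; first by split; [apply: (measurableT_comp h1)|apply: (measurableT_comp h2)].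
apply: cmeas_cexp; apply: cmeasB.
  apply: cmeasM; last exact: cmeas_cst.
  apply: cmeasr; apply: measurable_funM; last exact: measurable_snd.
  by apply: measurable_funM => //; apply: (measurableT_comp ms); exact: measurable_fst.
under [fun e => _]eq_fun do rewrite expr2.
have m1 : cmeas (fun z : mR * mR => w * z.2%:C).
  by apply: cmeasM; [exact: cmeas_cst|apply: cmeasr; exact: measurable_snd].
exact: cmeasM.
Qed.

Let cPhi l : 0 <= l -> cintble (mu \x mu)%E (Phi l).
Proof.
move=> l0; apply: (le_cintble (g := fun z : mR * mR => normc (B z.1) * (expR ((l * S0) ^+ 2) * expR (- (z.2 ^+ 2 / 2))))) => //.
- have c1 : cintble mu (fun x : mR => (normc (B x))%:C).
    by split; [exact: integrable_normc|exact: integrable0].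
  have c2 : cintble mu (fun r : mR => (expR ((l * S0) ^+ 2) * expR (- (r ^+ 2 / 2)))%:C).
    split; last exact: integrable0.
    by have := integrableZl measurableT (expR ((l * S0) ^+ 2)) (integrable_gauss2 R); apply: eq_integrable.
  have [+ _] := cintble_prod c1 c2.
  by apply: eq_integrable => // z _ /=; rewrite mulr0 subr0.
- by move=> z; exact: PhiB.
Qed.

Let cBexp (L : R) : 0 <= L -> cintble mu (fun x => B x * (expR (L * s x ^+ 2))%:C).
Proof.
move=> L0; apply: (le_cintble (g := fun x : mR => expR (L * S0 ^+ 2) * normc (B x))).
- apply: cmeasM; first exact: (cintble_meas cB).
  apply: cmeasr; apply: measurableT_comp => //.
  by apply: measurable_funM => //; exact: measurable_funX.
- by have := integrableZl measurableT (expR (L * S0 ^+ 2)) (integrable_normc cB); apply: eq_integrable.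
- move=> x; rewrite normcM normcr ger0_norm ?expR_ge0// mulrC.
  have [->|/sB /andP[s0 sS]] := eqVneq (B x) 0; first by rewrite normc0 !mulr0.
  by rewrite ler_wpM2r ?normc_ge0// ler_expR ler_wpM2l// ler_sqr// nnegrE (le_trans s0).
Qed.

(** Put l^2 = 4 L and integrate B x e^(s x l r w - (w r)^2) in both orders. Integrating r first
    gives the integral to be bounded times [gaussI] 0; integrating x first gives the transform on
    the ray at t = l r. *)
Lemma gauss_transfer (eta : R) : 0 < eta -> exists C, forall L, 0 < L ->
  normc (cint mu (fun x => B x * (expR (L * s x ^+ 2))%:C)) <= C * expR (eta * L).
Proof.
(* Chosen so that e0 l |r| <= r^2 / 2 + (e0 l)^2 / 2 = r^2 / 2 + eta L: half of the Gaussian absorbs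
   the growth in r. *)
move=> eta0; pose e0 := Num.sqrt (eta / 2).
have e00 : 0 < e0 by rewrite sqrtr_gt0 divr_gt0.
have [C hC] := hB e00.
have C0 : 0 <= C by have := hC 0; rewrite normr0 mulr0 expR0 mulr1; apply: le_trans; exact: normc_ge0.
pose K := \int[mu]_(r in setT) expR (- (r ^+ 2 / 2)).
exists (C * K / normc (gaussI (0 : R[i]))) => L L0.
have J0 : 0 < normc (gaussI (0 : R[i])).
  by rewrite lt_neqAle normc_ge0 andbT eq_sym; apply/eqP => /eq0_normc/eqP; rewrite (negbTE (gaussI0_neq0 R)).
pose l := 2 * Num.sqrt L.
have l0 : 0 <= l by rewrite mulr_ge0// sqrtr_ge0.
have l2 : l ^+ 2 = 4 * L by rewrite /l exprMn sqr_sqrtr ?(ltW L0)// -natrX.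
have F := cint_Fubini (cPhi l0).
have E1 : cint mu (fun x => cint mu (fun r => Phi l (x, r))) =
    cint mu (fun x => B x * (expR (L * s x ^+ 2))%:C) * gaussI (0 : R[i]).
  rewrite -cintZr; last exact: cBexp (ltW L0).
  apply: eq_cint => x; rewrite /Phi /= cintZ.
    rewrite cint_gauss exprMn l2 mulrA; congr (_ * (expR _)%:C * _).
    by set u := s x ^+ 2; field.
  apply: (le_cintble (g := fun r : mR => expR ((41 / 40 * (s x * l)) ^+ 2 / 2) * expR (- (r ^+ 2 / 2)))).
  - apply: cmeas_cexp; apply: cmeasB.
      by apply: cmeasM; [apply: cmeasr; exact: measurable_funM|exact: cmeas_cst].
    under [fun e => _]eq_fun do rewrite expr2.
    have m1 : cmeas (fun r : mR => w * r%:C).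
      by apply: cmeasM; [exact: cmeas_cst|apply: cmeasr; exact: measurable_id].
    exact: cmeasM.
  - by have := integrableZl measurableT (expR ((41 / 40 * (s x * l)) ^+ 2 / 2)) (integrable_gauss2 R); apply: eq_integrable.
  - move=> r; rewrite normc_cexp -expRD ler_expR.
    have -> : re ((s x * l * r)%:C * w - (w * r%:C) ^+ 2) = 41 / 40 * (s x * l) * r - r ^+ 2.
      by rewrite reD reN expr2 !(reM, imM) /=; field.
    by have := sqr_ge0 (r - 41 / 40 * (s x * l)); set u := s x * l; rewrite !expr2; lra.
pose G r := cint mu (fun x => B x * cexp ((s x * (l * r))%:C * w)).
have cBt t : cintble mu (fun x => B x * cexp ((s x * t)%:C * w)).
  apply: (le_cintble (g := fun x : mR => expR (2 * S0 * `|t|) * normc (B x))).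
  - apply: cmeasM; first exact: (cintble_meas cB).
    by apply: cmeas_cexp; apply: cmeasM; [apply: cmeasr; exact: measurable_funM|exact: cmeas_cst].
  - by have := integrableZl measurableT (expR (2 * S0 * `|t|)) (integrable_normc cB); apply: eq_integrable.
  - move=> x; rewrite normcM mulrC.
    have [->|/sB /andP[s0 sS]] := eqVneq (B x) 0; first by rewrite normc0 !mulr0.
    apply: ler_wpM2r; first exact: normc_ge0.
    rewrite normc_cexp ler_expR.
    have -> : re ((s x * t)%:C * w) = s x * t * (41 / 40) by rewrite reM /= mul0r subr0.
    have h : s x * `|t| <= S0 * `|t| := ler_wpM2r (normr_ge0 t) sS.
    have h' : s x * t <= s x * `|t| := ler_wpM2l s0 (ler_norm t).
    have h2 : 0 <= S0 * `|t| := mulr_ge0 S00 (normr_ge0 t).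
    lra.
have E2 : cint mu (fun r => cint mu (fun x => Phi l (x, r))) =
    cint mu (fun r => G r * cexp (- (w * r%:C) ^+ 2)).
  apply: eq_cint => r; rewrite /G -cintZr; last exact: cBt.
  apply: eq_cint => x; rewrite /Phi /= -[RHS]mulrA -cexpD [s x * (l * r)]mulrA.
  by [].
rewrite E1 E2 in F.
rewrite mulrAC ler_pdivlMr// -normcM F.
have GB r : normc (G r * cexp (- (w * r%:C) ^+ 2)) <= C * expR (eta * L) * expR (- (r ^+ 2 / 2)).
  rewrite normcM -mulrA; apply: le_trans (ler_wpM2r (normc_ge0 _) (hC (l * r))) _.
  rewrite -mulrA ler_wpM2l// normc_cexp -!expRD ler_expR.
  have -> : re (- (w * r%:C) ^+ 2) = - r ^+ 2.
    by have := re_gaussc 0 r; rewrite addr0 => ->; rewrite /=; ring.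
  rewrite normrM (ger0_norm l0).
  have e2 : (e0 * l) ^+ 2 = 2 * (eta * L).
    by rewrite exprMn l2 /e0 sqr_sqrtr ?divr_ge0 ?(ltW eta0)//; field.
  have := sqr_ge0 (`|r| - e0 * l); rewrite sqrrB e2 real_normK ?num_real// mulr2n; lra.
have cR : cintble mu (fun r => G r * cexp (- (w * r%:C) ^+ 2)).
  apply: (le_cintble (g := fun r : mR => C * expR (eta * L) * expR (- (r ^+ 2 / 2)))) => //.
  - rewrite (_ : (fun r => _) = (fun r => cint mu (fun x => Phi l (x, r)))); last first.
      apply/funext => r; rewrite /G -cintZr; last exact: cBt.
      apply: eq_cint => x; rewrite /Phi /= -[LHS]mulrA -cexpD [s x * (l * r)]mulrA.
      by [].
    apply: (cmeas_param mu (f := fun z : mR * mR => Phi l (z.2, z.1))).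
    have [h1 h2] := mPhi l.
    have msw : measurable_fun setT (fun z : mR * mR => (z.2, z.1)) by exact: measurable_swap.
    by split; [apply: (measurableT_comp h1 msw)|apply: (measurableT_comp h2 msw)].
  - by have := integrableZl measurableT (C * expR (eta * L)) (integrable_gauss2 R); apply: eq_integrable.
apply: le_trans (normc_cint cR) _.
apply: le_trans (_ : \int[mu]_r (C * expR (eta * L) * expR (- (r ^+ 2 / 2))) <= _).
  apply: le_Rintegral; [exact: measurableT|exact: integrable_normc| |by move=> r _; exact: GB].
  by have := integrableZl measurableT (C * expR (eta * L)) (integrable_gauss2 R); apply: eq_integrable.
rewrite RintegralZl; [|exact: measurableT|exact: integrable_gauss2].
by rewrite mulrAC.
Qed.

End Transfer.

(** * Mikusinski's argument *)

Section Mikusinski.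
Variable R : realType.
Notation mu := (@lebesgue_measure R).
Notation mR := (measurableTypeR R).
Variables (h phi : mR -> R) (Phi : R).
Hypothesis ih : mu.-integrable setT (EFin \o h).
Hypothesis mphi : measurable_fun setT phi.
Hypothesis hphi : forall x, h x != 0 -> 0 <= phi x <= Phi.
Hypothesis hB : forall eta : R, 0 < eta -> exists C, forall L, 0 < L ->
  `|\int[mu]_x (h x * expR (L * phi x))| <= C * expR (eta * L).

Let mh : measurable_fun setT h.
Proof. by have /measurable_EFinP := measurable_int _ ih. Qed.

Let ihe L : 0 <= L -> mu.-integrable setT (EFin \o (fun x => h x * expR (L * phi x))).
Proof.
move=> L0.
apply: (@le_integrable _ _ _ _ _ measurableT _ (EFin \o (fun x => expR (L * Phi) * h x))).
- apply/measurable_EFinP; apply: measurable_funM => //; apply: measurableT_comp => //.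
  exact: measurable_funM.
- move=> x _; rewrite /= lee_fin !normrM !(ger0_norm (expR_ge0 _)) mulrC.
  have [->|/hphi /andP[p0 pP]] := eqVneq (h x) 0; first by rewrite normr0 !mulr0.
  by rewrite ler_wpM2r// ler_expR ler_wpM2l.
- by have := integrableZl measurableT (expR (L * Phi)) ih; apply: eq_integrable.
Qed.

Lemma expR_partial_le (x : R) n : 0 <= x -> series (exp_coeff x) n <= expR x.
Proof.
move=> x0; apply: nondecreasing_cvgn_le.
- apply/nondecreasing_seqP => k; rewrite /series /= [leRHS]big_nat_recr//= lerDl.
  by rewrite /exp_coeff /= divr_ge0// exprn_ge0.
- exact: is_cvg_series_exp_coeff.
Qed.

(** The constant term is left out: the moments are bounded for L > 0 only, and without it the bound
    on the sum tends to 0. *)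
Let partial (x : R) n := \sum_(0 <= k < n) exp_coeff x k.+1.

Let partialE (x : R) n : partial x n = series (exp_coeff x) n.+1 - 1.
Proof.
by rewrite /series /= big_nat_recl// /exp_coeff /= expr0 divr1 [RHS]addrC addKr.
Qed.

Let partial_le (x : R) n : 0 <= x -> partial x n <= expR x - 1.
Proof. by move=> x0; rewrite partialE lerB// expR_partial_le. Qed.

Let partial_norm (x : R) n : 0 <= x -> `|partial (- x) n| <= partial x n.
Proof.
move=> x0; apply: le_trans (ler_norm_sum _ _ _) _; apply: ler_sum => k _.
rewrite /exp_coeff /= normrM normrX normrN !ger0_norm// ?invr_ge0//.
Qed.

Let cvg_partial (x : R) : partial x n @[n --> \oo] --> expR x - 1.
Proof.
under eq_fun do rewrite partialE.
apply: cvgB; last exact: cvg_cst.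
rewrite (cvg_shiftS (series (exp_coeff x))); exact: is_cvg_series_exp_coeff.
Qed.

Let z L y x := expR (L * (phi x - y)).

Let mz L y : measurable_fun setT (z L y).
Proof.
apply: measurableT_comp => //; apply: measurable_funM => //.
exact: measurable_funB.
Qed.

(** The k-th term of the expansion is (-1)^k e^(-k L y) / k! times the moment at k L. The hypothesis
    with eta = y / 2 bounds it by C e^(-k L y / 2) / k!, and these bounds sum to an exponential
    again. *)
Lemma mikusinski_bound y : 0 < y -> exists2 C, 0 <= C & forall L, 0 < L ->
  `|\int[mu]_x (h x * (expR (- z L y x) - 1))| <= C * (expR (expR (- (L * (y / 2)))) - 1).
Proof.
move=> y0; have y2 : 0 < y / 2 by rewrite divr_gt0.
have [C hC] := hB y2.
have C0 : 0 <= C.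
  have := hC 1 ltr01; move/(le_trans (normr_ge0 _)).
  by rewrite pmulr_lge0// expR_gt0.
exists C => // L L0; set w := expR (- (L * (y / 2))).
have w0 : 0 <= w by exact: expR_ge0.
have hk n : \int[mu]_x (h x * partial (- z L y x) n) =
    \sum_(0 <= k < n) ((-1) ^+ k.+1 * expR (- (k.+1%:R * L * y)) / k.+1`!%:R *
      \int[mu]_x (h x * expR (k.+1%:R * L * phi x))) /\
    mu.-integrable setT (EFin \o (fun x => h x * partial (- z L y x) n)).
  elim: n => [|n [IH ii]].
    rewrite big_geq//; split.
      under eq_Rintegral do rewrite /partial big_geq// mulr0.
      by rewrite Rintegral_cst// mul0r.
    apply: (eq_integrable _ (cst 0)%E) => //; last exact: integrable0.
    by move=> x _ /=; rewrite /partial big_geq// mulr0.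
  have kL : 0 <= n.+1%:R * L by rewrite mulr_ge0// ltW.
  have i1 := integrableZl measurableT ((-1) ^+ n.+1 * expR (- (n.+1%:R * L * y)) / n.+1`!%:R) (ihe kL).
  have E x : h x * partial (- z L y x) n.+1 = h x * partial (- z L y x) n +
     (-1) ^+ n.+1 * expR (- (n.+1%:R * L * y)) / n.+1`!%:R * (h x * expR (n.+1%:R * L * phi x)).
    rewrite /partial big_nat_recr//= mulrDr; congr (_ + _).
    rewrite /exp_coeff /= [(- z _ _ _) ^+ _]exprNn /z -expRM_natl.
    have -> : n.+1%:R * (L * (phi x - y)) = - (n.+1%:R * L * y) + n.+1%:R * L * phi x by ring.
    rewrite expRD; ring.
  split.
    rewrite big_nat_recr//= -IH -RintegralZl//; last exact: ihe.
    by rewrite -RintegralD//; apply: eq_Rintegral => x _; exact: E.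
  have := integrableD measurableT ii i1; apply: eq_integrable => // x _ /=.
  by rewrite E.
have bd n : `|\int[mu]_x (h x * partial (- z L y x) n)| <= C * (expR w - 1).
  have [-> _] := hk n.
  apply: le_trans (ler_norm_sum _ _ _) _.
  apply: le_trans (ler_wpM2l C0 (partial_le n w0)); rewrite /partial mulr_sumr.
  apply: ler_sum => k _.
  rewrite !normrM normrX normrN1 expr1n mul1r (ger0_norm (expR_ge0 _)) [`|_^-1|]ger0_norm ?invr_ge0//.
  have kL : 0 < k.+1%:R * L by rewrite mulr_gt0.
  apply: le_trans (ler_wpM2l _ (hC _ kL)) _; first by rewrite mulr_ge0 ?expR_ge0 ?invr_ge0.
  rewrite /exp_coeff /= /w -expRM_natl mulrCA -!mulrA ler_wpM2l//.
  rewrite mulrCA [leRHS]mulrC ler_wpM2l ?invr_ge0// -expRD ler_expR; lra.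
have [_ lim] : mu.-integrable setT (EFin \o (fun x => h x * (expR (- z L y x) - 1))) /\
  \int[mu]_x (h x * partial (- z L y x) n) @[n --> \oo] --> \int[mu]_x (h x * (expR (- z L y x) - 1)).
  apply: (@Rintegral_dominated _ _ _ mu (fun n x => h x * partial (- z L y x) n) _
    (EFin \o (fun x => expR (expR (L * Phi)) * `|h x|))).
  - move=> n; have [_ /measurable_int/measurable_EFinP] := hk n; exact.
  - apply: measurable_funM => //; apply: measurable_funB => //.
    by apply: measurableT_comp => //; apply: measurable_funN.
  - by apply: aeW => x; apply: cvgM; [exact: cvg_cst|exact: cvg_partial].
  - by have := integrableZl measurableT (expR (expR (L * Phi))) (integrable_norm ih); apply: eq_integrable.
  - apply: aeW => x n; rewrite lee_fin normrM mulrC.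
    have [->|/hphi /andP[p0 pP]] := eqVneq (h x) 0; first by rewrite normr0 !mulr0.
    rewrite ler_wpM2r//; apply: le_trans (partial_norm n (expR_ge0 _)) _.
    apply: le_trans (partial_le n (expR_ge0 _)) _.
    apply: le_trans (_ : expR (z L y x) <= _); first by rewrite lerBlDr lerDl.
    rewrite !ler_expR ler_wpM2l ?(ltW L0)//; lra.
have limN : `|\int[mu]_x (h x * partial (- z L y x) n)| @[n --> \oo] -->
  `|\int[mu]_x (h x * (expR (- z L y x) - 1))| by apply: cvg_norm.
rewrite -(cvg_lim (@Rhausdorff R) limN); apply: limr_le; first exact: cvgP limN.
by apply: nearW => n; exact: bd.
Qed.

Lemma cvg_expRN_nat (e : R) : 0 < e -> expR (- (n.+1%:R * e)) @[n --> \oo] --> (0 : R).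
Proof.
move=> e0; have g : expR (- e) ^+ n @[n --> \oo] --> (0 : R).
  by apply: cvg_expr; rewrite ger0_norm ?expR_ge0// -expR0 ltr_expR oppr_lt0.
rewrite -(cvg_shiftS (fun n => expR (- e) ^+ n)) in g.
by under eq_fun do rewrite -mulrN expRM_natl; exact: g.
Qed.

(** As L -> oo, e^(-z) - 1 tends boundedly to -1 where phi > y and to 0 where phi < y, while the
    bound of [mikusinski_bound] tends to 0. The level set phi = y has another limit and must be
    negligible. *)
Lemma mikusinski y : 0 < y -> {ae mu, forall x, h x != 0 -> phi x != y} ->
  \int[mu]_x (h x * (y < phi x)%R%:R) = 0.
Proof.
move=> y0 hy; have [C C0 hC] := mikusinski_bound y0.
have [iM lim] : mu.-integrable setT (EFin \o (fun x => h x * - (y < phi x)%R%:R)) /\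
  \int[mu]_x (h x * (expR (- z n.+1%:R y x) - 1)) @[n --> \oo] --> \int[mu]_x (h x * - (y < phi x)%R%:R).
  apply: (@Rintegral_dominated _ _ _ mu (fun n x => h x * (expR (- z n.+1%:R y x) - 1)) _
    (EFin \o (fun x => `|h x|))).
  - move=> n; apply: measurable_funM => //; apply: measurable_funB => //.
    by apply: measurableT_comp => //; apply: measurable_funN.
  - apply: measurable_funM => //; apply: measurable_funN => //.
    rewrite (_ : (fun x => _) = \1_[set x | y < phi x]); last first.
      by apply/funext => x; rewrite indicE; congr (nat_of_bool _)%:R; apply/idP/idP => [?|]; rewrite inE.
    apply: measurable_indic; rewrite (_ : [set x | y < phi x] = phi @^-1` `]y, +oo[).
      by rewrite -[X in measurable X]setTI; exact: mphi.
    by apply/seteqP; split => x /=; rewrite in_itv /= andbT.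
  - apply: filterS hy => x hx.
    have [->|/hx py] := eqVneq (h x) 0.
      by rewrite mul0r; under eq_fun do rewrite mul0r; exact: cvg_cst.
    apply: cvgM; first exact: cvg_cst.
    have [yp|yp] := ltP y (phi x).
    + suff : expR (- z n.+1%:R y x) - 1 @[n --> \oo] --> (0 - 1 : R) by rewrite add0r.
      apply: cvgB; last exact: cvg_cst.
      have d0 : 0 < phi x - y by rewrite subr_gt0.
      (* Here z >= 1 + (n + 1) (phi x - y), so e^(-z) lies below a geometric sequence. *)
      apply: (squeeze_cvgr _ (cvg_cst 0) (cvg_expRN_nat d0)).
      apply: nearW => n; rewrite expR_ge0/= /z expRN expRN ler_pV2 ?inE ?unitfE ?gt_eqF ?expR_gt0//.
      by apply: le_trans (expR_ge1Dx _); rewrite lerDr.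
    + have d0 : 0 < y - phi x by rewrite subr_gt0 lt_neqAle py.
      rewrite oppr0.
      have N0 : - expR (- (n.+1%:R * (y - phi x))) @[n --> \oo] --> (0 : R).
        by rewrite -oppr0; apply: cvgN; exact: cvg_expRN_nat.
      apply: (squeeze_cvgr _ N0 (cvg_cst 0)).
      apply: nearW => n; rewrite /z -mulrN opprB.
      rewrite subr_le0 -[X in _ && (_ <= X)]expR0 ler_expR oppr_le0 expR_ge0 andbT.
      by rewrite lerBrDr addrC; exact: expR_ge1Dx.
  - exact: (integrable_norm ih).
  - apply: aeW => x n; rewrite lee_fin normrM ler_piMr// ler_norml.
    have := expR_ge0 (- z n.+1%:R y x).
    have : expR (- z n.+1%:R y x) <= 1 by rewrite -[leRHS]expR0 ler_expR oppr_le0 expR_ge0.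
    by move=> h1 h2; apply/andP; split; lra.
have lim0 : \int[mu]_x (h x * (expR (- z n.+1%:R y x) - 1)) @[n --> \oo] --> (0 : R).
  apply/norm_cvg0P.
  have U : C * (expR (expR (- (n.+1%:R * (y / 2)))) - 1) @[n --> \oo] --> (0 : R).
    rewrite -(mulr0 C); apply: cvgM; first exact: cvg_cst.
    rewrite -(subrr 1); apply: cvgB; last exact: cvg_cst.
    rewrite -[X in _ --> X]expR0.
    apply: (@cvg_comp _ _ _ (fun n => expR (- (n.+1%:R * (y / 2)))) expR).
      by apply: cvg_expRN_nat; rewrite divr_gt0.
    exact: continuous_expR.
  apply: (squeeze_cvgr _ (cvg_cst 0) U).
  by apply: nearW => n; rewrite normr_ge0 hC.
have := cvg_unique (@Rhausdorff R) lim0 lim.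
under eq_Rintegral do rewrite -mulN1r mulrCA.
rewrite RintegralZl//.
  by move=> /(_ _)/esym/eqP; rewrite mulN1r oppr_eq0 => /eqP.
have := integrableZl measurableT (-1) iM; apply: eq_integrable => // x _ /=.
by rewrite -EFinM mulrN mulN1r opprK.
Qed.

End Mikusinski.

(** * Vanishing of a density from the growth of its transform *)

Section Uniqueness.
Variable R : realType.
Notation mu := (@lebesgue_measure R).
Notation mR := (measurableTypeR R).

(** On ]0, a[ the function (2 (a - t))^2 is decreasing, so its superlevel sets are the intervals ]0,
    x[. Hence the primitive of h vanishes there, and so does its derivative, which is h almost
    everywhere. *)
Lemma gauss_moments_eq0 (a : R) (h : mR -> R) : 0 < a -> mu.-integrable setT (EFin \o h) ->
  (forall x, h x != 0 -> 0 < x < a) ->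
  (forall eta : R, 0 < eta -> exists C, forall L, 0 < L ->
    `|\int[mu]_x (h x * expR (L * (2 * (a - x)) ^+ 2))| <= C * expR (eta * L)) ->
  {ae mu, forall x, h x = 0}.
Proof.
move=> a0 ih h0a hB.
have prim0 x : 0 < x < a -> \int[mu]_(t in `]-oo, x]) h t = 0.
  move=> /andP[x0 xa].
  have ax : 0 < a - x by rewrite subr_gt0.
  rewrite -Rintegral_itv_bndo_bndc; last by apply: integrableS ih.
  rewrite Rintegral_mkcond.
  pose phi (t : mR) := (2 * (a - t)) ^+ 2.
  have mphi : measurable_fun setT phi.
    apply: measurable_funX; apply: measurable_funM => //; exact: measurable_funB.
  have hphi t : h t != 0 -> 0 <= phi t <= (2 * a) ^+ 2.
    by move=> /h0a /andP[t0 ta]; rewrite sqr_ge0 /phi ler_sqr ?nnegrE; lra.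
  have y0 : 0 < phi x by rewrite exprn_gt0// mulr_gt0.
  have hy : {ae mu, forall t, h t != 0 -> phi t != phi x}.
    exists [set x]; split; [exact: measurable_set1|exact: lebesgue_measure_set1|].
    move=> t /= /not_implyP[/h0a /andP[t0 ta] /negP/negPn/eqP].
    move=> /eqP; rewrite eqf_sqr => /orP[] /eqP e; lra.
  rewrite -[RHS](mikusinski ih mphi hphi hB y0 hy).
  apply: eq_Rintegral => t _; rewrite patchE mem_setE.
  have [->|/h0a /andP[t0 ta]] := eqVneq (h t) 0; first by rewrite mul0r if_same.
  rewrite in_itv /= /phi ltr_sqr ?nnegrE; [|lra|lra].
  have -> : (2 * (a - x) < 2 * (a - t)) = (t < x) by rewrite ltr_pM2l// ltrD2l ltrN2.
  by case: ifP => _; rewrite ?mulr1 ?mulr0.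
have := ae_derive_primitive ih.
apply: filterS; first exact: (ae_filter_ringOfSetsType mu).
move=> x D; apply/eqP/negPn/negP => hx; have xa := h0a x hx.
have D0 : is_derive x 1 (cst 0 : R -> R) (h x).
  apply: near_eq_is_derive D; near=> t; apply: prim0.
  suff : t \in `]0, a[ by rewrite in_itv.
  by near: t; exact: near_in_itvoo.
by move: hx; rewrite -(@derive_val _ _ _ _ _ _ _ D0) derive_cst eqxx.
Unshelve. all: by end_near.
Qed.

Lemma laplace_ray_unique (a : R) (B : mR -> R[i]) : 0 < a -> cintble mu B ->
  (forall x, B x != 0 -> 0 < x < a) ->
  (forall eta : R, 0 < eta -> exists C T0, forall t : R, T0 < t ->
    normc (cint mu (fun x => B x * cexp ((2 * (a - x) * t)%:C * omega R))) <= C * expR (eta * t)) ->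
  {ae mu, forall x, B x = 0}.
Proof.
move=> a0 cB B0a hB.
pose s (x : mR) := 2 * (a - x).
have ms : measurable_fun setT s by apply: measurable_funM => //; exact: measurable_funB.
have S00 : 0 <= 2 * a by rewrite mulr_ge0// ltW.
have sB x : B x != 0 -> 0 <= s x <= 2 * a.
  by move=> /B0a /andP[x0 xa]; rewrite /s; apply/andP; split; lra.
(* The Gaussian integral runs over all real t. For t <= T0 the exponent has real part at most 2 a
   |T0| 41/40 <= 4 a |T0|, because s >= 0 on the support of B. *)
have hB' (eta : R) : 0 < eta -> exists C, forall t : R,
    normc (cint mu (fun x => B x * cexp ((s x * t)%:C * omega R))) <= C * expR (eta * `|t|).
  move=> eta0; have [C [T0 hC]] := hB eta eta0.
  pose K := \int[mu]_x (expR (4 * a * `|T0|) * normc (B x)).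
  have iB := integrable_normc cB.
  have iK := integrableZl measurableT (expR (4 * a * `|T0|)) iB.
  have K0 : 0 <= K by apply: Rintegral_ge0 => x _; rewrite mulr_ge0 ?expR_ge0 ?normc_ge0.
  exists (`|C| + K) => t.
  have [tT|tT] := ltP T0 t.
    apply: le_trans (hC _ tT) _; apply: le_trans (ler_wpM2r (expR_ge0 _) (ler_norm C)) _.
    apply: ler_pM; rewrite ?normr_ge0 ?expR_ge0 ?lerDl// ler_expR.
    by apply: ler_wpM2l; [exact: ltW|exact: ler_norm].
  have bnd x : normc (B x * cexp ((s x * t)%:C * omega R)) <= expR (4 * a * `|T0|) * normc (B x).
    rewrite normcM mulrC.
    have [->|/sB /andP[s0 sS]] := eqVneq (B x) 0; first by rewrite normc0 !mulr0.
    apply: ler_wpM2r; first exact: normc_ge0.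
    rewrite normc_cexp ler_expR.
    have -> : re ((s x * t)%:C * omega R) = s x * t * (41 / 40) by rewrite reM /= mul0r subr0.
    have h1 : s x * t <= s x * `|T0| := ler_wpM2l s0 (le_trans tT (ler_norm T0)).
    have h2 : s x * `|T0| <= 2 * a * `|T0| := ler_wpM2r (normr_ge0 T0) sS.
    have h3 : 0 <= 2 * a * `|T0| := mulr_ge0 S00 (normr_ge0 T0).
    lra.
  have cBt : cintble mu (fun x => B x * cexp ((s x * t)%:C * omega R)).
    apply: (le_cintble (g := fun x : mR => expR (4 * a * `|T0|) * normc (B x))) => //.
    apply: cmeasM; first exact: (cintble_meas cB).
    by apply: cmeas_cexp; apply: cmeasM; [apply: cmeasr; exact: measurable_funM|exact: cmeas_cst].
  apply: le_trans (normc_cint cBt) _.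
  apply: le_trans (_ : K <= _).
    by apply: le_Rintegral; [exact: measurableT|exact: integrable_normc|exact: iK|move=> x _; exact: bnd].
  apply: le_trans (_ : `|C| + K <= _); first by rewrite lerDr normr_ge0.
  rewrite ler_peMr ?addr_ge0 ?normr_ge0// -[leLHS]expR0 ler_expR.
  by rewrite mulr_ge0 ?normr_ge0// ltW.
have G := gauss_transfer cB ms S00 sB hB'.
(* The exponentials are now real, so the real and imaginary parts of B can be treated separately. *)
have key (f : R[i] -> R) : (forall z, `|f z| <= normc z) -> f 0 = 0 ->
    (forall g : mR -> R[i], f (cint mu g) = \int[mu]_x f (g x)) ->
    (forall z r, f (z * r%:C) = f z * r) -> mu.-integrable setT (fun x : mR => (f (B x))%:E) ->
    {ae mu, forall x, f (B x) = 0}.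
  move=> f1 f0 f2 f3 i; apply: (gauss_moments_eq0 a0 i).
    by move=> x fx; apply: B0a; apply: contraNneq fx => ->; rewrite f0.
  move=> eta eta0; have [C hC] := G eta eta0; exists C => L L0.
  apply: le_trans (hC L L0); apply: le_trans (f1 _); rewrite f2.
  by under [X in _ <= `|X|]eq_Rintegral do rewrite f3.
have [iB1 iB2] := cB.
have r1 (z : R[i]) r : re (z * r%:C) = re z * r by case: z => u v /=; rewrite mulr0 subr0.
have r2 (z : R[i]) r : im (z * r%:C) = im z * r by case: z => u v /=; rewrite mulr0 add0r.
have H1 := key (@complex.Re R) (@normr_re R) erefl (fun=> erefl) r1 iB1.
have H2 := key (@complex.Im R) (@normr_im R) erefl (fun=> erefl) r2 iB2.
apply: (@filterS2 _ _ (ae_filter_ringOfSetsType mu)) H1 H2 => x h1 h2.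
by apply/eqP; rewrite eq_complex h1 h2 !eqxx.
Qed.

End Uniqueness.

(** * The Laplace representation of the m-function *)

Section LaplaceRepresentation.
Variables (R : realType) (q : R -> R) (m : R[i] -> R[i]) (kappa : R).
Notation mu := (@lebesgue_measure R).
Notation mR := (measurableTypeR R).
Hypothesis hq : Linfty q.
Hypothesis hm : m_function q m.
Hypothesis kappa0 : 0 < kappa.
Hypothesis qk : (ess_norm q < (kappa ^+ 2)%:E)%E.

Let H := (`]0, +oo[%classic : set mR).
Let c := fine (ess_norm q).

Lemma ess_norm_ge0 : (0 <= ess_norm q)%E.
Proof. exact: Lnorm_ge0. Qed.

Let cE : ess_norm q = c%:E.
Proof. by rewrite fineK// ge0_fin_numE ?ess_norm_ge0//; case: hq. Qed.

Let c0 : 0 <= c.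
Proof. by rewrite -lee_fin -cE ess_norm_ge0. Qed.

Let ck : c < kappa ^+ 2.
Proof. by rewrite -lte_fin -cE. Qed.

Lemma ae_le_ess_norm : {ae mu, forall x, 0 < x -> `|q x| <= c}.
Proof.
(* The norm of index +oo unfolds to the essential supremum when the whole space has positive
   measure. *)
have muT : (0 < mu [set: mR])%E.
  apply: (@lt_le_trans _ _ (mu (`[0, 1]%classic : set mR))).
    by rewrite lebesgue_measure_itv /= lte_fin ltr01 -EFinB lte_fin subr0 ltr01.
  by apply: le_measure; rewrite ?inE.
have E : ess_norm q = ess_sup mu (abse \o (EFin \o (q \_ H))).
  by rewrite /ess_norm unlock /= muT.
have := ess_sup_ge mu (abse \o (EFin \o (q \_ H))); rewrite -E cE.
apply: filterS => x /= + x0; rewrite lee_fin patchE mem_set//.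
by rewrite /H /= in_itv /= x0.
Qed.

(** A representative that is bounded by c at every point and defined by 0 on x <= 0, as the
    construction needs pointwise bounds on the whole line. *)
Let q0 (x : mR) : R := if (0 < x) && (`|q x| <= c) then q x else 0.

Let qc x : `|q0 x| <= c.
Proof. by rewrite /q0; case: ifPn => [/andP[]//|_]; rewrite normr0. Qed.

Let qq0 : {ae mu, forall x, 0 < x -> q x = q0 x}.
Proof. move: ae_le_ess_norm; apply: filterS; first exact: (ae_filter_ringOfSetsType mu).
by move=> x h x0; rewrite /q0 x0 h. Qed.

Let mq : measurable_fun setT q0.
Proof.
have mH : measurable H by exact: measurable_itv.
have [mq _] := hq.
have mp : measurable_fun setT (q \_ H) by apply/(measurable_restrictT _ mH).
have ms : measurable [set x : mR | `|(q \_ H) x| <= c].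
  rewrite (_ : [set x | _] = (fun x => `|(q \_ H) x|) @^-1` `]-oo, c]).
    rewrite -[X in measurable X]setTI.
    by apply: (measurableT_comp (@normr_measurable R setT) mp) => //; exact: measurable_itv.
  by apply/seteqP; split => x /=; rewrite in_itv.
rewrite (_ : q0 = (fun x => (q \_ H) x * \1_[set x : mR | `|(q \_ H) x| <= c] x)).
  by apply: measurable_funM => //; exact: measurable_indic.
apply/funext => x; rewrite /q0 indicE patchE.
have -> : (x \in H) = (0 < x) by rewrite /H mem_setE in_itv /= andbT.
have [x0|x0] := ltP 0 x; last by rewrite mul0r.
have -> : (x \in [set x : mR | `|(q \_ H) x| <= c]) = (`|q x| <= c).
  have e : (q \_ H) x = q x by rewrite patchE mem_set// /H /= in_itv /= x0.
  by apply/idP/idP; rewrite inE /= e.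
by rewrite andTb; case: (_ <= _); rewrite ?mulr1 ?mulr0.
Qed.

(* The smaller root of M^2 - 2 kappa M + c = 0. *)
Let M := kappa - Num.sqrt (kappa ^+ 2 - c).

Let d0 : 0 < Num.sqrt (kappa ^+ 2 - c).
Proof. by rewrite sqrtr_gt0 subr_gt0. Qed.

Let Mkappa : M < kappa.
Proof. by rewrite /M ltrBlDr ltrDl. Qed.

Let M0 : 0 <= M.
Proof.
rewrite subr_ge0 -[leRHS]ger0_norm ?(ltW kappa0)// -sqrtr_sqr ler_wsqrtr//.
by rewrite gerBl.
Qed.

Let cM : c + M ^+ 2 <= 2 * kappa * M.
Proof.
have := @sqr_sqrtr R (kappa ^+ 2 - c); rewrite subr_ge0 (ltW ck) => /(_ erefl).
by rewrite /M; set s := Num.sqrt _; rewrite !expr2; nra.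
Qed.

(** Here f is A0 with its weight, f a = e^(-2 kappa a) A0 a. It is therefore integrable, and only k
    - kappa is left in the exponent. *)
Lemma m_function_laplace : exists f : mR -> R,
  [/\ mu.-integrable setT (EFin \o f), forall x, x <= 0 -> f x = 0 &
    forall k : R[i], kappa <= re k -> off_ray q (- k ^+ 2) ->
      m (- k ^+ 2) = - k - cint mu (fun a => cexp (- (2 * a)%:C * (k - kappa%:C)) * (f a)%:C)].
Proof.
have mA := mfun2_amplitude kappa0 c0 mq qc.
have lA := l1bound_amplitude kappa0 c0 mq qc M0 cM.
have iA := l1bound_integrable 0 mA lA.
have mf : measurable_fun setT (fun a : mR => \1_H a * amplitude kappa q0 a 0).
  apply: measurable_funM; first by apply: measurable_indic; exact: measurable_itv.
  exact: mfun2_1.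
(* Causality covers a < 0; the indicator also clears the point 0. *)
exists (fun a => \1_H a * amplitude kappa q0 a 0); split.
- apply: le_integrable iA => //; first exact/measurable_EFinP.
  move=> x _; rewrite /= lee_fin normrM indicE.
  by case: (x \in H); rewrite ?normr1 ?normr0 ?mul1r ?mul0r.
- by move=> x x0; rewrite indicE /H mem_setE in_itv /= andbT ltNge x0 mul0r.
move=> k kk off; pose chi (a : mR) := cexp (- (2 * a)%:C * (k - kappa%:C)).
have mchi : cmeas chi.
  apply: cmeas_cexp; apply: cmeasM; last exact: cmeas_cst.
  by apply: cmeasN; apply: cmeasr; exact: measurable_funM.
have -> : cint mu (fun a : mR => chi a * (\1_H a * amplitude kappa q0 a 0)%:C) =
    laplace chi (amplitude kappa q0) 0.
  apply: ae_eq_cint; [by apply: cmeasM => //; exact: cmeasr|exact: cmeas_chi|].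
  exists [set 0]; split; [exact: measurable_set1|exact: lebesgue_measure_set1|].
  move=> x /= h; apply: contrapT => /eqP x0; apply: h.
  rewrite indicE /H mem_setE in_itv /= andbT.
  have [xp|xn|x00] := ltgtP 0 x; first by rewrite mul1r.
    by rewrite (causal_amplitude kappa0 c0 mq qc)// mulr0.
  by move: x0; rewrite x00 eqxx.
have chiD a b : chi (a + b) = chi a * chi b.
  have e : - (2 * (a + b))%:C = - (2 * a)%:C + - (2 * b)%:C :> R[i].
    by rewrite mulrDr rmorphD opprD.
  by rewrite /chi e mulrDl cexpD.
have reE a : re (- (2 * a)%:C * (k - kappa%:C)) = - (2 * a * (re k - kappa)).
  by case: (k) => u v; rewrite reM reN imN /=; ring.
have chi_le1 a : 0 <= a -> normc (chi a) <= 1.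
  move=> a0; rewrite normc_cexp reE -[leRHS]expR0 ler_expR oppr_le0.
  by rewrite !mulr_ge0// subr_ge0.
have pchi (e : mR) : (pexp kappa e)%:C * chi e =
    (\1_(`[0, +oo[%classic : set R) e)%:C * cexp (- (2 * e)%:C * k).
  rewrite /pexp indicE mem_setE in_itv /= andbT.
  case: ifP => _; last by rewrite !mul0r.
  rewrite mul1r /chi -cexpr -cexpD; congr cexp.
  by rewrite rmorphN !rmorphM /=; ring.
pose F := laplace chi (amplitude kappa q0).
have Ffix x : F x = cint mu (fun e : mR =>
    (\1_(`[0, +oo[%classic : set R) e)%:C * cexp (- (2 * e)%:C * k) * ((q0 (x + e))%:C - F (x + e) ^+ 2)).
  rewrite /F (laplace_amplitude_fix kappa0 c0 mq qc M0 cM mchi chiD chi_le1).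
  by apply: eq_cint => e; rewrite pchi.
have FM := normc_laplace_amplitude kappa0 c0 mq qc M0 cM mchi chi_le1.
have mF := cmeas_laplace_amplitude kappa0 c0 mq qc mchi.
have k0 : 0 < re k := lt_le_trans kappa0 kk.
have Mk : M < re k := lt_le_trans Mkappa kk.
(* [hm] evaluates m on any Weyl solution, in particular on the one constructed from F. *)
rewrite (hm off (weyl_solutionP c0 mq qc k0 Mk mF FM Ffix qq0)).
exact: (weyl_quotient c0 mq qc k0 Mk mF FM Ffix).
Qed.

End LaplaceRepresentation.

(** * The ray spanned by omega *)

Section Ray.
Variable R : realType.

Lemma omega_polar : exists r theta : R, [/\ 0 < r, - (pi / 2) < theta, theta < 0 &
  omega R = (r * cos theta) +i* (r * sin theta)].
Proof.
pose x : R := - (9 / 41).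
have c0 : 0 < cos (atan x) by apply: cos_gt0_pihalf; rewrite atan_gtNpi2 atan_ltpi2.
exists (41 / 40 / cos (atan x)), (atan x); split.
- by rewrite divr_gt0.
- exact: atan_gtNpi2.
- by rewrite -atan0; apply: lt_atan; rewrite /x; lra.
have cN : cos (atan x) != 0 by rewrite gt_eqF.
have s : sin (atan x) = x * cos (atan x) by rewrite -{2}(atanK x) /tan divfK.
rewrite divfK// s [x * _]mulrC mulrA divfK// /omega /x; congr (_ +i* _); lra.
Qed.

Lemma omega_sector : exists2 eps : R, 0 < eps & forall t, 0 < t -> sector eps (t%:C * omega R).
Proof.
have [r [theta [r0 th1 th2 E]]] := omega_polar.
(* Half the angular distance from omega to the sides of the quadrant. *)
exists (Num.min (- theta) (theta + pi / 2) / 2).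
  by rewrite divr_gt0// lt_min oppr_gt0 th2 -(opprK (pi / 2)) subr_gt0.
move=> t t0; exists (t * r), theta; split.
- exact: mulr_gt0.
- have : Num.min (- theta) (theta + pi / 2) <= theta + pi / 2 by rewrite ge_min lexx orbT.
  by set u := Num.min _ _; lra.
- have : Num.min (- theta) (theta + pi / 2) <= - theta by rewrite ge_min lexx.
  by set u := Num.min _ _; lra.
- by rewrite E -!mulrA; apply/eqP; rewrite eq_complex !(reM, imM) /= !mul0r subr0 addr0 !eqxx.
Qed.

Lemma off_ray_omega (q : R -> R) (t : R) : 0 < t -> off_ray q (- (t%:C * omega R) ^+ 2).
Proof.
move=> t0 [+ _]; rewrite exprMn omega2 imN imM -rmorphXn /= => /eqP.
by rewrite mul0r addr0 oppr_eq0 mulf_eq0 sqrf_eq0 (gt_eqF t0) /= => /eqP; lra.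
Qed.

Lemma off_ray_real (q : R -> R) (kappa : R) : (ess_norm q < (kappa ^+ 2)%:E)%E ->
  off_ray q (- kappa%:C ^+ 2).
Proof.
move=> qk [_]; rewrite -rmorphXn reN /= EFinN leeN2 => h.
by have := lt_le_trans qk h; rewrite ltxx.
Qed.

End Ray.

Section TildeO.
Variable R : realType.

(** The limit gives |f / g| |g|^eta < 1 for large k in the sector; multiplying by |g| yields the
    form used below. *)
Lemma tildeO_bound (eps eta : R) (f g : R[i] -> R[i]) : tildeO (sector_infty eps) f g ->
  (forall k, g k != 0) -> 0 < eta ->
  exists N, forall k, sector eps k -> N < normc k -> normc (f k) * normc (g k) `^ eta <= normc (g k).
Proof.
move=> [_ H] g0 eta0.
have : nbhs (0 : R[i]^o) [set z : R[i] | normc z < 1].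
  apply/nbhs_ballP; exists 1 => //= z.
  by rewrite /ball /= sub0r normrN => h; rewrite -ltcR.
move=> /(H eta eta0) [N _ hN]; exists N => k sk Nk.
have /= := hN k (conj sk Nk).
have gn : 0 < normc (g k) by rewrite lt_neqAle normc_ge0 andbT eq_sym; apply: contra (g0 k) => /eqP /eq0_normc ->.
rewrite !normcM normcr ger0_norm ?powR_ge0// normcV mulrAC ltr_pdivrMr// mul1r.
exact: ltW.
Qed.

End TildeO.

Section ComplexIntegrableAE.
Context d (T : measurableType d) (R : realType) (mu : {measure set T -> \bar R}).

Lemma cintble_mul_le1 (f e : T -> R[i]) : cintble mu f -> cmeas e ->
  (forall x, f x != 0 -> normc (e x) <= 1) -> cintble mu (fun x => f x * e x).
Proof.
move=> cf me e1; apply: (le_cintble (g := fun x => normc (f x))).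
- by apply: cmeasM => //; exact: cintble_meas cf.
- exact: integrable_normc.
- move=> x; rewrite normcM; have [->|/e1 h] := eqVneq (f x) 0; first by rewrite normc0 mul0r.
  by rewrite ler_piMr// normc_ge0.
Qed.

Lemma ae_eq_cintble (f g : T -> R[i]) : cmeas f -> cintble mu g -> {ae mu, forall x, f x = g x} ->
  cintble mu f.
Proof.
move=> [f1 f2] [g1 g2] fg.
have [mg1 mg2] := cintble_meas (conj g1 g2).
have K (u v : T -> R) : measurable_fun setT u -> measurable_fun setT v ->
    mu.-integrable setT (EFin \o v) -> {ae mu, forall x, u x = v x} -> mu.-integrable setT (EFin \o u).
  move=> mu_ mv iv uv; apply/integrableP; split; first exact/measurable_EFinP.
  have /integrableP[_] := iv; apply: le_lt_trans.
  rewrite le_eqVlt; apply/orP; left; apply/eqP.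
  apply: ge0_ae_eq_integral => //.
  - by apply: measurableT_comp => //; exact/measurable_EFinP.
  - by apply: measurableT_comp => //; exact/measurable_EFinP.
  - by apply: filterS uv => x h _ /=; rewrite h.
split.
- apply: (K _ (fun x => re (g x))) => //.
  by apply: filterS fg => x ->.
- apply: (K _ (fun x => im (g x))) => //.
  by apply: filterS fg => x ->.
Qed.

End ComplexIntegrableAE.

Section ComplexIntegrable.
Variable R : realType.
Notation mu := (@lebesgue_measure R).
Notation mR := (measurableTypeR R).

Lemma cintegrableP (D : set R) (f : mR -> R[i]) : measurable (D : set mR) ->
  cintegrable D f <-> cintble mu (fun x => (\1_D x)%:C * f x).
Proof.
move=> mD.
have E (p : R[i] -> R) : (forall z, p (0%:C * z) = 0) -> (forall z, p (1%:C * z) = p z) ->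
    (fun x => (p (f x))%:E) \_ D = (fun x => (p ((\1_D x)%:C * f x))%:E).
  move=> p0 p1; apply/funext => x; rewrite patchE indicE.
  by case: (x \in D); rewrite ?p0 ?p1.
have E1 := E (@complex.Re R); have E2 := E (@complex.Im R).
have z1 (z : R[i]) : 1%:C * z = z by exact: mul1r.
have z0 (z : R[i]) : 0%:C * z = 0 by exact: mul0r.
have {}E1 : (fun x => (re (f x))%:E) \_ D = (fun x => (re ((\1_D x)%:C * f x))%:E).
  by apply: E1 => z; rewrite ?z0 ?z1.
have {}E2 : (fun x => (im (f x))%:E) \_ D = (fun x => (im ((\1_D x)%:C * f x))%:E).
  by apply: E2 => z; rewrite ?z0 ?z1.
rewrite /cintegrable /cintble -E1 -E2; split=> -[i1 i2]; split.
- by move/(integrable_mkcond _ mD): i1.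
- by move/(integrable_mkcond _ mD): i2.
- by apply/(integrable_mkcond _ mD).
- by apply/(integrable_mkcond _ mD).
Qed.

End ComplexIntegrable.

(** * Identification of A with the constructed amplitude *)

Section Identification.
Variables (R : realType) (q : R -> R) (m : R[i] -> R[i]) (A : R -> R[i]) (kappa : R).
Notation mu := (@lebesgue_measure R).
Notation mR := (measurableTypeR R).
Hypothesis kappa0 : 0 < kappa.
Hypothesis hA : A_amplitude m A.
Variable f : mR -> R.
Hypothesis fi : mu.-integrable setT (EFin \o f).
Hypothesis f0 : forall x, x <= 0 -> f x = 0.
Hypothesis hf : forall k : R[i], kappa <= re k -> off_ray q (- k ^+ 2) ->
  m (- k ^+ 2) = - k - cint mu (fun a => cexp (- (2 * a)%:C * (k - kappa%:C)) * (f a)%:C).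

Let e (k : R[i]) (x : mR) : R[i] := cexp (- (2 * x)%:C * k).

Let me k : cmeas (e k).
Proof.
apply: cmeas_cexp; apply: cmeasM; last exact: cmeas_cst.
by apply: cmeasN; apply: cmeasr; exact: measurable_funM.
Qed.

Let normc_e k x : normc (e k x) = expR (- (2 * x * re k)).
Proof. by rewrite normc_cexp; case: k => u v; rewrite reM reN imN /=; congr expR; ring. Qed.

Let e_le1 k x : 0 <= re k -> 0 <= x -> normc (e k x) <= 1.
Proof.
by move=> k0 x0; rewrite normc_e -[leRHS]expR0 ler_expR oppr_le0 !mulr_ge0.
Qed.

Let cf : cintble mu (fun x => (f x)%:C).
Proof. by split; [exact: fi|exact: integrable0]. Qed.

Let mf : measurable_fun setT f.
Proof. by have /measurable_EFinP := measurable_int _ fi. Qed.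

(** Undoes the weight e^(-2 kappa x) carried by f. *)
Let A0 (x : mR) : R[i] := (expR (2 * kappa * x) * f x)%:C.

Let A0E k x : A0 x * e k x = (f x)%:C * e (k - kappa%:C) x.
Proof.
rewrite /A0 /e [expR _ * _]mulrC rmorphM /= -[LHS]mulrA; congr (_ * _).
rewrite -cexpr -cexpD; congr cexp.
by rewrite !rmorphM /=; ring.
Qed.

(** On the ray k = t omega the exact representation is subtracted from the asymptotics of A. The
    part of A0 beyond a is the tail [T], of size e^(-2 a (re k - kappa)). Multiplying by e^(2 a k)
    leaves the transform of B with exponent 2 (a - x) k, of growth at most e^(eta t). *)
Lemma amplitude_unique (a : R) : 0 < a -> {ae mu, forall x : mR, 0 < x < a -> A x = A0 x}.
Proof.
move=> a0; pose D := (`]0, a[%classic : set mR).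
have mD : measurable D by exact: measurable_itv.
have D1 x : \1_D x = (0 < x < a)%R%:R :> R by rewrite indicE /D mem_setE in_itv.
have [/(_ a a0) Ai hO] := hA.
have cA : cintble mu (fun x => (\1_D x)%:C * A x) by exact: (cintegrableP A mD).1.
have cA0 : cintble mu (fun x => (\1_D x)%:C * A0 x).
  apply: (le_cintble (g := fun x : mR => expR (2 * kappa * a) * `|f x|)).
  - apply: cmeasM; first by apply: cmeasr; exact: measurable_indic.
    apply: cmeasr; apply: measurable_funM => //; apply: measurableT_comp => //.
  - by have := integrableZl measurableT (expR (2 * kappa * a)) (integrable_norm fi); apply: eq_integrable.
  - move=> x; rewrite normcM !normcr normrM D1 (ger0_norm (expR_ge0 _)).
    case: andP => [[x0 xa]|_]; last by rewrite normr0 mul0r mulr_ge0 ?expR_ge0.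
    rewrite normr1 mul1r ler_wpM2r// ler_expR ler_wpM2l ?ltW// mulr_gt0//.
pose B (x : mR) := (\1_D x)%:C * A x - (\1_D x)%:C * A0 x.
have cB : cintble mu B by exact: cintbleB.
have B0a x : B x != 0 -> 0 < x < a.
  by rewrite /B D1; case: (0 < x < a)%R => //; rewrite !mul0r subrr eqxx.
suff : {ae mu, forall x, B x = 0}.
  by apply: filterS => x + xa; rewrite /B D1 xa !mul1r => /eqP; rewrite subr_eq0 => /eqP.
apply: (laplace_ray_unique a0 cB B0a) => eta eta0.
have [eps eps0 sec] := omega_sector R.
(* Since re k = 41/40 t, this makes |e^(-2 a k)|^eta' = e^(- eta t). *)
pose eta' := eta / (2 * a * (41 / 40)).
have eta'0 : 0 < eta' by rewrite divr_gt0// !mulr_gt0.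
have [N hN] := tildeO_bound (hO a eps a0 eps0) (fun k => cexp_neq0 _) eta'0.
pose If := \int[mu]_x `|f x|.
(* The 1 comes from the asymptotics and the other summand from the tail; t > max(kappa, N) ensures
   re k >= kappa and |k| > N. *)
exists (1 + expR (2 * a * kappa) * If), (Num.max kappa N) => t.
rewrite gt_max => /andP[kt Nt].
have t0 : 0 < t := lt_trans kappa0 kt.
pose k := t%:C * omega R.
have rek : re k = 41 / 40 * t by rewrite /k reM /= mul0r subr0 mulrC.
have kk : kappa <= re k by rewrite rek; lra.
have k0 : 0 <= re k by rewrite (le_trans _ kk)// ltW.
have Nk : N < normc k.
  by apply: lt_le_trans (re_le_normc k); rewrite rek; apply: lt_trans Nt _; lra.
have off : off_ray q (- k ^+ 2) := off_ray_omega t0.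
have := hN k (sec t t0) Nk.
rewrite (hf kk off) cintegral_indic.
set g := normc (cexp _).
pose C1 := cint mu (fun x => (\1_D x)%:C * A x * e k x).
pose C2 := cint mu (fun x => (\1_D x)%:C * A0 x * e k x).
pose T (x : mR) := (1 - \1_D x)%:C * ((f x)%:C * e (k - kappa%:C) x).
have De1 (h : mR -> R[i]) x : (\1_D x)%:C * h x != 0 -> normc (e k x) <= 1.
  rewrite D1; case: andP => [[x0 _] _|]; last by rewrite mul0r eqxx.
  by apply: e_le1 => //; exact: ltW.
have cAe := cintble_mul_le1 cA (me k) (De1 A).
have cA0e := cintble_mul_le1 cA0 (me k) (De1 A0).
have cfe : cintble mu (fun x => (f x)%:C * e (k - kappa%:C) x).
  apply: (cintble_mul_le1 cf) => // x fx; apply: e_le1.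
    by case: (k) kk => u v /=; rewrite subr_ge0.
  by rewrite leNgt; apply: contra fx => x0; rewrite f0// ltW.
have cT : cintble mu T.
  apply: (le_cintble (g := fun x => normc ((f x)%:C * e (k - kappa%:C) x))).
  - apply: cmeasM; last exact: cintble_meas cfe.
    by apply: cmeasr; apply: measurable_funB => //; exact: measurable_indic.
  - exact: integrable_normc.
  - move=> x; rewrite normcM normcr D1 ler_piMl ?normc_ge0//.
    by case: (_ < _ < _)%R; rewrite ?subrr ?subr0 ?normr0 ?normr1.
have E1 : cint mu (fun x => cexp (- (2 * x)%:C * (k - kappa%:C)) * (f x)%:C) = C2 + cint mu T.
  rewrite /C2 -cintD//; apply: eq_cint => x.
  rewrite /T -mulrA A0E -mulrDl -rmorphD /= [\1_D x + _]addrC subrK mul1r mulrC.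
  by [].
have E2 : cint mu (fun x => (\1_D x)%:C * (A x * cexp (- (2 * x)%:C * k))) = C1.
  by apply: eq_cint => x; rewrite mulrA.
have E3 : cint mu (fun x => B x * cexp ((2 * (a - x) * t)%:C * omega R)) =
    cexp ((2 * a)%:C * k) * (C1 - C2).
  rewrite /C1 /C2 -cintB// -cintZ; last exact: cintbleB.
  apply: eq_cint => x; rewrite /B -mulrBl mulrCA mulrC [RHS]mulrC; congr (_ * _).
  rewrite /e -cexpD; congr cexp.
  by rewrite /k !rmorphM rmorphB /=; ring.
rewrite E1 E2 E3 normcM normc_cexp.
have -> : - k - (C2 + cint mu T) - (- k - C1) = C1 - C2 - cint mu T by ring.
have gE : g = expR (- (2 * a * re k)).
  by rewrite /g normc_cexp; case: (k) => u v; rewrite reM reN imN /=; congr expR; ring.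
have re2 : re ((2 * a)%:C * k) = 2 * a * re k by case: (k) => u v; rewrite reM /=; ring.
have gp : g `^ eta' = expR (- (eta * t)).
  rewrite gE -expRM; congr expR; rewrite rek /eta'; field.
  by rewrite gt_eqF.
rewrite re2 gp => hb.
have hT : normc (cint mu T) <= expR (- (2 * a * (re k - kappa))) * If.
  apply: le_trans (normc_cint cT) _.
  rewrite /If -RintegralZl//; last exact: (integrable_norm fi).
  apply: le_Rintegral => //; first exact: integrable_normc.
    by have := integrableZl measurableT (expR (- (2 * a * (re k - kappa)))) (integrable_norm fi); apply: eq_integrable.
  move=> x _; rewrite /T !normcM !normcr D1.
  have [x0|x0] := leP x 0; first by rewrite f0// normr0 mul0r !mulr0.
  have [xa|xa] := ltP x a; first by rewrite subrr normr0 mul0r mulr_ge0 ?expR_ge0.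
  rewrite subr0 normr1 mul1r mulrC ler_wpM2r// normc_e ler_expR.
  have -> : re (k - kappa%:C) = re k - kappa by rewrite reD reN.
  by rewrite lerN2 ler_wpM2r ?subr_ge0// ler_pM2l.
have gK : expR (2 * a * re k) * g = 1 by rewrite gE -expRD subrr expR0.
have h1 : normc (C1 - C2) <= normc (C1 - C2 - cint mu T) + normc (cint mu T).
  by rewrite -{1}(subrK (cint mu T) (C1 - C2)); exact: normcD.
have h2 : expR (2 * a * re k) * normc (C1 - C2 - cint mu T) <= expR (eta * t).
  have := ler_wpM2l (expR_ge0 (2 * a * re k)) hb; rewrite gK mulrA.
  by rewrite -{2}(expR0 R) -(subrr (eta * t)) expRD ler_pM2r ?expR_gt0.
have h3 : expR (2 * a * re k) * normc (cint mu T) <= expR (2 * a * kappa) * If.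
  apply: le_trans (ler_wpM2l (expR_ge0 _) hT) _; rewrite mulrA -expRD.
  by rewrite (_ : 2 * a * re k + _ = 2 * a * kappa)//; ring.
have If0 : 0 <= If by apply: Rintegral_ge0.
have h4 : expR (2 * a * kappa) * If <= expR (2 * a * kappa) * If * expR (eta * t).
  by rewrite ler_peMr ?mulr_ge0 ?expR_ge0// -[leLHS]expR0 ler_expR mulr_ge0 ?ltW.
have h5 := ler_wpM2l (expR_ge0 (2 * a * re k)) h1.
rewrite [leRHS]mulrDl mul1r; apply: le_trans h5 _; rewrite [leLHS]mulrDr.
exact: lerD h2 (le_trans h3 h4).
Qed.

Lemma amplitude_unique_half_line : {ae mu, forall x : mR, 0 < x -> A x = A0 x}.
Proof.
have h : {ae mu, forall x : mR, forall n : nat, 0 < x < n.+1%:R -> A x = A0 x}.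
  by apply/ae_foralln => n; exact: amplitude_unique.
apply: filterS h => x h x0; apply: (h (Num.truncn x)); rewrite x0 /=; exact: truncnS_gt.
Qed.

Let g (x : R) := A x * cexp (- (2 * x * kappa)%:C).

(** Almost everywhere A = A0 on the half-line, so the factor e^(-2 kappa x) restores f; the integral
    converges because f is integrable. *)
Lemma laplace_amplitude_real : cintegrable `]0, +oo[ g /\ cintegral `]0, +oo[ g = cint mu (fun x => (f x)%:C).
Proof.
pose H := (`]0, +oo[%classic : set mR).
have mH : measurable H by exact: measurable_itv.
(* A is given as measurable on bounded intervals only; these exhaust the half-line. *)
have HE : H = \bigcup_n (`]0, n.+1%:R[%classic : set mR).
  apply/seteqP; split => x; rewrite /H /=.
    rewrite in_itv /= andbT => x0; exists (Num.truncn x) => //=.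
    by rewrite in_itv /= x0 /= truncnS_gt.
  by move=> [n _] /=; rewrite !in_itv /= andbT => /andP[].
have [Ai _] := hA.
have mA : cmeas (fun x : mR => (\1_H x)%:C * A x).
  have K (p : R[i] -> R) : (forall z, p (0%:C * z) = 0) -> (forall z, p (1%:C * z) = p z) ->
      (forall n, measurable_fun (`]0, n.+1%:R[%classic : set mR) (fun x => p (A x))) ->
      measurable_fun setT (fun x : mR => p ((\1_H x)%:C * A x)).
    move=> p0 p1 mp; rewrite (_ : (fun x => _) = (fun x => p (A x)) \_ H).
      apply/(measurable_restrictT _ mH); rewrite HE.
      by apply/measurable_fun_bigcup => // n; exact: measurable_itv.
    by apply/funext => x; rewrite patchE indicE; case: (x \in H); rewrite ?p0 ?p1.
  have z1 (z : R[i]) : 1%:C * z = z by exact: mul1r.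
  have z0 (z : R[i]) : 0%:C * z = 0 by exact: mul0r.
  split; apply: K => [z|z|n]; rewrite ?z0 ?z1//.
  - by have [/measurable_int/measurable_EFinP] := Ai n.+1%:R (ltr0Sn _ _).
  - by have [_ /measurable_int/measurable_EFinP] := Ai n.+1%:R (ltr0Sn _ _).
have mg : cmeas (fun x : mR => (\1_H x)%:C * g x).
  rewrite (_ : (fun x => _) = (fun x => (\1_H x)%:C * A x * cexp (- (2 * x * kappa)%:C))).
    apply: cmeasM => //; apply: cmeas_cexp; apply: cmeasN; apply: cmeasr.
    by apply: measurable_funM => //; exact: measurable_funM.
  by apply/funext => x; rewrite mulrA.
have gf : {ae mu, forall x : mR, (\1_H x)%:C * g x = (f x)%:C}.
  apply: filterS amplitude_unique_half_line => x hx; rewrite indicE /H mem_setE in_itv /= andbT.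
  have [x0|x0] := ltP 0 x; last by rewrite f0// mul0r.
  rewrite mul1r /g hx// /A0 rmorphM /= mulrAC -rmorphN -!cexpr -cexpD -rmorphD /=.
  by rewrite (_ : 2 * kappa * x + _ = 0) ?cexp0 ?mul1r//; ring.
split; first by exact: (cintegrableP g mH).2 (ae_eq_cintble mg cf gf).
by rewrite cintegral_indic; exact: ae_eq_cint mg (cintble_meas cf) gf.
Qed.

End Identification.

Theorem theorem10p3 (R : realType) (q : R -> R) (m : R[i] -> R[i])
    (A : R -> R[i]) (kappa : R) :
  Linfty q -> m_function q m -> A_amplitude m A ->
  0 < kappa -> (ess_norm q < (kappa ^+ 2)%:E)%E ->
  let f := fun x : R => A x * cexp (- (2 * x * kappa)%:C) in
  cintegrable `]0, +oo[ f /\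
  m (- (kappa ^+ 2)%:C) = - kappa%:C - cintegral `]0, +oo[ f.
Proof.
move=> hq hm hA kappa0 qk g.
have [f [fi f0 hf]] := m_function_laplace hq hm kappa0 qk.
have [gi ->] := laplace_amplitude_real kappa0 hA fi f0 hf.
split => //.
have off : off_ray q (- kappa%:C ^+ 2) := off_ray_real qk.
(* At k = kappa the exponent k - kappa vanishes, and the representation reduces to the integral of
   f. *)
have := hf kappa%:C (lexx _) off; rewrite -rmorphXn /= => ->; congr (_ - _).
by apply: eq_cint => x; rewrite subrr mulr0 cexp0 mul1r.
Qed.
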